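(* Let $\bar\lambda>0$ be as in the context and assume that $|\lambda_1|,|\lambda_2|\le\bar\lambda$ are sufficiently small so that $1-|\lambda_1|\delta>0$, $\gamma_3-|\gamma_4|\delta>0$ and $1-|\lambda_2|\delta>0$. Assume that the time step satisfies $\frac{6C^2\mathcal D_4}{\nu\varrho}\Delta t\le1$. Let $p_h$ be the step function defined by $p_h(t)=p_h^i$ for $t\in]t_{i-1},t_i]$, $1\le i\le N$, where $p_h^i$ are the discrete pressures of the fully discrete scheme of the context. Then $p_h\in W^{-1,\infty}(0,T;L^2_0(\Omega))$ with $$\|p_h\|_{W^{-1,\infty}(0,T;L^2(\Omega))}\le3\Big(C_3+C_4\big(C_1\exp(C_2T)\big)^{1/2}\Big),$$ where $$C_1:=\|\mathbf v_h^0\|^2_{L^2(\Omega)}+\frac{3C^2\mathcal D_3}{\nu\varrho}\|\mathbf u_h^0\|^2_{L^2(\Omega)},\qquad C_2:=\frac{9C^2\mathcal D_4}{\nu\varrho},$$ $$C_3:=\frac1{\beta^*}\mathcal P\big(\varrho\|\mathbf v_h^0\|_{L^2(\Omega)}+2\alpha\|\mathbf u_h^0\|_{L^2(\Omega)}\big),\qquad C_4:=\frac{\mathcal P}{\beta^*}\Big(\alpha\mathcal P\mathcal K\Big(\frac{E_1\varrho}{2\gamma_1}\Big)^{1/2}+\varrho\Big(1+\frac T\varrho\Big(\frac\nu{\mathcal P^2}+\frac\alpha2\Big)\Big)^{1/2}\Big).$$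
   Context: **Continuous problem.** $\Omega\subset\mathbb R^d$, $d\in\{2,3\}$, is a bounded connected open Lipschitz polytopal domain, $T>0$. Parameters: $\alpha,\nu,\varrho>0$; $E_1>0$, $E_2<0$, $E_1-d|E_2|>0$; $\lambda_1,\lambda_2\in\mathbb R$. $\boldsymbol\varepsilon(\mathbf w)=\frac12(\nabla\mathbf w+(\nabla\mathbf w)^t)$ and $F(f)=E_1(1+\lambda_1f)-d|E_2|(1+\lambda_2f)=\gamma_3+\gamma_4f$. $V=\{\mathbf w\in H^1_0(\Omega)^d:\operatorname{div}\mathbf w=0\}$; $L^2_0(\Omega)$ is the space of mean-zero functions of $L^2(\Omega)$. Initial data $\mathbf u_0\in H^1_0(\Omega)^d$, $\mathbf v_0\in V$. The continuous problem is to find $\mathbf u$, $\mathbf v$ (divergence free), vanishing on $\partial\Omega$, and $p$ (mean zero), with $\mathbf u(0)=\mathbf u_0$, $\mathbf v(0)=\mathbf v_0$ and, for all $\mathbf z,\mathbf w\in H^1_0(\Omega)^d$ and a.e. $t\in]0,T[$, $$\int_\Omega\frac{\boldsymbol\varepsilon(\mathbf u):\boldsymbol\varepsilon(\mathbf z)}{E_1(1+\lambda_1\operatorname{div}\mathbf u)}+\int_\Omega\frac{|E_2|(1+\lambda_2\operatorname{div}\mathbf u)}{E_1(1+\lambda_1\operatorname{div}\mathbf u)}\frac{\operatorname{div}\mathbf u}{F(\operatorname{div}\mathbf u)}\operatorname{div}\mathbf z+\alpha\langle\partial_t\mathbf u,\mathbf z\rangle=\alpha\int_\Omega\mathbf v\cdot\mathbf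 z,$$ $$\langle\varrho\,\partial_t\mathbf v+\nabla p,\mathbf w\rangle+\nu\int_\Omega\nabla\mathbf v:\nabla\mathbf w+\alpha\int_\Omega\mathbf v\cdot\mathbf w=\alpha\langle\partial_t\mathbf u,\mathbf w\rangle.$$ **Standing assumption.** $\bar\lambda>0$ and $D>0$ are such that for all $|\lambda_1|,|\lambda_2|\le\bar\lambda$ the continuous problem has a solution with $\mathbf v,\mathbf u\in L^\infty(0,T;H^2(\Omega)^d)$, $\partial_t\mathbf v,\partial_t\mathbf u\in L^2(0,T;H^1(\Omega)^d)$, $\partial_{tt}^2\mathbf u\in L^2(0,T;H^{-1}(\Omega)^d)$, $p\in L^\infty(0,T;H^1(\Omega))$ and $\|\operatorname{div}\mathbf u\|_{L^\infty(0,T;L^\infty(\Omega))}\le D$. **Dual norm.** $W^{-1,\infty}(0,T;L^2_0(\Omega))$ is the dual of $W^{1,1}_0(0,T;L^2_0(\Omega))=\{\varphi\in L^1(0,T;L^2_0(\Omega)):\partial_t\varphi\in L^1(0,T;L^2_0(\Omega)),\ \varphi(0)=\varphi(T)=0\}$ (standard $W^{1,1}$ norm); its dual norm is denoted $\|\cdot\|_{W^{-1,\infty}(0,T;L^2(\Omega))}$, and a function $q$ acts by $\varphi\mapsto\int_0^T\int_\Omega q\varphi$. **Truncation.** A number $\delta\ge D$ is fixed, and $T_\delta f=f$ if $|f|\le\delta$, $T_\delta f=\delta\,\mathrm{sign}(f)$ if $|f|>\delta$. **Constants.** $\gamma_1=\frac1{1+|\lambda_1|\delta}$, $\gamma_2=\frac1{1-|\lambda_1|\delta}$,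 $\gamma_3=E_1+dE_2$, $\gamma_4=E_1\lambda_1+dE_2\lambda_2$, $\gamma_5=\frac1{\gamma_3+|\gamma_4|\delta}$, $\gamma_6=\frac1{\gamma_3-|\gamma_4|\delta}$, $\gamma_7=1-|\lambda_2|\delta$, $\gamma_8=1+|\lambda_2|\delta$. Under the smallness conditions, for all $\mathbf w\in H^1_0(\Omega)^d$: $\gamma_1\le(1+\lambda_1T_\delta\operatorname{div}\mathbf w)^{-1}\le\gamma_2$, $\gamma_5\le F(T_\delta\operatorname{div}\mathbf w)^{-1}\le\gamma_6$, $0<\gamma_7\le1+\lambda_2T_\delta\operatorname{div}\mathbf w\le\gamma_8$. $\mathcal P,\mathcal K>0$ are the Poincaré and Korn constants of $\Omega$: $\|\mathbf w\|_{L^2}\le\mathcal P\|\nabla\mathbf w\|_{L^2}$, $\|\nabla\mathbf w\|_{L^2}\le\mathcal K\|\boldsymbol\varepsilon(\mathbf w)\|_{L^2}$ for $\mathbf w\in H^1_0(\Omega)^d$. Further $$\mathcal D_1=\frac{(\gamma_6\gamma_8)^2}{\gamma_5\gamma_7}|E_2|,\quad\mathcal D_2=1+\frac{\mathcal D_1}2,\quad\mathcal D_3=\frac{(\alpha h)^2}{\Delta t}+\frac\alpha{E_1}\frac{\gamma_2^2}{\gamma_1}\mathcal D_2,\quad\mathcal D_4=(\alpha\mathcal P)^2\Big(1+\frac{E_1\mathcal K^2}{\alpha\gamma_1}\mathcal D_3\Big).$$ **Discretization.** $\boldsymbol U_h,\boldsymbol X_h\subset H^1_0(\Omega)^d$ and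 $Q_h\subset L^2_0(\Omega)$ are finite element spaces with mesh size $h$; there is $\beta^*>0$ independent of $h$ with $\inf_{q\in Q_h}\sup_{\mathbf w\in\boldsymbol X_h}\frac{\int_\Omega q\operatorname{div}\mathbf w}{\|q\|_{L^2}\|\nabla\mathbf w\|_{L^2}}=\beta^*$. $\boldsymbol V_h=\{\mathbf v_h\in\boldsymbol X_h:\int_\Omega q_h\operatorname{div}\mathbf v_h=0\ \forall q_h\in Q_h\}$. $\Pi_h$ denotes interpolation operators $H^1_0(\Omega)^d\to\boldsymbol U_h$, $H^1_0(\Omega)^d\to\boldsymbol X_h$ and $V\to\boldsymbol V_h$ (same symbol), satisfying, with $C>0$ independent of $h$, $\|\nabla\Pi_h\mathbf w\|_{L^2}\le C\|\nabla\mathbf w\|_{L^2}$ and $\|\mathbf w-\Pi_h\mathbf w\|_{L^2}\le Ch\|\nabla\mathbf w\|_{L^2}$; this is the constant $C$ of the claim. **Fully discrete scheme.** $N>1$, $\Delta t=T/N$, $t_n=n\Delta t$; $\mathbf u_h^0=\Pi_h\mathbf u_0\in\boldsymbol U_h$, $\mathbf v_h^0=\Pi_h\mathbf v_0\in\boldsymbol V_h$. For $1\le n\le N$, given $\mathbf u_h^{n-1}\in\boldsymbol U_h$, $\mathbf v_h^{n-1}\in\boldsymbol V_h$, find $\mathbf u_h^n\in\boldsymbol U_h$, $\mathbf v_h^n\in\boldsymbol V_h$, $p_h^n\in Q_h$ such that for all $\mathbf z_h\in\boldsymbol U_h$, $\mathbf w_h\in\boldsymbol X_h$, $$\frac{\alpha}{\Delta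 t}\int_\Omega(\mathbf u_h^n-\mathbf u_h^{n-1})\cdot\mathbf z_h+\frac1{E_1}\int_\Omega\frac{\boldsymbol\varepsilon(\mathbf u_h^n):\boldsymbol\varepsilon(\mathbf z_h)}{1+\lambda_1T_\delta\operatorname{div}\mathbf u_h^{n-1}}+\frac{|E_2|}{E_1}\int_\Omega\frac{1+\lambda_2T_\delta\operatorname{div}\mathbf u_h^{n-1}}{1+\lambda_1T_\delta\operatorname{div}\mathbf u_h^{n-1}}\frac{(\operatorname{div}\mathbf u_h^n)(\operatorname{div}\mathbf z_h)}{F(T_\delta\operatorname{div}\mathbf u_h^{n-1})}=\alpha\int_\Omega\mathbf v_h^n\cdot\mathbf z_h,$$ $$\frac{\varrho}{\Delta t}\int_\Omega(\mathbf v_h^n-\mathbf v_h^{n-1})\cdot\mathbf w_h-\int_\Omega p_h^n\operatorname{div}\mathbf w_h+\nu\int_\Omega\nabla\mathbf v_h^n:\nabla\mathbf w_h+\alpha\int_\Omega\mathbf v_h^n\cdot\mathbf w_h=\frac{\alpha}{\Delta t}\int_\Omega(\mathbf u_h^n-\mathbf u_h^{n-1})\cdot\mathbf w_h.$$ *)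

(* Defs.v *)
From HB Require Import structures.
From mathcomp Require Import all_boot all_order all_algebra.
From mathcomp Require Import all_classical all_reals all_analysis.
Set Implicit Arguments.
Unset Strict Implicit.
Unset Printing Implicit Defensive.
Import Order.TTheory GRing.Theory Num.Theory.
Import numFieldNormedType.Exports.
Local Open Scope classical_set_scope.
Local Open Scope ring_scope.

Definition measure_rV_display : measure_display -> measure_display.
Proof. exact. Qed.

(* The sigma-algebra generated by the coordinates, i.e. the Borel sets *)
Section measurable_rV.
Context {R : realType} (d : nat).

Let coord (i : 'I_d) (x : 'rV[R]_d) : R := x ord0 i.

Let rV_set0 : g_sigma_preimage coord set0.
Proof. exact: sigma_algebra0. Qed.

Let rV_setC A : g_sigma_preimage coord A -> g_sigma_preimage coord (~` A).
Proof. exact: sigma_algebraC. Qed.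

Let rV_bigcup (F : (set 'rV[R]_d)^nat) :
  (forall i, g_sigma_preimage coord (F i)) ->
  g_sigma_preimage coord (\bigcup_i (F i)).
Proof. exact: sigma_algebra_bigcup. Qed.

HB.instance Definition _ := @isMeasurable.Build
  (measure_rV_display default_measure_display) 'rV[R]_d
  (g_sigma_preimage coord) rV_set0 rV_setC rV_bigcup.

End measurable_rV.

Lemma measurable_coord {R : realType} d (i : 'I_d) :
  measurable_fun [set: 'rV[R]_d] (fun x => x ord0 i).
Proof.
move=> _ Y mY; rewrite setTI; apply: sub_sigma_algebra => /=.
rewrite -bigcup_seq/=; exists i => /=; first by rewrite mem_index_enum.
by exists Y => //; rewrite setTI.
Qed.

Lemma measurable_fun_rVP {R : realType} d0 (T : measurableType d0) d
    (f : T -> 'rV[R]_d) :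
  (forall i, measurable_fun [set: T] (fun t => f t ord0 i)) ->
  measurable_fun [set: T] f.
Proof.
move=> mf; apply: (@measurability _ _ _ _ _ _
  (\big[setU/set0]_(i < d) preimage_set_system setT
     (fun x : 'rV[R]_d => x ord0 i) measurable)) => //.
move=> _ [B + <-]; rewrite -bigcup_seq => -[i _ [Y mY <-]].
have := mf i measurableT _ mY.
by rewrite !setTI.
Qed.

Section lebesgue_rV.
Context {R : realType}.

Definition consrV n (p : R * 'rV[R]_n) : 'rV[R]_n.+1 :=
  row_mx (const_mx p.1 : 'rV_1) p.2.

Definition unconsrV n (x : 'rV[R]_n.+1) : R * 'rV[R]_n :=
  (x ord0 ord0, \row_j x ord0 (lift ord0 j)).

Lemma consrV0 n (p : R * 'rV[R]_n) : consrV p ord0 ord0 = p.1.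
Proof.
transitivity (row_mx (const_mx p.1 : 'rV_1) p.2 ord0 (lshift n ord0)).
  by congr (row_mx _ _ _ _); apply: val_inj.
by rewrite row_mxEl mxE.
Qed.

Lemma consrVS n (p : R * 'rV[R]_n) j : consrV p ord0 (lift ord0 j) = p.2 ord0 j.
Proof.
rewrite -(row_mxEr (const_mx p.1 : 'rV_1) p.2).
by congr (row_mx _ _ _ _); apply: val_inj.
Qed.

Lemma consrVK n : cancel (@consrV n) (@unconsrV n).
Proof.
move=> p; rewrite /unconsrV consrV0 [RHS]surjective_pairing; congr pair.
by apply/rowP => j; rewrite mxE consrVS.
Qed.

Lemma measurable_consrV n : measurable_fun setT (@consrV n).
Proof.
apply: measurable_fun_rVP => i; case: (unliftP ord0 i) => [j ->|->].
  under eq_fun do rewrite consrVS.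
  apply: (@measurableT_comp _ _ _ _ _ _ (fun x : 'rV[R]_n => x ord0 j)).
    exact: measurable_coord.
  exact: measurable_snd.
under eq_fun do rewrite consrV0.
exact: measurable_fst.
Qed.

Lemma measurable_unconsrV n : measurable_fun setT (@unconsrV n).
Proof.
apply/measurable_fun_pair; first exact: measurable_coord.
apply: measurable_fun_rVP => i.
under eq_fun do rewrite mxE.
exact: measurable_coord.
Qed.

Section step.
Context n (m : {sigma_finite_measure set 'rV[R]_n -> \bar R}).

Definition lebesgue_rV_step : set 'rV[R]_n.+1 -> \bar R :=
  pushforward (@lebesgue_measure R \x m)%E (@consrV n).

Let mpre A : measurable A -> measurable (@consrV n @^-1` A).
Proof.
move=> mA; rewrite -[X in measurable X]setTI.
exact: measurable_consrV measurableT _ mA.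
Qed.

Let step0 : lebesgue_rV_step set0 = 0%E.
Proof. by rewrite /lebesgue_rV_step /pushforward preimage_set0 measure0. Qed.

Let step_ge0 A : (0 <= lebesgue_rV_step A)%E.
Proof. exact: (@measure_ge0 _ _ _ (@lebesgue_measure R \x m)%E). Qed.

Let step_sigma_additive : semi_sigma_additive lebesgue_rV_step.
Proof.
move=> F mF tF mUF; rewrite /lebesgue_rV_step /pushforward preimage_bigcup.
apply: measure_semi_sigma_additive.
- by move=> k; exact: mpre.
- apply/trivIsetP => /= i j _ _ ij; rewrite -preimage_setI.
  by move/trivIsetP : tF => /(_ _ _ _ _ ij) ->//; rewrite preimage_set0.
- by rewrite -preimage_bigcup; exact: mpre.
Qed.

HB.instance Definition _ := isMeasure.Build _ _ _
  lebesgue_rV_step step0 step_ge0 step_sigma_additive.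

Let step_sigma_finite : sigma_finite setT lebesgue_rV_step.
Proof.
have /sigma_finiteP[F [TF ndF Foo]] := sigma_finiteT (@lebesgue_measure R).
have /sigma_finiteP[G [TG ndG Goo]] := sigma_finiteT m.
exists (fun k => @unconsrV n @^-1` (F k `*` G k)).
  rewrite -preimage_bigcup; apply/esym/seteqP; split=> // x _ /=.
  have : (\bigcup_k F k) (unconsrV x).1 by rewrite -TF.
  have : (\bigcup_k G k) (unconsrV x).2 by rewrite -TG.
  move=> [j _ Gj] [i _ Fi]; exists (maxn i j) => //; split => /=.
    by move: Fi; apply/subsetPset/ndF; rewrite leq_maxl.
  by move: Gj; apply/subsetPset/ndG; rewrite leq_maxr.
move=> k; have [mF Fk] := Foo k; have [mG Gk] := Goo k; split.
  by rewrite -[X in measurable X]setTI; apply: measurable_unconsrV => //;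
    exact: measurableX.
rewrite /lebesgue_rV_step /pushforward (_ : _ @^-1` _ = F k `*` G k).
  by rewrite product_measure1E// lte_mul_pinfty// ge0_fin_numE.
rewrite -comp_preimage (_ : _ \o _ = id) ?preimage_id//.
by apply/funext => p; exact: consrVK.
Qed.

HB.instance Definition _ := @Measure_isSigmaFinite.Build _ _ _
  lebesgue_rV_step step_sigma_finite.

End step.

(* Iterated product of one-dimensional Lebesgue measures *)
Fixpoint lebesgue_rV d : {sigma_finite_measure set 'rV[R]_d -> \bar R} :=
  if d is n.+1 then lebesgue_rV_step (lebesgue_rV n)
  else \d_(0 : 'rV[R]_0).

Lemma lebesgue_rV_box d (A : 'I_d -> set R) :
  (forall i, measurable (A i)) ->
  lebesgue_rV d [set x | forall i, A i (x ord0 i)] =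
  (\prod_(i < d) lebesgue_measure (A i))%E.
Proof.
elim: d A => [|n IH] A mA /=.
  rewrite big_ord0 diracE mem_set//= => i; by case: i.
rewrite big_ord_recl -IH//.
rewrite /lebesgue_rV_step /pushforward.
have mB : measurable [set x : 'rV[R]_n | forall i, A (lift ord0 i) (x ord0 i)].
  rewrite (_ : mkset _ = \bigcap_(i in [set: 'I_n])
     ((fun x : 'rV[R]_n => x ord0 i) @^-1` A (lift ord0 i))).
    apply: fin_bigcap_measurable => // i _.
    by rewrite -[X in measurable X]setTI; exact: measurable_coord.
  by apply/seteqP; split=> x /= Ax i => [_|]; exact: Ax.
rewrite -product_measure1E//; last exact: mA.
congr (_ _); apply/seteqP; split=> [p /= Ap|p /= [Ap1 Ap2] i].
  split => [|i]; first by rewrite -[p.1]consrV0.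
  by rewrite -consrVS.
by case: (unliftP ord0 i) => [j ->|->]; rewrite ?consrVS ?consrV0.
Qed.

End lebesgue_rV.

(* A function class is a set of functions; equality in L^2 is equality almost
   everywhere, and derivatives are distributional.  Vector fields take values
   in 'rV_d; spaces such as H^1(Omega)^d are stated componentwise. *)
Section sobolev.
Context {R : realType} {d : nat}.
Notation pt := 'rV[R]_d.
Notation leb := (lebesgue_rV d : {measure set pt -> \bar R}).
Implicit Types (Omega : set pt) (f g : pt -> R) (w : pt -> 'rV[R]_d).

Definition frob m n (A B : 'M[R]_(m, n)) : R :=
  \sum_(i < m) \sum_(j < n) A i j * B i j.

Definition enorm m n (A : 'M[R]_(m, n)) : R := Num.sqrt (frob A A).

Definition coordf w (i : 'I_d) : pt -> R := fun x => w x ord0 i.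

Definition unit_vec (i : 'I_d) : pt := delta_mx ord0 i.

Definition iter_partial (s : seq 'I_d) f : pt -> R :=
  foldr (fun i g x => 'D_(unit_vec i) g x) f s.

Definition smooth f : Prop := forall s : seq 'I_d,
  continuous (iter_partial s f) /\
  forall i x, derivable (iter_partial s f) x (unit_vec i).

Definition test_fun Omega : set (pt -> R) := [set f : pt -> R | [/\ smooth f,
  compact (closure [set x | f x != 0]) &
  closure [set x | f x != 0] `<=` Omega]].

Definition L2 Omega : set (pt -> R) := [set f : pt -> R |
  measurable_fun Omega f /\
  (\int[leb]_(x in Omega) ((f x) ^+ 2)%:E < +oo)%E].

Definition L2norm Omega f : R :=
  Num.sqrt (\int[leb]_(x in Omega) ((f x) ^+ 2)).

Definition L20 Omega : set (pt -> R) := [set f : pt -> R |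
  L2 Omega f /\ \int[leb]_(x in Omega) f x = 0].

Definition L2normv m n Omega (A : pt -> 'M[R]_(m, n)) : R :=
  L2norm Omega (fun x => enorm (A x)).

Definition weak_partial Omega (i : 'I_d) f : set (pt -> R) := [set g : pt -> R |
  L2 Omega g /\ forall phi, test_fun Omega phi ->
    \int[leb]_(x in Omega) (f x * 'D_(unit_vec i) phi x) =
    - \int[leb]_(x in Omega) (g x * phi x)].

Definition partial Omega (i : 'I_d) f : pt -> R :=
  xget (fun=> 0) (weak_partial Omega i f).

Definition H1 Omega : set (pt -> R) := [set f : pt -> R |
  L2 Omega f /\ forall i, weak_partial Omega i f !=set0].

Definition H1norm Omega f : R :=
  Num.sqrt (L2norm Omega f ^+ 2 +
            \sum_(i < d) L2norm Omega (partial Omega i f) ^+ 2).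

Definition H10 Omega : set (pt -> R) := [set f : pt -> R | H1 Omega f /\
  exists phi : nat -> pt -> R, (forall k, test_fun Omega (phi k)) /\
    H1norm Omega (fun x => f x - phi k x) @[k --> \oo] --> (0 : R)].

Definition H2 Omega : set (pt -> R) := [set f : pt -> R |
  H1 Omega f /\ forall i, H1 Omega (partial Omega i f)].

Definition H2norm Omega f : R :=
  Num.sqrt (L2norm Omega f ^+ 2 +
            \sum_(i < d) H1norm Omega (partial Omega i f) ^+ 2).

Definition L2v Omega : set (pt -> 'rV[R]_d) :=
  [set w : pt -> 'rV[R]_d | forall i, L2 Omega (coordf w i)].

Definition H10v Omega : set (pt -> 'rV[R]_d) :=
  [set w : pt -> 'rV[R]_d | forall i, H10 Omega (coordf w i)].

Definition H1normv Omega w : R :=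
  Num.sqrt (\sum_(i < d) H1norm Omega (coordf w i) ^+ 2).

Definition grad Omega w (x : pt) : 'M[R]_d :=
  \matrix_(i, j) partial Omega j (coordf w i) x.

Definition eps Omega w (x : pt) : 'M[R]_d :=
  2^-1 *: (grad Omega w x + (grad Omega w x)^T).

Definition divg Omega w (x : pt) : R := \tr (grad Omega w x).

Definition Vdiv Omega : set (pt -> 'rV[R]_d) := [set w : pt -> 'rV[R]_d |
  H10v Omega w /\ {ae leb, forall x, Omega x -> divg Omega w x = 0}].

(* Norm of a functional for the dual H^-1 of H^1_0; +oo if unbounded *)
Definition Hm1norm Omega (l : (pt -> 'rV[R]_d) -> R) : \bar R :=
  ereal_sup [set (`|l z|)%:E | z in [set z : pt -> 'rV[R]_d |
    H10v Omega z /\ H1normv Omega z <= 1]].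

End sobolev.

Definition linear_on (R : realType) (X : lmodType R) (A : set X)
    (l : X -> R) : Prop :=
  forall a f g, A f -> A g -> l (a *: f + g) = a * l f + l g.

Section domains.
Context {R : realType} {d : nat}.
Notation pt := 'rV[R]_d.
Notation leb := (lebesgue_rV d : {measure set pt -> \bar R}).
Implicit Types (Omega : set pt).

Definition chull (s : seq pt) : set pt := [set x |
  exists c : 'I_(size s) -> R, [/\ forall i, 0 <= c i, \sum_i c i = 1 &
    x = \sum_i c i *: s`_i]].

(* Not necessarily convex: closure of Omega is a finite union of convex
   polytopes *)
Definition polytopal Omega : Prop :=
  exists L : seq (seq pt), closure Omega = \bigcup_(s in [set` L]) chull s.

(* Near every boundary point, Omega lies strictly above the graph, in some
   direction e, of a Lipschitz function on the hyperplane orthogonal to e *)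
Definition lipschitz_domain Omega : Prop :=
  forall x, (closure Omega `\` Omega) x ->
  exists (e : pt) (r L : R) (g : pt -> R),
    [/\ enorm e = 1, 0 < r,
        forall y z, `|g y - g z| <= L * enorm (y - z) &
        forall y, enorm (y - x) < r ->
          (Omega y <-> g (y - frob y e *: e) < frob y e)].

Definition domain Omega : Prop :=
  [/\ Omega !=set0, open Omega, connected Omega, bounded_set Omega &
      lipschitz_domain Omega /\ polytopal Omega].

Definition diam (A : set pt) : R :=
  sup [set r | exists x y, [/\ A x, A y & r = enorm (x - y)]].

(* A mesh is given by the vertices of its cells, which are convex polytopes *)
Definition mesh Omega (h : R) (M : seq (seq pt)) : Prop :=
  [/\ closure Omega = \bigcup_(K in [set` M]) chull K,
      forall K, K \in M -> interior (chull K) !=set0,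
      forall i j, (i < j < size M)%N ->
        interior (chull (nth [::] M i)) `&` interior (chull (nth [::] M j))
        = set0 &
      h = \big[Num.max/0]_(K <- M) diam (chull K)].

(* A linear space of functions which, on each cell of a mesh of size h,
   coincide with elements of a finite-dimensional local space (spanned by the
   functions psi; polynomials of bounded degree, for instance) *)
Definition fe_space (W : lmodType R) Omega (h : R) (S : set (pt -> W)) : Prop :=
  [/\ S (fun=> 0),
      forall (a : R) f g, S f -> S g -> S (fun x => a *: f x + g x) &
      exists2 M, mesh Omega h M & forall K, K \in M ->
        exists k (psi : 'I_k -> pt -> W), forall f, S f ->
          exists c : 'I_k -> R, {ae leb, forall x, chull K x ->
            f x = \sum_(j < k) c j *: psi j x}].

(* An interpolation operator from A to the discrete space S; as a map on L^2
   functions it does not distinguish functions equal almost everywhere *)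
Definition interpolation Omega (C h : R) (A S : set (pt -> 'rV[R]_d))
    (Pi : (pt -> 'rV[R]_d) -> (pt -> 'rV[R]_d)) : Prop :=
  (forall w, A w ->
    [/\ S (Pi w),
        L2normv Omega (grad Omega (Pi w)) <= C * L2normv Omega (grad Omega w) &
        L2normv Omega (w - Pi w) <= C * h * L2normv Omega (grad Omega w)]) /\
  (forall w w', A w -> A w' ->
    {ae leb, forall x, Omega x -> w x = w' x} ->
    {ae leb, forall x, Omega x -> Pi w x = Pi w' x}).

Definition infsup Omega (X : set (pt -> 'rV[R]_d)) (Q : set (pt -> R)) :
    \bar R :=
  ereal_inf [set ereal_sup [set
      ((\int[leb]_(x in Omega) (q x * divg Omega w x)) /
       (L2norm Omega q * L2normv Omega (grad Omega w)))%:E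
    | w in [set w : pt -> 'rV[R]_d | X w /\ L2normv Omega (grad Omega w) != 0]]
  | q in [set q : pt -> R | Q q /\ L2norm Omega q != 0]].

Definition Vh Omega (X : set (pt -> 'rV[R]_d)) (Q : set (pt -> R)) :
    set (pt -> 'rV[R]_d) := [set w : pt -> 'rV[R]_d | X w /\ forall q, Q q ->
  \int[leb]_(x in Omega) (q x * divg Omega w x) = 0].

Definition poincare_constant Omega (P : R) : Prop := forall w : pt -> 'rV[R]_d,
  H10v Omega w -> L2normv Omega w <= P * L2normv Omega (grad Omega w).

Definition korn_constant Omega (K : R) : Prop := forall w : pt -> 'rV[R]_d,
  H10v Omega w ->
  L2normv Omega (grad Omega w) <= K * L2normv Omega (eps Omega w).

End domains.

Section bochner.
Context {R : realType} {d : nat}.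
Notation pt := 'rV[R]_d.
Notation leb := (lebesgue_rV d : {measure set pt -> \bar R}).
Notation leb1 := (@lebesgue_measure R).
Variables (T : R) (Omega : set pt).
Notation openT := (`]0, T[%classic : set R).
Notation closedT := (`[0, T]%classic : set R).
Implicit Types (f g : R -> pt -> R) (u : R -> pt -> 'rV[R]_d).
Implicit Types (X : set (pt -> R)) (N : (pt -> R) -> R).

Definition compt u (i : 'I_d) : R -> pt -> R := fun t => coordf (u t) i.

Definition smooth1 (theta : R -> R) : Prop :=
  forall n t, derivable (derive1n n theta) t 1.

Definition test_fun1 : set (R -> R) := [set theta : R -> R | [/\ smooth1 theta,
  compact (closure [set t | theta t != 0]) &
  closure [set t | theta t != 0] `<=` openT]].

(* Strong measurability in the separable spaces below amounts to having a
   jointly measurable representative *)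
Definition bochner_measurable X f : Prop :=
  measurable_fun (openT `*` Omega) (fun z : R * pt => f z.1 z.2) /\
  {ae leb1, forall t, openT t -> X (f t)}.

(* L^q(0,T;X) for finite q, where N is the norm of X *)
Definition Lq_time (q : nat) X N : set (R -> pt -> R) := [set f : R -> pt -> R |
  bochner_measurable X f /\
  (\int[leb1]_(t in openT) ((N (f t)) ^+ q)%:E < +oo)%E].

Definition Linf_time X N : set (R -> pt -> R) := [set f : R -> pt -> R |
  bochner_measurable X f /\
  exists M, {ae leb1, forall t, openT t -> N (f t) <= M}].

Definition weak_dt f : set (R -> pt -> R) := [set g : R -> pt -> R |
  Lq_time 1 (L2 Omega) (L2norm Omega) g /\
  forall theta, test_fun1 theta ->
    {ae leb, forall x, Omega x ->
      \int[leb1]_(t in openT) (f t x * derive1 theta t) =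
      - \int[leb1]_(t in openT) (g t x * theta t)}].

Definition dt f : R -> pt -> R := xget (fun=> fun=> 0) (weak_dt f).

(* f is its representative in C([0,T];L^2(Omega)) *)
Definition cont_L2 f : Prop :=
  (forall t, closedT t -> L2 Omega (f t)) /\
  forall t, closedT t ->
    L2norm Omega (f s - f t) @[s --> within closedT (nbhs t)] --> (0 : R).

Definition cont_L2v u : Prop := forall i, cont_L2 (compt u i).

(* W^{1,1}_0(0,T;L^2_0): elements are identified with their continuous
   representative, which gives a meaning to the end point conditions *)
Definition W110 : set (R -> pt -> R) := [set f : R -> pt -> R |
  [/\ Lq_time 1 (L20 Omega) (L2norm Omega) f,
      exists2 g, weak_dt f g & Lq_time 1 (L20 Omega) (L2norm Omega) g,
      cont_L2 f,
      {ae leb, forall x, Omega x -> f 0 x = 0} &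
      {ae leb, forall x, Omega x -> f T x = 0}]].

Definition W11norm f : R :=
  \int[leb1]_(t in openT) (L2norm Omega (f t)) +
  \int[leb1]_(t in openT) (L2norm Omega (dt f t)).

Definition pairing (q f : R -> pt -> R) : R :=
  \int[leb1]_(t in openT) \int[leb]_(x in Omega) (q t x * f t x).

Definition Wm1norm (q : R -> pt -> R) : \bar R :=
  ereal_sup [set (`|pairing q f|)%:E | f in [set f : R -> pt -> R |
    W110 f /\ W11norm f <= 1]].

(* q defines, by integration, a continuous linear form on W^{1,1}_0 *)
Definition Wm1inf : set (R -> pt -> R) := [set q : R -> pt -> R |
  [/\ forall f, W110 f -> (\int[leb1]_(t in openT)
        \int[leb]_(x in Omega) (`|q t x * f t x|)%:E < +oo)%E,
      linear_on W110 (pairing q) &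
      (Wm1norm q < +oo)%E]].

(* l belongs to L^2(0,T;H^-1(Omega)^d) and is the weak time derivative of u *)
Definition weak_dt_Hm1 u (l : R -> (pt -> 'rV[R]_d) -> R) : Prop :=
  [/\ forall z, H10v Omega z -> measurable_fun openT (fun t => l t z),
      {ae leb1, forall t, openT t -> linear_on (H10v Omega) (l t)},
      (\int[leb1]_(t in openT) (Hm1norm Omega (l t) ^+ 2) < +oo)%E &
      forall z theta, H10v Omega z -> test_fun1 theta ->
        \int[leb1]_(t in openT)
          ((\int[leb]_(x in Omega) frob (u t x) (z x)) * derive1 theta t) =
        - \int[leb1]_(t in openT) (l t z * theta t)].

End bochner.

Record material (R : realType) :=
  Material { alpha : R; nu : R; rho : R; E1 : R; E2 : R }.

Definition Ffun (R : realType) (d : nat) (m : material R) (l1 l2 f : R) : R :=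
  E1 m * (1 + l1 * f) - d%:R * `|E2 m| * (1 + l2 * f).

Section continuous_problem.
Context {R : realType} {d : nat}.
Notation pt := 'rV[R]_d.
Notation leb := (lebesgue_rV d : {measure set pt -> \bar R}).
Notation leb1 := (@lebesgue_measure R).
Variables (T : R) (Omega : set pt) (m : material R).
Notation openT := (`]0, T[%classic : set R).

Definition stress1 (l1 : R) (y z : pt -> 'rV[R]_d) (x : pt) : R :=
  frob (eps Omega y x) (eps Omega z x) / (E1 m * (1 + l1 * divg Omega y x)).

Definition stress2 (l1 l2 : R) (y z : pt -> 'rV[R]_d) (x : pt) : R :=
  (`|E2 m| * (1 + l2 * divg Omega y x)) / (E1 m * (1 + l1 * divg Omega y x)) *
  (divg Omega y x / Ffun d m l1 l2 (divg Omega y x)) * divg Omega z x.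

(* ut and vt are the time derivatives of u and v; they are functions with
   values in L^2, so that duality pairings with them are integrals, and the
   distribution grad p acts by w |-> - int p div w *)
Definition weak_solution (l1 l2 : R) (u0 v0 : pt -> 'rV[R]_d)
    (u v ut vt : R -> pt -> 'rV[R]_d) (p : R -> pt -> R) : Prop :=
  [/\ {ae leb1, forall t, openT t ->
        [/\ H10v Omega (u t), Vdiv Omega (v t) & L20 Omega (p t)]},
      [/\ cont_L2v T Omega u, cont_L2v T Omega v,
        {ae leb, forall x, Omega x -> u 0 x = u0 x} &
        {ae leb, forall x, Omega x -> v 0 x = v0 x}],
      forall i, weak_dt T Omega (compt u i) (compt ut i) /\
                weak_dt T Omega (compt v i) (compt vt i),
      forall z, H10v Omega z -> {ae leb1, forall t, openT t ->
        [/\ leb.-integrable Omega (EFin \o stress1 l1 (u t) z),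
            leb.-integrable Omega (EFin \o stress2 l1 l2 (u t) z) &
            \int[leb]_(x in Omega) (stress1 l1 (u t) z x) +
            \int[leb]_(x in Omega) (stress2 l1 l2 (u t) z x) +
            alpha m * \int[leb]_(x in Omega) (frob (ut t x) (z x)) =
            alpha m * \int[leb]_(x in Omega) (frob (v t x) (z x))]} &
      forall w, H10v Omega w -> {ae leb1, forall t, openT t ->
        rho m * \int[leb]_(x in Omega) (frob (vt t x) (w x)) -
        \int[leb]_(x in Omega) (p t x * divg Omega w x) +
        nu m * \int[leb]_(x in Omega)
                 (frob (grad Omega (v t) x) (grad Omega w x)) +
        alpha m * \int[leb]_(x in Omega) (frob (v t x) (w x)) =
        alpha m * \int[leb]_(x in Omega) (frob (ut t x) (w x))}].

Definition solution_regularity (Dbound : R)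
    (u v ut vt : R -> pt -> 'rV[R]_d) (p : R -> pt -> R) : Prop :=
  [/\ forall i, Linf_time T Omega (H2 Omega) (H2norm Omega) (compt v i) /\
                Linf_time T Omega (H2 Omega) (H2norm Omega) (compt u i),
      forall i, Lq_time T Omega 2 (H1 Omega) (H1norm Omega) (compt vt i) /\
                Lq_time T Omega 2 (H1 Omega) (H1norm Omega) (compt ut i),
      exists l, weak_dt_Hm1 T Omega ut l,
      Linf_time T Omega (H1 Omega) (H1norm Omega) p &
      {ae leb1, forall t, openT t ->
        {ae leb, forall x, Omega x -> `|divg Omega (u t) x| <= Dbound}}].

Definition standing_assumption (u0 v0 : pt -> 'rV[R]_d) (lbar Dbound : R) :
    Prop :=
  [/\ 0 < lbar, 0 < Dbound &
    forall l1 l2, `|l1| <= lbar -> `|l2| <= lbar ->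
      exists u v ut vt p, weak_solution l1 l2 u0 v0 u v ut vt p /\
        solution_regularity Dbound u v ut vt p].

End continuous_problem.

Section scheme.
Context {R : realType} {d : nat}.
Notation pt := 'rV[R]_d.
Notation leb := (lebesgue_rV d : {measure set pt -> \bar R}).

Definition trunc (delta f : R) : R :=
  if `|f| <= delta then f else delta * Num.sg f.

Definition discrete_solution (Omega : set pt) (m : material R)
    (l1 l2 delta tau : R) (N : nat)
    (U X : set (pt -> 'rV[R]_d)) (Q : set (pt -> R))
    (u v : nat -> pt -> 'rV[R]_d) (p : nat -> pt -> R) : Prop :=
  forall n, (1 <= n <= N)%N ->
    let Tdiv x := trunc delta (divg Omega (u n.-1) x) in
    [/\ U (u n), Vh Omega X Q (v n), Q (p n),
      forall z, U z ->
        alpha m / tau *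
          \int[leb]_(x in Omega) (frob (u n x - u n.-1 x) (z x)) +
        (E1 m)^-1 * \int[leb]_(x in Omega)
          (frob (eps Omega (u n) x) (eps Omega z x) / (1 + l1 * Tdiv x)) +
        `|E2 m| / E1 m * \int[leb]_(x in Omega)
          ((1 + l2 * Tdiv x) / (1 + l1 * Tdiv x) *
           ((divg Omega (u n) x * divg Omega z x) / Ffun d m l1 l2 (Tdiv x))) =
        alpha m * \int[leb]_(x in Omega) (frob (v n x) (z x)) &
      forall w, X w ->
        rho m / tau *
          \int[leb]_(x in Omega) (frob (v n x - v n.-1 x) (w x)) -
        \int[leb]_(x in Omega) (p n x * divg Omega w x) +
        nu m * \int[leb]_(x in Omega)
          (frob (grad Omega (v n) x) (grad Omega w x)) +
        alpha m * \int[leb]_(x in Omega) (frob (v n x) (w x)) =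
        alpha m / tau *
          \int[leb]_(x in Omega) (frob (u n x - u n.-1 x) (w x))].

Definition step_function (tau : R) (N : nat) (p : nat -> pt -> R)
    (t : R) (x : pt) : R :=
  \sum_(1 <= i < N.+1)
    \1_(`](i.-1)%:R * tau, i%:R * tau]%classic) t * p i x.

End scheme.

Section constants.
Context {R : realType}.
Variables (d : nat) (m : material R) (l1 l2 delta : R).

Definition gamma1 : R := (1 + `|l1| * delta)^-1.
Definition gamma2 : R := (1 - `|l1| * delta)^-1.
Definition gamma3 : R := E1 m + d%:R * E2 m.
Definition gamma4 : R := E1 m * l1 + d%:R * E2 m * l2.
Definition gamma5 : R := (gamma3 + `|gamma4| * delta)^-1.
Definition gamma6 : R := (gamma3 - `|gamma4| * delta)^-1.
Definition gamma7 : R := 1 - `|l2| * delta.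
Definition gamma8 : R := 1 + `|l2| * delta.

Definition calD1 : R := (gamma6 * gamma8) ^+ 2 / (gamma5 * gamma7) * `|E2 m|.
Definition calD2 : R := 1 + calD1 / 2.
Definition calD3 (h tau : R) : R :=
  (alpha m * h) ^+ 2 / tau +
  alpha m / E1 m * (gamma2 ^+ 2 / gamma1) * calD2.
Definition calD4 (h tau P K : R) : R :=
  (alpha m * P) ^+ 2 *
  (1 + E1 m * K ^+ 2 / (alpha m * gamma1) * calD3 h tau).

End constants.

(* Main.v *)
(* Test the displacement equation with u^n, and the velocity equation with v^n,
   after rewriting the coupling term (alpha/tau) (u^n - u^(n-1), v^n) by means
   of the displacement equation tested with Pi_h v^n.  This gives a one-step
   inequality for the energy |v^n|^2 + (3 C^2 D3/(nu rho)) |u^n|^2, and the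
   discrete Gronwall lemma bounds the energy and the dissipation by
   C1 exp(C2 T).  Summing the velocity equation over the first n steps and using
   the inf-sup condition then bounds S_n = tau (p^1 + ... + p^n) in L^2 by
   M = C3 + C4 (C1 exp(C2 T))^(1/2).

   Let f be in W^{1,1}_0 and let q be in L^2.  Testing f_t with smooth
   approximations of the indicator function of [a, b] shows that
   |(q, f(b) - f(a))| is at most |q| times the integral of |f_t| over [a, b].
   As tau |p^i| = |S_i - S_(i-1)| <= 2 M, replacing f on each step by its value
   at the end of the step costs at most 2 M int |f_t| in the pairing; a summation
   by parts then moves the differences from S to the nodal values of f and costs
   M int |f_t|, whence the factor 3.

   The inequality |div w| <= |grad w| on H^1_0, needed for the constants of the
   scheme, comes from int d_i phi d_j psi = int d_j phi d_i psi for test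
   functions. *)
Require Import Defs.
From HB Require Import structures.
From mathcomp Require Import all_boot all_order all_algebra.
From mathcomp Require Import all_classical all_reals all_analysis.
From mathcomp Require Import measurable_realfun ring lra.
Set Implicit Arguments.
Unset Strict Implicit.
Unset Printing Implicit Defensive.
Import Order.TTheory GRing.Theory Num.Theory.
Import numFieldNormedType.Exports.
Local Open Scope classical_set_scope.
Local Open Scope ring_scope.

(** * Smooth bump functions *)

Section smooth_functions_of_one_variable.
Context {R : realType}.
Implicit Types (f g : R -> R) (n : nat).

(** The discrete velocity need not lie in [U h], so the displacement equation is tested with its
    interpolant instead. The interpolation error is of order [h / tau] times the displacement
    increment, and the numerical dissipation of the implicit Euler step absorbs it: hence the
    summand [(alpha h)^2 / tau] of D3 and the weighted displacement norm in the energy. A single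
    pressure is not bounded uniformly in [tau], because the velocity equation contains difference
    quotients of v and u; only their time sums telescope, hence a norm dual to time derivatives. The
    weak time derivative of f is given for almost every x against scalar test functions; Fubini
    transfers it to the scalar function t |-> (q, f(t)), where a smoothed fundamental theorem of
    calculus applies. In space, [partial] chooses some weak derivative and [smooth] speaks of
    directional derivatives; uniqueness of weak derivatives and commutation of mixed ones both come
    from testing with products of one-variable bumps, where everything is explicit. *)

Fixpoint diffn n f : Prop :=
  if n is n'.+1 then (forall t, derivable f t 1) /\ diffn n' (derive1 f) else True.

(** [derive1n] adds derivatives on the outside, whereas [diffn] peels off the innermost one; the
    latter form lets the sum, product and chain rules pass through an induction on the order. *)
Lemma smooth1P f : (forall n, diffn n f) <-> smooth1 f.
Proof.
split=> [H n|H n].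
  elim: n f H => [|n IH] f H t; first by have [] := H 1%N.
  rewrite derive1Sn; apply: IH => k.
  by have [] := H k.+1.
elim: n f H => [//|n IH] f H; split; first by move=> t; exact: (H 0%N).
by apply: IH => k t; rewrite -derive1Sn.
Qed.

Lemma diffnS n f : diffn n.+1 f -> diffn n f.
Proof. by elim: n f => [//|n IH] f [df /IH]. Qed.

Lemma diffnD n f g : diffn n f -> diffn n g -> diffn n (f \+ g).
Proof.
elim: n f g => [//|n IH] f g [df Hf] [dg Hg]; split.
  by move=> t; exact: derivableD.
rewrite (_ : derive1 _ = (derive1 f) \+ (derive1 g)); first exact: IH.
by apply/funext => t; rewrite /= !derive1E deriveD.
Qed.

Lemma diffnZ n (a : R) f : diffn n f -> diffn n (a \*o f).
Proof.
elim: n f => [//|n IH] f [df Hf]; split.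
  by move=> t; exact: (@derivableZ _ _ _ f).
rewrite (_ : derive1 _ = a \*o (derive1 f)); first exact: IH.
by apply/funext => t; rewrite /= !derive1E (@deriveZ _ _ _ f).
Qed.

Lemma diffnM n f g : diffn n f -> diffn n g -> diffn n (f \* g).
Proof.
elim: n f g => [//|n IH] f g Hf Hg.
have [[df Hf'] [dg Hg']] := (Hf, Hg); split.
  by move=> t; exact: derivableM.
rewrite (_ : derive1 _ = (f \* (derive1 g)) \+ (g \* (derive1 f))).
  by apply: diffnD; apply: IH => //; exact: diffnS.
by apply/funext => t; rewrite /= !derive1E deriveM.
Qed.

Lemma is_derive_affine f (a b t df : R) :
  is_derive (a * t + b) 1 f df -> is_derive t 1 (fun t => f (a * t + b)) (a * df).
Proof.
move=> dF.
have dg : is_derive t 1 (fun t : R => a * t + b) a.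
  apply: (is_derive_eq (is_deriveD (is_deriveZ a (is_derive_id t 1)) (is_derive_cst b t 1))).
  by rewrite addr0 /GRing.scale/= mulr1.
by have := @is_derive1_comp _ f (fun t : R => a * t + b) t df a dF dg; rewrite mulrC.
Qed.

Lemma diffn_affine n f (a b : R) : diffn n f -> diffn n (fun t => f (a * t + b)).
Proof.
elim: n f => [//|n IH] f [df Hf].
have H (t : R) : is_derive t 1 (fun t => f (a * t + b)) (a * (derive1 f) (a * t + b)).
  by apply: is_derive_affine; rewrite derive1E; exact: derivableP.
split; first by move=> t; have [] := H t.
rewrite (_ : derive1 _ = a \*o (fun t => (derive1 f) (a * t + b))).
  by apply: diffnZ; exact: IH.
by apply/funext => t; rewrite derive1E; have [] := H t.
Qed.

(* The factors x^-k are those produced by differentiation *)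
Definition flat (c : R) (k : nat) (x : R) : R :=
  if 0 < x then x ^- k * expR (- (c / x)) else 0.

Lemma flat_le0 c k x : x <= 0 -> flat c k x = 0.
Proof. by move=> x0; rewrite /flat ltNge x0. Qed.

Lemma flat_ge0 c k x : 0 <= flat c k x.
Proof.
rewrite /flat; case: ifPn => // x0.
by rewrite mulr_ge0// ?expR_ge0// invr_ge0 exprn_ge0// ltW.
Qed.

(** The exponential of [c / x] dominates its Taylor term of order k + 2, which outweighs [x ^- k]
    with two powers of x to spare. Quadratic decay at 0 is what makes the derivative there exist and
    vanish. *)
Lemma flat_quadratic c k : 0 < c ->
  exists M, forall x, `|flat c k x| <= M * x ^+ 2.
Proof.
move=> c0; exists ((k.+2)`!%:R / c ^+ k.+2) => x.
rewrite ger0_norm ?flat_ge0//.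
have M0 : 0 <= (k.+2)`!%:R / c ^+ k.+2 * x ^+ 2.
  by rewrite mulr_ge0 ?sqr_ge0// divr_ge0// exprn_ge0// ltW.
rewrite /flat; case: ifPn => // x0.
have cx : 0 <= c / x by rewrite divr_ge0// ltW.
rewrite expRN ler_pdivrMr ?expR_gt0// -ler_pdivrMl; last first.
  by rewrite mulr_gt0// ?exprn_gt0// divr_gt0 ?exprn_gt0// ltr0n fact_gt0.
have := @expR_ge1Dxn R (c / x) k.+1 cx.
apply: le_trans; rewrite -[leLHS]add0r lerD// expr_div_n.
rewrite le_eqVlt; apply/orP; left; apply/eqP.
have f0 : (k.+2)`!%:R != 0 :> R by rewrite pnatr_eq0 -lt0n fact_gt0.
rewrite !exprS expr0 mulr1.
move: (x ^+ k) (c ^+ k) (expf_neq0 k (lt0r_neq0 x0)) (expf_neq0 k (lt0r_neq0 c0)) => X Y X0 Y0.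
by field; rewrite X0 Y0 f0 !lt0r_neq0.
Qed.

Lemma is_derive_flat (c : R) k (x : R) : 0 < c ->
  is_derive x 1 (flat c k) (- k%:R * flat c k.+1 x + c * flat c k.+2 x).
Proof.
move=> c0; have [x0|x0|x0] := ltgtP x 0.
- rewrite !flat_le0 ?(ltW x0)// !mulr0 addr0.
  apply: (@near_eq_is_derive _ _ _ (cst 0)) => //.
  near=> y; rewrite flat_le0//; apply: ltW.
  by near: y; exact: lt_nbhsl.
- pose e y := y ^- k * expR (- (c / y)).
  apply: (@near_eq_is_derive _ _ _ e).
    by near=> y; rewrite /flat /e ifT//; near: y; exact: lt_nbhsr.
  rewrite /flat x0.
  have x0' : x != 0 by rewrite gt_eqF.
  have dV : is_derive x 1 (fun y : R => c / y) (- c * x ^- 2).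
    have dI := @is_deriveV R id x 1 1 x0' (is_derive_id _ _).
    apply: (is_derive_eq (@is_deriveZ _ _ _ _ c x 1 _ dI)).
    by rewrite /GRing.scale/= mulr1 mulrN mulNr.
  have dE : is_derive x 1 (fun y : R => expR (- (c / y))) (c * x ^- 2 * expR (- (c / x))).
    have := @is_derive1_comp _ expR (fun y : R => - (c / y)) x _ _ (is_derive_expR _) (is_deriveN dV).
    by rewrite mulNr opprK mulrC.
  have dX : is_derive x 1 (fun y : R => y ^- k) (- k%:R * x ^- k.+1).
    have xk0 : x ^+ k != 0 by rewrite expf_neq0.
    have dP : is_derive x 1 (fun y : R => y ^+ k) (k%:R * x ^+ k.-1).
      apply: DeriveDef; first exact: exprn_derivable.
      by rewrite exp_derive /GRing.scale/= mulr1.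
    have dI := @is_deriveV R (fun y => y ^+ k) x _ 1 xk0 dP.
    apply: (is_derive_eq dI).
    rewrite /GRing.scale/=.
    case: k xk0 {dP dI e} => [|k] xk0; first by rewrite mul0r mulr0 oppr0 mul0r.
    rewrite !exprS; move: xk0; rewrite exprS mulf_eq0 negb_or => /andP[_ xk0].
    by field; rewrite xk0.
  apply: (is_derive_eq (is_deriveM dX dE)).
  rewrite /GRing.scale/= !exprS expr0.
  by field; rewrite expf_neq0.
- rewrite x0 !flat_le0// !mulr0 addr0.
  have [M HM] := flat_quadratic k c0.
  (* At the junction point the quadratic bound makes the difference quotient at most [|M| |h|];
     adding 1 to [|M|] gives a positive constant to divide by. *)
  have cv : (fun h : R => h^-1 *: (flat c k (h *: 1 + 0) - flat c k 0)) @ 0^' --> 0.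
    apply/cvgr0Pnorm_le => e e0; near=> h.
    rewrite (flat_le0 c k (lexx 0)) subr0 addr0 /GRing.scale/= mulr1 normrM normfV.
    have h0 : h != 0 by near: h; exact: nbhs_dnbhs_neq.
    rewrite ler_pdivrMl ?normr_gt0// (le_trans (HM h))//.
    rewrite -real_normK ?num_real// expr2 mulrA [leRHS]mulrC ler_wpM2r//.
    apply: (@le_trans _ _ ((`|M| + 1) * `|h|)).
      by rewrite ler_wpM2r// (le_trans (ler_norm M))// lerDl.
    have M1 : 0 < `|M| + 1 by rewrite ltr_wpDl.
    rewrite -ler_pdivlMl// mulrC; near: h; apply: dnbhs0_le.
    by rewrite divr_gt0.
  apply: DeriveDef; first by apply/cvg_ex; exists 0.
  exact/cvg_lim.
Unshelve. all: end_near.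
Qed.

(** The derivative of a member of the family is a linear combination of the members of index k + 1
    and k + 2, so the induction on the order treats all k at once. *)
Lemma diffn_flat n c k : 0 < c -> diffn n (flat c k).
Proof.
move=> c0; elim: n k => [//|n IH] k; split.
  by move=> t; have [] := is_derive_flat k t c0.
rewrite (_ : derive1 _ = (- k%:R \*o flat c k.+1) \+ (c \*o flat c k.+2)).
  by apply: diffnD; apply: diffnZ.
by apply/funext => t; rewrite derive1E; have [_ ->] := is_derive_flat k t c0.
Qed.

(* As c tends to 0, bumpf c a b tends to the indicator function of ]a, b[ *)
Definition bumpf (c a b t : R) : R := flat c 0 (t - a) * flat c 0 (b - t).

Lemma bump_smooth c a b : 0 < c -> smooth1 (bumpf c a b).
Proof.
move=> c0; apply/smooth1P => n; apply: diffnM.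
  rewrite (_ : (fun t => _) = fun t => flat c 0 (1 * t + - a)).
    exact/diffn_affine/diffn_flat.
  by apply/funext => t; rewrite mul1r.
rewrite (_ : (fun t => _) = fun t => flat c 0 (- 1 * t + b)).
  exact/diffn_affine/diffn_flat.
by apply/funext => t; rewrite mulN1r addrC.
Qed.

Lemma flat0_le1 c x : 0 < c -> flat c 0 x <= 1.
Proof.
move=> c0; rewrite /flat; case: ifPn => // x0.
by rewrite expr0 invr1 mul1r expR_le1 oppr_le0 divr_ge0// ltW.
Qed.

Lemma bump_ge0 c a b t : 0 <= bumpf c a b t.
Proof. by rewrite mulr_ge0// flat_ge0. Qed.

Lemma bump_le1 c a b t : 0 < c -> bumpf c a b t <= 1.
Proof. by move=> c0; rewrite mulr_ile1 ?flat_ge0 ?flat0_le1. Qed.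

Lemma bump_out c a b t : ~~ (a < t < b) -> bumpf c a b t = 0.
Proof.
rewrite negb_and -!leNgt => /orP[ta|bt]; rewrite /bumpf.
  by rewrite [flat _ _ (t - a)]flat_le0 ?mul0r// subr_le0.
by rewrite [flat _ _ (b - t)]flat_le0 ?mulr0// subr_le0.
Qed.

Lemma bump_gt0 c a b t : a < t < b -> 0 < bumpf c a b t.
Proof.
move=> /andP[ta tb].
by rewrite mulr_gt0// /flat subr_gt0 ?ta ?tb expr0 invr1 mul1r expR_gt0.
Qed.

Lemma bump_cvg a b t :
  bumpf n.+1%:R^-1 a b t @[n --> \oo] --> (if a < t < b then 1 else 0 : R).
Proof.
case: ifPn => [/andP[ta tb]|tab].
  have H (x : R) : 0 < x -> flat n.+1%:R^-1 0 x @[n --> \oo] --> (1 : R).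
    move=> x0; rewrite /flat x0; under eq_fun do rewrite expr0 invr1 mul1r.
    suff: expR (- (n.+1%:R^-1 / x)) @[n --> \oo] --> expR (0 : R) by rewrite expR0.
    apply: continuous_cvg; first exact: continuous_expR.
    rewrite -oppr0; apply: cvgN; rewrite -(mul0r x^-1).
    by apply: (@cvgMr_tmp _ _ _ _ (@harmonic R)); exact: cvg_harmonic.
  rewrite -[X in _ --> X](mulr1 1).
  by apply: cvgM; apply: H; rewrite subr_gt0.
by under eq_fun do rewrite bump_out//; exact: cvg_cst.
Qed.

Lemma smooth1_derivable f : smooth1 f -> forall t, derivable f t 1.
Proof. by move=> sf; exact: (sf 0%N). Qed.

Lemma smooth1_continuous f : smooth1 f -> continuous f.
Proof.
move=> /smooth1_derivable df t.
exact/differentiable_continuous/derivable1_diffP.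
Qed.

Lemma smooth1_derive1 f : smooth1 f -> smooth1 (derive1 f).
Proof. by move=> sf n t; rewrite -derive1Sn; exact: sf. Qed.

Lemma smooth1_derive1n n f : smooth1 f -> smooth1 (derive1n n f).
Proof. by move=> sf; elim: n => [//|n IH]; rewrite derive1nS; exact: smooth1_derive1. Qed.

End smooth_functions_of_one_variable.

(** * Boxes and products of bump functions *)

Section topology_of_rV.
Context {R : realType} {d : nat}.
Notation pt := 'rV[R]_d.
Implicit Types (x y : pt) (A : set pt).

Definition obox (a b : 'I_d -> R) : set pt :=
  [set x | forall i, a i < x ord0 i < b i].

Definition cbox (a b : 'I_d -> R) : set pt :=
  [set x | forall i, a i <= x ord0 i <= b i].

Lemma nbhs_cbox x A : nbhs x A -> exists2 e : R, 0 < e &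
  cbox (fun i => x ord0 i - e) (fun i => x ord0 i + e) `<=` A.
Proof.
move=> /nbhs_ballP[e/= e0 eA]; exists (e / 2); first by rewrite divr_gt0.
move=> y xy; apply: eA; split => // i j; rewrite ord1.
have := xy j; rewrite -ler_distl => xyj.
rewrite /ball/= distrC (le_lt_trans xyj)// ltr_pdivrMr// ltr_pMr//.
by rewrite ltr1n.
Qed.

Lemma measurable_obox a b : measurable (obox a b).
Proof.
rewrite (_ : obox a b = \bigcap_(i in [set: 'I_d])
   ((fun x : pt => x ord0 i) @^-1` `]a i, b i[)).
  apply: fin_bigcap_measurable => // i _.
  by rewrite -[X in measurable X]setTI; exact: measurable_coord.
apply/seteqP; split=> x /= Ax i => [_|]; first by rewrite /= in_itv/=; exact: Ax.
by have := Ax i I; rewrite /= in_itv.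
Qed.

(* The rational open boxes whose closures lie in an open set cover it *)
Lemma open_bigcup_obox A : A !=set0 -> open A -> exists (a b : nat -> 'I_d -> R),
  (forall n, cbox (a n) (b n) `<=` A) /\ A = \bigcup_n obox (a n) (b n).
Proof.
move=> [x0 Ax0] oA.
have [e0 e0_gt0 e0A] := nbhs_cbox (open_nbhs_nbhs (conj oA Ax0)).
pose ra (n : nat) : 'I_d -> R := if unpickle n is Some (q, r) then
   fun i => ratr ((q : 'rV[rat]_d) ord0 i) - ratr r else fun=> 0.
pose rb (n : nat) : 'I_d -> R := if unpickle n is Some (q, r) then
   fun i => ratr ((q : 'rV[rat]_d) ord0 i) + ratr (r : rat) else fun=> 0.
pose ok n := `[< cbox (ra n) (rb n) `<=` A >].
(* An index that decodes to a box leaving A is sent to a fixed box around [x0], so that the cover is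
   indexed by all of nat. *)
exists (fun n => if ok n then ra n else fun i => x0 ord0 i - e0), (fun n => if ok n then rb n else fun i => x0 ord0 i + e0).
split.
  move=> n; case: ifPn => [/asboolP//|_] x //; exact: e0A.
apply/seteqP; split => [x Ax|x [n _]]; last first.
  case: ifPn => [/asboolP + H|_ H]; last apply: e0A;
    by try apply; move=> i; have /andP[? ?] := H i; rewrite !ltW.
have [e e_gt0 eA] := nbhs_cbox (open_nbhs_nbhs (conj oA Ax)).
(* With a centre within r of x in each coordinate, the box of radius r stays within 2 r < e of x. *)
have [r] := rat_in_itvoo (divr_gt0 e_gt0 (ltr0n R 2)); rewrite in_itv/= => /andP[r0 re].
have H i : exists q : rat, x ord0 i - ratr r < ratr q < x ord0 i + ratr r.
  have [|q] := @rat_in_itvoo R (x ord0 i - ratr r) (x ord0 i + ratr r).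
    by rewrite ltrD2l gt0_cp.
  by exists q.
pose q : 'rV[rat]_d := \row_i xchoose (H i).
have qx i : `|x ord0 i - ratr (q ord0 i)| < ratr r.
  by rewrite mxE distrC ltr_distl; exact: (xchooseP (H i)).
pose n := pickle (q, r).
have rn : ra n = fun i => ratr (q ord0 i) - ratr r by rewrite /ra pickleK.
have rbn : rb n = fun i => ratr (q ord0 i) + ratr r by rewrite /rb pickleK.
have okn : ok n.
  apply/asboolP => y yab; apply: eA => i; have := yab i.
  rewrite rn rbn -!ler_distl => yq.
  rewrite -(subrK (ratr (q ord0 i)) (y ord0 i)) -addrA (le_trans (ler_normD _ _))//.
  rewrite (splitr e) lerD//; first by rewrite (le_trans yq)// ltW.
  by rewrite distrC ltW// (lt_trans (qx i)).
exists n => // i; rewrite okn rn rbn -ltr_distl; exact: qx.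
Qed.

(** The sigma-algebra is generated by the coordinates, not by the topology; countability of the
    cover by boxes bridges the two. *)
Lemma open_measurable_rV A : open A -> measurable A.
Proof.
have [-> _|/set0P A0] := eqVneq A set0; first exact: measurable0.
move=> /(open_bigcup_obox A0)[a [b [_ ->]]].
by apply: bigcupT_measurable => n; exact: measurable_obox.
Qed.

Lemma continuous_measurable_rV (f : pt -> R) :
  continuous f -> measurable_fun setT f.
Proof.
move=> /continuousP cf; apply: (measurability _ (measurable_realfun.RGenOpens.measurableE R)).
move=> _ [_ [a [b ->] <-]]; rewrite setTI; apply: open_measurable_rV.
exact/cf/interval_open.
Qed.

Lemma compact_cbox a b : compact (cbox a b).
Proof.
rewrite (_ : cbox a b = [set v | forall i, `[a i, b i]%classic (v ord0 i)]).
  exact: (@rV_compact R d _ (fun i => @segment_compact R (a i) (b i))).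
by apply/seteqP; split => x /= H i; have := H i; rewrite /= in_itv/=.
Qed.

Lemma closed_cbox a b : closed (cbox a b).
Proof.
apply: compact_closed; last exact: compact_cbox.
exact: norm_hausdorff.
Qed.

Lemma bounded_sub_cbox A : bounded_set A ->
  exists M : R, 0 < M /\ A `<=` cbox (fun=> - M) (fun=> M).
Proof.
move=> [M [_ HM]]; exists (`|M| + 1); split; first by rewrite ltr_wpDl.
have MM : M < `|M| + 1 by rewrite (le_lt_trans (ler_norm M))// ltrDl.
move=> x Ax i; have := HM _ MM x Ax; rewrite -ler_norml.
apply: le_trans; rewrite [leRHS]mx_normrE.
exact: (le_bigmax _ (fun ij : 'I_1 * 'I_d => `|x ij.1 ij.2|) (ord0, i)).
Qed.

Lemma continuous_compact_support_bounded (f : pt -> R) a b :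
  continuous f -> (forall x, f x != 0 -> cbox a b x) ->
  exists2 M, 0 <= M & forall x, `|f x| <= M.
Proof.
move=> cf fab.
have [[x0 x0ab]|] := pselect (cbox a b !=set0); last first.
  move=> ab; exists 0 => // x.
  have [->|/fab abx] := eqVneq (f x) 0; first by rewrite normr0.
  by exfalso; apply: ab; exists x.
have cnf : {within cbox a b, continuous (Num.norm \o f)}.
  apply: continuous_subspaceT => x; apply: continuous_comp; first exact: cf.
  exact: norm_continuous.
have [c _ Hc] := EVT_max_rV (ex_intro _ _ x0ab) (@compact_cbox a b) cnf.
exists `|f c| => // x.
have [->|/fab abx] := eqVneq (f x) 0; first by rewrite normr0.
by apply: Hc; rewrite inE.
Qed.

Lemma derive_lineE (f : pt -> R) x v (s : R) :
  (fun h : R => h^-1 *: (f (h *: v + (s *: v + x)) - f (s *: v + x))) =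
  (fun h : R => h^-1 *: (f ((h *: 1 + s) *: v + x) - f (s *: v + x))).
Proof.
by apply/funext => h; rewrite scalerDl addrA [h *: 1]mulr1.
Qed.

(** Restriction to a line turns directional derivatives into one-variable ones, both for products of
    bumps and on the fibres used with Fubini. *)
Lemma is_derive_line (f : pt -> R) x v (s df : R) :
  is_derive (s *: v + x) v f df <->
  is_derive s 1 (fun s : R => f (s *: v + x)) df.
Proof.
by split=> -[df1 df2]; apply: DeriveDef; move: df1 df2;
  rewrite /derivable /derive derive_lineE.
Qed.

End topology_of_rV.

Section product_functions.
Context {R : realType} {d : nat}.
Notation pt := 'rV[R]_d.
Implicit Types (g : 'I_d -> R -> R).

Definition prodf g (x : pt) : R := \prod_(i < d) g i (x ord0 i).

Lemma prodf_line g x (j : 'I_d) (s : R) :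
  prodf g (s *: unit_vec j + x) =
  (\prod_(i < d | i != j) g i (x ord0 i)) * g j (s + x ord0 j).
Proof.
rewrite /prodf (bigD1 j)//= mulrC; congr (_ * _).
  apply: eq_bigr => i ij; rewrite !mxE eqxx/= (negbTE ij) mulr0 add0r//.
by rewrite !mxE !eqxx mulr1.
Qed.

Lemma is_derive_prodf g x j : (forall i, smooth1 (g i)) ->
  is_derive x (unit_vec j) (prodf g)
    (prodf (fun i => if i == j then derive1 (g j) else g i) x).
Proof.
move=> sg; rewrite -[x]add0r -{1}(scale0r (unit_vec j)).
apply/is_derive_line; rewrite add0r.
under eq_fun do rewrite prodf_line.
rewrite /prodf [X in is_derive _ _ _ X](bigD1 j)//= eqxx mulrC.
under [X in X * _]eq_bigr => i ij do rewrite (negbTE ij).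
have dg : is_derive (0 : R) 1 (fun s => g j (s + x ord0 j)) (derive1 (g j) (x ord0 j)).
  rewrite (_ : (fun s => _) = (fun t => g j (1 * t + x ord0 j))); last first.
    by apply/funext => t; rewrite mul1r.
  have H : is_derive (1 * 0 + x ord0 j) 1 (g j) (derive1 (g j) (x ord0 j)).
    rewrite mulr0 add0r derive1E; apply: derivableP; exact: smooth1_derivable.
  by have := is_derive_affine H; rewrite mul1r.
exact: (is_deriveZ _ dg).
Qed.

(** Only the multiplicity of each index in [s] matters, so partial derivatives of such products
    visibly commute; commutation for general test functions is deduced from this case by duality. *)
Lemma iter_partial_prodf g s : (forall i, smooth1 (g i)) ->
  iter_partial s (prodf g) = prodf (fun i => derive1n (count_mem i s) (g i)).
Proof.
move=> sg; elim: s => [//|j s IH] /=; rewrite IH; apply/funext => x.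
have sg' i : smooth1 (derive1n (count_mem i s) (g i)).
  exact: smooth1_derive1n.
have [_ ->] := is_derive_prodf x j sg'.
apply: eq_bigr => i _; rewrite eq_sym; case: eqP => [->|//]/=.
by [].
Qed.

Lemma continuous_prodf g : (forall i, continuous (g i)) -> continuous (prodf g).
Proof.
move=> cg; rewrite /prodf; elim: (index_enum _) => [|i r IH].
  by under eq_fun do rewrite big_nil; exact: cst_continuous.
under eq_fun do rewrite big_cons.
move=> x.
have c1 : {for x, continuous (g i \o (fun y : pt => y ord0 i))}.
  by apply: continuous_comp; [exact: coord_continuous|exact: cg].
exact: (continuousM c1 (IH x)).
Qed.

Lemma smooth_prodf g : (forall i, smooth1 (g i)) -> smooth (prodf g).
Proof.
move=> sg s; rewrite iter_partial_prodf//.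
have sg' i : smooth1 (derive1n (count_mem i s) (g i)).
  exact: smooth1_derive1n.
split; first by apply: continuous_prodf => i; exact: smooth1_continuous.
by move=> i x; have [] := is_derive_prodf x i sg'.
Qed.

Lemma test_fun_prod_bump (Omega : set pt) (c : R) a b : 0 < c -> cbox a b `<=` Omega ->
  test_fun Omega (prodf (fun i => bumpf c (a i) (b i))).
Proof.
move=> c0 abO.
have sub : [set x | prodf (fun i => bumpf c (a i) (b i)) x != 0] `<=` cbox a b.
  move=> x /= H i; apply: contraNT H => H; rewrite /prodf (bigD1 i)//=.
  rewrite bump_out ?mul0r//; apply: contra H => /andP[? ?].
  by rewrite !ltW.
have csub : closure [set x | prodf (fun i => bumpf c (a i) (b i)) x != 0] `<=` cbox a b.
  by have /closure_id -> := @closed_cbox _ _ a b; exact: closure_subset.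
split.
- by apply: smooth_prodf => i; exact: bump_smooth.
- apply: (subclosed_compact _ (@compact_cbox _ _ a b) csub); exact: closed_closure.
- exact: subset_trans abO.
Qed.

End product_functions.

(** * Integration by parts on R^d *)

Section integration_on_rV.
Context {R : realType}.
Notation leb n := (lebesgue_rV n : {measure set 'rV[R]_n -> \bar R}).
Notation leb1 := (@lebesgue_measure R).

Lemma lebesgue_cbox_lty n (a b : 'I_n -> R) : (leb n (cbox a b) < +oo)%E.
Proof.
have -> : leb n (cbox a b) = (\prod_(i < n) leb1 `[a i, b i]%classic)%E.
  by rewrite -lebesgue_rV_box//; congr (lebesgue_rV n _).
rewrite ltey_eq; apply/orP; left; apply: (big_ind (fun x => x \is a fin_num)) => //.
  by move=> x y; exact: fin_numM.
by move=> i _; rewrite lebesgue_measure_itv; case: ifP => // _; rewrite -EFinB.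
Qed.

Lemma measurable_cbox n (a b : 'I_n -> R) : measurable (cbox a b).
Proof.
rewrite -[cbox a b]setCK; apply: measurableC; apply: open_measurable_rV.
by apply: closed_openC; exact: closed_cbox.
Qed.

Lemma integrable_bounded_support n (f : 'rV[R]_n -> R) a b (M : R) :
  measurable_fun setT f -> (forall x, `|f x| <= M) ->
  (forall x, f x != 0 -> cbox a b x) -> (leb n).-integrable setT (EFin \o f).
Proof.
move=> mf fM fab.
have -> : EFin \o f = (EFin \o f) \_ (cbox a b).
  apply/funext => x; rewrite /patch; case: ifPn => // /negP xab /=.
  by have [->//|/fab abx] := eqVneq (f x) 0; exfalso; apply: xab; rewrite inE.
apply/(integrable_mkcond (EFin \o f) (@measurable_cbox _ a b)).
apply: measurable_bounded_integrable.
- exact: measurable_cbox.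
- exact: lebesgue_cbox_lty.
- exact: measurable_funTS.
- exists M; split; first by rewrite num_real.
  by move=> y My x _ /=; rewrite (le_trans (fM x))// ltW.
Qed.

Lemma integrable_continuous_support n (f : 'rV[R]_n -> R) a b :
  continuous f -> (forall x, f x != 0 -> cbox a b x) ->
  (leb n).-integrable setT (EFin \o f).
Proof.
move=> cf fab.
have [M _ HM] := continuous_compact_support_bounded cf fab.
exact: integrable_bounded_support (continuous_measurable_rV cf) HM fab.
Qed.

(** The measure in dimension n + 1 is by construction the pushforward of a product by [consrV], so
    splitting off the first coordinate is a change of variables, after which Fubini applies. *)
Lemma integral_rVS n (f : 'rV[R]_n.+1 -> R) :
  (leb n.+1).-integrable setT (EFin \o f) ->
  (leb1 \x lebesgue_rV n)%E.-integrable setT (fun p => (f (consrV p))%:E) /\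
  (\int[leb n.+1]_x (f x)%:E =
   \int[(leb1 \x lebesgue_rV n)%E]_p (f (consrV p))%:E)%E.
Proof.
move=> fi; have [mf foo] := integrableP _ _ _ fi.
have mc : measurable_fun [set: (g_sigma_algebraType R.-ocitv.-measurable * 'rV[R]_n)%type]
    (@consrV R n) by exact: measurable_consrV.
have fi' : (leb1 \x lebesgue_rV n)%E.-integrable setT (fun p => (f (consrV p))%:E).
  apply/integrableP; split.
    by move=> _ Y mY; have := mc measurableT _ (mf measurableT Y mY); rewrite !setTI.
  move: foo; rewrite (@ge0_integral_pushforward _ _ _ _ _ _ mc)//.
  by have [] := integrableP _ _ _ (integrable_abse fi).
split => //.
by rewrite (@integral_pushforward _ _ _ _ _ _ mc).
Qed.

Lemma continuous_rV (V : topologicalType) n (F : V -> 'rV[R]_n) :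
  (forall i, continuous (fun y => F y ord0 i)) -> continuous F.
Proof.
move=> cF y; apply/cvg_ballP => e e0.
have : \forall z \near y, forall i, ball (F y ord0 i) e (F z ord0 i).
  apply: filter_forall => i; apply: (cF i y); exact: nbhsx_ballx.
by apply: filterS => z H; split => // i j; rewrite ord1.
Qed.

Lemma continuous_consrVl n (t : R) : continuous (fun y : 'rV[R]_n => consrV (t, y)).
Proof.
apply: continuous_rV => j; case: (unliftP ord0 j) => [k ->|->].
  by under eq_fun do rewrite consrVS; exact: coord_continuous.
by under eq_fun do rewrite consrV0; exact: cst_continuous.
Qed.

Lemma continuous_consrVr n (y : 'rV[R]_n) : continuous (fun t : R => consrV (t, y)).
Proof.
apply: continuous_rV => j; case: (unliftP ord0 j) => [k ->|->].
  by under eq_fun do rewrite consrVS; exact: cst_continuous.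
by under eq_fun do rewrite consrV0/=; move=> t; exact: cvg_id.
Qed.

Lemma consrV_line0 n t s (y : 'rV[R]_n) :
  consrV (t + s, y) = t *: unit_vec ord0 + consrV (s, y).
Proof.
apply/rowP => j; rewrite /unit_vec [RHS]mxE [X in _ = X + _]mxE [X in _ = _ * X + _]mxE eqxx/=.
case: (unliftP ord0 j) => [k ->|->]; first by rewrite !consrVS mulr0 add0r.
by rewrite !consrV0 eqxx mulr1.
Qed.

Lemma consrV_lineS n t s (i : 'I_n) (y : 'rV[R]_n) :
  consrV (t, s *: unit_vec i + y) = s *: unit_vec (lift ord0 i) + consrV (t, y).
Proof.
apply/rowP => j; rewrite /unit_vec [RHS]mxE [X in _ = X + _]mxE [X in _ = _ * X + _]mxE eqxx/=.
case: (unliftP ord0 j) => [k ->|->]; last by rewrite !consrV0 mulr0 add0r.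
by rewrite !consrVS !mxE eqxx/= (inj_eq lift_inj).
Qed.

Lemma integral_derive_support1 (f g : R -> R) (M : R) :
  (forall t : R, is_derive t 1 f (g t)) -> continuous g ->
  (forall t, f t != 0 -> - M <= t <= M) -> (forall t, g t != 0 -> - M <= t <= M) ->
  (\int[leb1]_t (g t)%:E = 0)%E.
Proof.
(* N exceeds M strictly, so f vanishes at both ends of [[-N, N]]; the absolute value keeps this
   interval nondegenerate even for negative M. *)
move=> fg cg f0 g0; pose N : R := `|M| + 1.
have MN : M < N by rewrite (le_lt_trans (ler_norm M))// ltrDl.
have NN : - N < N by rewrite gtrN// ltr_wpDl.
have gN t : ~~ (- N <= t <= N) -> g t = 0.
  move=> tN; apply: contraNeq tN => /g0/andP[Mt tM].
  by rewrite (le_trans _ Mt) ?lerN2 ?(ltW MN)// (le_trans tM)// ltW.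
have fN t : `|t| = N -> f t = 0.
  move=> tN; apply/eqP; apply: contraTT MN => /f0; rewrite -ler_norml tN.
  by rewrite leNgt.
have -> : (\int[leb1]_t (g t)%:E = \int[leb1]_(t in `[(- N)%R, N]) (g t)%:E)%E.
  rewrite [RHS]integral_mkcond/=; apply: eq_integral => t _.
  by rewrite /patch; case: ifPn => //; rewrite notin_setE/= in_itv/= => /negP/gN ->.
have cf : continuous f.
  move=> t; apply/differentiable_continuous/derivable1_diffP.
  by have [] := fg t.
rewrite (@continuous_FTC2 _ g f)//.
- have N0 : 0 <= N by rewrite addr_ge0.
  by rewrite !fN ?subee// ?normrN ger0_norm.
- exact: continuous_subspaceT.
- split.
  + by move=> t _; have [] := fg t.
  + exact/cvg_at_right_filter/cf.
  + exact/cvg_at_left_filter/cf.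
- by move=> t _; rewrite derive1E; have [_ ->] := fg t.
Qed.

(** Induction on the dimension. If i is the first coordinate, that variable is integrated first and
    the one-dimensional case applies on each line; otherwise the remaining variables are integrated
    first and the induction hypothesis applies on each hyperplane. *)
Lemma integral_derive_support n (i : 'I_n) (f g : 'rV[R]_n -> R) (M : R) :
  (forall x, is_derive x (unit_vec i) f (g x)) ->
  continuous f -> continuous g ->
  (forall x, f x != 0 -> cbox (fun=> - M) (fun=> M) x) ->
  (forall x, g x != 0 -> cbox (fun=> - M) (fun=> M) x) ->
  (\int[leb n]_x (g x)%:E = 0)%E.
Proof.
elim: n i f g => [[]//|n IH] i f g fg cf cg f0 g0.
have [gi ->] := integral_rVS (integrable_continuous_support cg g0).
case: (unliftP ord0 i) => [j|] ij; rewrite {}ij {i} in fg.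
- rewrite -(integral12_prod_meas1 gi); apply: integral0_eq => t _.
  rewrite /fubini_F/=.
  apply: (IH j (fun y => f (consrV (t, y))) (fun y => g (consrV (t, y)))).
  + move=> y; rewrite -[y]add0r -[X in X + y](scale0r (unit_vec j)).
    apply/is_derive_line; under eq_fun do rewrite consrV_lineS.
    by apply/is_derive_line; rewrite scale0r add0r scale0r add0r; exact: fg.
  + by move=> y; apply: continuous_comp; [exact: continuous_consrVl|exact: cf].
  + by move=> y; apply: continuous_comp; [exact: continuous_consrVl|exact: cg].
  + by move=> y /f0 H k; have := H (lift ord0 k); rewrite consrVS.
  + by move=> y /g0 H k; have := H (lift ord0 k); rewrite consrVS.
- rewrite -(integral21_prod_meas1 gi); apply: integral0_eq => y _.
  rewrite /fubini_G/=.
  apply: (@integral_derive_support1 (fun t => f (consrV (t, y))) _ M).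
  + move=> t.
    have -> : (fun t => f (consrV (t, y))) =
      fun t => f (t *: unit_vec ord0 + consrV (0, y)).
      by apply/funext => s; rewrite -consrV_line0 addr0.
    have -> : consrV (t, y) = t *: unit_vec ord0 + consrV (0, y).
      by rewrite -consrV_line0 addr0.
    by apply/is_derive_line; exact: fg.
  + by move=> t; apply: continuous_comp; [exact: continuous_consrVr|exact: cg].
  + by move=> t /f0/(_ ord0); rewrite consrV0.
  + by move=> t /g0/(_ ord0); rewrite consrV0.
Qed.

End integration_on_rV.

(** * Square-integrable functions *)

(** A quadratic polynomial that is nonnegative everywhere has nonpositive discriminant: evaluate at
    the minimiser [B / D], or, if D = 0, use that an affine function bounded below is constant. Both
    Cauchy-Schwarz inequalities, for functions and for matrix fields, rest on it. *)
Lemma discriminant_le (R : realFieldType) (A B D : R) : 0 <= A -> 0 <= D ->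
  (forall s, 0 <= A - 2 * s * B + s ^+ 2 * D) -> B ^+ 2 <= A * D.
Proof.
move=> A0 D0 H; have [D1|D1] := eqVneq D 0.
  subst D; have [->|B1] := eqVneq B 0; first by rewrite expr0n/= mulr0.
  (* At this point the affine function takes the value -1. *)
  have := H ((A + 1) / (2 * B)).
  have -> : 2 * ((A + 1) / (2 * B)) * B = A + 1 by field.
  by rewrite mulr0 addr0; lra.
have Dp : 0 < D by rewrite lt_neqAle eq_sym D1.
have := H (B / D).
have -> : A - 2 * (B / D) * B + (B / D) ^+ 2 * D = (A * D - B ^+ 2) / D by field.
by rewrite pmulr_lge0 ?invr_gt0// subr_ge0.
Qed.

HB.lock Definition ip (R : realType) (d : nat) (Omega : set 'rV[R]_d)
    (f g : 'rV[R]_d -> R) : R :=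
  \int[(lebesgue_rV d : {measure set 'rV[R]_d -> \bar R})]_(x in Omega) (f x * g x).

Section square_integrable_functions.
Context {R : realType} {d : nat}.
Notation pt := 'rV[R]_d.
Notation leb := (lebesgue_rV d : {measure set pt -> \bar R}).
Variables (Omega : set pt) (mO : measurable Omega).
Implicit Types f g : pt -> R.

Lemma L2_integrable_mul f g : L2 Omega f -> L2 Omega g ->
  leb.-integrable Omega (EFin \o (f \* g)).
Proof.
move=> [mf foo] [mg goo].
have isq (k : pt -> R) : measurable_fun Omega k ->
    (\int[leb]_(x in Omega) (k x ^+ 2)%:E < +oo)%E ->
    leb.-integrable Omega (EFin \o (fun x => k x ^+ 2)).
  move=> mk koo; apply/integrableP; split.
    by apply/measurable_EFinP; exact: measurable_funX.
  move: koo; apply: le_lt_trans; rewrite le_eqVlt; apply/orP; left; apply/eqP.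
  by apply: eq_integral => x _ /=; rewrite ger0_norm// sqr_ge0.
have H := @integrableD _ _ _ leb _ mO _ _ (isq f mf foo) (isq g mg goo).
apply: (le_integrable mO _ _ H); first by apply/measurable_EFinP; exact: measurable_funM.
move=> x _ /=; rewrite !lee_fin [leRHS]ger0_norm ?addr_ge0 ?sqr_ge0//.
rewrite normrM -(real_normK (num_real (f x))) -(real_normK (num_real (g x))).
have := sqr_ge0 (`|f x| - `|g x|); have := sqr_ge0 (`|f x| + `|g x|).
by nra.
Qed.

Lemma L2P f : measurable_fun Omega f ->
  leb.-integrable Omega (EFin \o (f \* f)) -> L2 Omega f.
Proof.
move=> mf /integrableP[_ foo]; split => //; move: foo; apply: le_lt_trans.
apply: ge0_le_integral => //.
- by move=> x _; rewrite lee_fin sqr_ge0.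
- by apply/measurable_EFinP; exact: measurable_funX.
- by apply/measurable_EFinP; apply: measurableT_comp => //; exact: measurable_funM.
- by move=> x _ /=; rewrite lee_fin expr2 ler_norm.
Qed.

Lemma L2_dominated f g : measurable_fun Omega f -> L2 Omega g ->
  (forall x, Omega x -> `|f x| <= `|g x|) -> L2 Omega f.
Proof.
move=> mf [mg goo] fg; split => //; move: goo; apply: le_lt_trans.
apply: ge0_le_integral => //.
- by move=> x _; rewrite lee_fin sqr_ge0.
- by apply/measurable_EFinP; exact: measurable_funX.
- by apply/measurable_EFinP; exact: measurable_funX.
- move=> x Ox; rewrite lee_fin -(real_normK (num_real (f x))) -(real_normK (num_real (g x))).
  by rewrite ler_sqr ?nnegrE// fg.
Qed.

Lemma L2Z (a : R) f : L2 Omega f -> L2 Omega (fun x => a * f x).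
Proof.
move=> f2; have [mf _] := f2.
have maf : measurable_fun Omega (fun x => a * f x) by exact: measurable_funM.
apply: L2P => //; have := integrableZl mO (a * a) (L2_integrable_mul f2 f2).
apply: eq_integrable => // x _ /=; rewrite -EFinM; congr EFin.
by rewrite mulrACA.
Qed.

Lemma L2D f g : L2 Omega f -> L2 Omega g -> L2 Omega (fun x => f x + g x).
Proof.
move=> f2 g2; have [mf _] := f2; have [mg _] := g2.
apply: L2P; first exact: measurable_funD.
have ff := L2_integrable_mul f2 f2; have gg := L2_integrable_mul g2 g2.
have fg := L2_integrable_mul f2 g2.
have := integrableD mO (integrableD mO ff gg) (integrableD mO fg fg).
apply: eq_integrable => // x _ /=; rewrite -!EFinD; congr EFin.
by ring.
Qed.

Lemma L2N f : L2 Omega f -> L2 Omega (fun x => - f x).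
Proof. by move=> /(L2Z (-1)); under eq_fun do rewrite mulN1r. Qed.

Lemma L2B f g : L2 Omega f -> L2 Omega g -> L2 Omega (fun x => f x - g x).
Proof. by move=> f2 /L2N; exact: L2D. Qed.

Lemma L2_cst0 : L2 Omega (fun=> 0).
Proof.
apply: L2P; first exact: measurable_cst.
by apply: (eq_integrable _ (cst 0%E)) => //; [move=> x _ /=; rewrite mulr0|exact: integrable0].
Qed.

Lemma L2_sum (I : Type) (r : seq I) (P : pred I) (F : I -> pt -> R) :
  (forall i, P i -> L2 Omega (F i)) -> L2 Omega (fun x => \sum_(i <- r | P i) F i x).
Proof.
move=> HF; elim: r => [|i r IH].
  by under eq_fun do rewrite big_nil; exact: L2_cst0.
under eq_fun do rewrite big_cons.
case Pi : (P i) => //; apply: L2D => //; exact: HF.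
Qed.

Notation ip := (ip Omega).

Lemma ipE f g : ip f g = \int[leb]_(x in Omega) (f x * g x).
Proof. by rewrite unlock. Qed.

Lemma ipC f g : ip f g = ip g f.
Proof. by rewrite !ipE; apply: eq_Rintegral => x _; rewrite mulrC. Qed.

Lemma ipDl f g h : L2 Omega f -> L2 Omega g -> L2 Omega h ->
  ip (fun x => f x + g x) h = ip f h + ip g h.
Proof.
move=> f2 g2 h2; rewrite !ipE -RintegralD//; try exact: L2_integrable_mul.
by apply: eq_Rintegral => x _; rewrite mulrDl.
Qed.

Lemma ipZl a f h : L2 Omega f -> L2 Omega h ->
  ip (fun x => a * f x) h = a * ip f h.
Proof.
move=> f2 h2; rewrite !ipE -RintegralZl//; last exact: L2_integrable_mul.
by apply: eq_Rintegral => x _; rewrite mulrA.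
Qed.

Lemma ipNl f h : L2 Omega f -> L2 Omega h -> ip (fun x => - f x) h = - ip f h.
Proof.
move=> f2 h2; rewrite -mulN1r -ipZl//.
by congr (ip _ h); apply/funext => x; rewrite mulN1r.
Qed.

Lemma ipBl f g h : L2 Omega f -> L2 Omega g -> L2 Omega h ->
  ip (fun x => f x - g x) h = ip f h - ip g h.
Proof. by move=> f2 g2 h2; rewrite -ipNl// -ipDl//; exact: L2N. Qed.

Lemma ipDr f g h : L2 Omega f -> L2 Omega g -> L2 Omega h ->
  ip h (fun x => f x + g x) = ip h f + ip h g.
Proof. by move=> f2 g2 h2; rewrite ipC ipDl// !(ipC h). Qed.

Lemma ipZr a f h : L2 Omega f -> L2 Omega h ->
  ip h (fun x => a * f x) = a * ip h f.
Proof. by move=> f2 h2; rewrite ipC ipZl// !(ipC h). Qed.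

Lemma ipBr f g h : L2 Omega f -> L2 Omega g -> L2 Omega h ->
  ip h (fun x => f x - g x) = ip h f - ip h g.
Proof. by move=> f2 g2 h2; rewrite ipC ipBl// !(ipC h). Qed.

Lemma ip_suml (I : Type) (r : seq I) (F : I -> pt -> R) h :
  (forall i, L2 Omega (F i)) -> L2 Omega h ->
  ip (fun x => \sum_(i <- r) F i x) h = \sum_(i <- r) ip (F i) h.
Proof.
move=> HF h2; elim: r => [|i r IH].
  rewrite big_nil ipE; under eq_Rintegral do rewrite big_nil mul0r.
  by rewrite Rintegral_cst// mul0r.
rewrite big_cons -IH -ipDl//; last exact: L2_sum.
by rewrite !ipE; apply: eq_Rintegral => x _; rewrite big_cons.
Qed.

Lemma ip_ge0 f : 0 <= ip f f.
Proof. by rewrite ipE; apply: Rintegral_ge0 => x _; rewrite -expr2 sqr_ge0. Qed.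

Lemma L2norm_ge0 f : 0 <= L2norm Omega f.
Proof. exact: sqrtr_ge0. Qed.

Lemma L2norm_sqr f : L2norm Omega f ^+ 2 = ip f f.
Proof.
rewrite /L2norm sqr_sqrtr; last by apply: Rintegral_ge0 => x _; rewrite sqr_ge0.
by rewrite ipE; apply: eq_Rintegral => x _; rewrite expr2.
Qed.

Lemma L2_CauchySchwarz f g : L2 Omega f -> L2 Omega g ->
  `|ip f g| <= L2norm Omega f * L2norm Omega g.
Proof.
move=> f2 g2.
have H s : 0 <= ip f f - 2 * s * ip f g + s ^+ 2 * ip g g.
  have sg := L2Z s g2.
  have := ip_ge0 (fun x => f x - s * g x).
  rewrite ipBl//; last exact: L2B.
  rewrite !ipBr// !ipZl// !ipZr// (ipC g f).
  by move=> /le_trans; apply; rewrite le_eqVlt; apply/orP; left; apply/eqP; ring.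
rewrite -ler_sqr ?nnegrE ?mulr_ge0 ?L2norm_ge0// real_normK ?num_real//.
rewrite exprMn !L2norm_sqr; apply: discriminant_le => //; exact: ip_ge0.
Qed.

Lemma ae_eq_Rintegral f g : measurable_fun Omega f -> measurable_fun Omega g ->
  {ae leb, forall x, Omega x -> f x = g x} ->
  \int[leb]_(x in Omega) f x = \int[leb]_(x in Omega) g x.
Proof.
move=> mf mg fg; congr fine; apply: ae_eq_integral => //; try exact/measurable_EFinP.
exact: (ae_eq_comp EFin fg).
Qed.

Lemma eq_L2norm f g : (forall x, Omega x -> f x ^+ 2 = g x ^+ 2) ->
  L2norm Omega f = L2norm Omega g.
Proof.
move=> fg; rewrite /L2norm; congr Num.sqrt; apply: eq_Rintegral => x.
by rewrite inE => /fg.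
Qed.

Lemma L2norm_le f g : L2 Omega f -> L2 Omega g ->
  (forall x, Omega x -> `|f x| <= `|g x|) -> L2norm Omega f <= L2norm Omega g.
Proof.
move=> f2 g2 fg; rewrite /L2norm ler_wsqrtr//; apply: le_Rintegral => //.
- by have := L2_integrable_mul f2 f2; apply: eq_integrable.
- by have := L2_integrable_mul g2 g2; apply: eq_integrable.
- move=> x Ox; rewrite -(real_normK (num_real (f x))) -(real_normK (num_real (g x))).
  by rewrite ler_sqr ?nnegrE// fg.
Qed.

Lemma L2normZ (a : R) f : L2 Omega f ->
  L2norm Omega (fun x => a * f x) = `|a| * L2norm Omega f.
Proof.
move=> f2; apply/eqP; rewrite -(@eqrXn2 _ 2) ?mulr_ge0 ?L2norm_ge0//.
rewrite exprMn !L2norm_sqr ipZl//; last exact: L2Z.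
by rewrite ipZr// real_normK ?num_real// mulrA -expr2.
Qed.

Lemma L2normD f g : L2 Omega f -> L2 Omega g ->
  L2norm Omega (fun x => f x + g x) <= L2norm Omega f + L2norm Omega g.
Proof.
move=> f2 g2; rewrite -ler_sqr ?nnegrE ?addr_ge0 ?L2norm_ge0// sqrrD !L2norm_sqr.
rewrite ipDl//; last exact: L2D.
rewrite !ipDr// (ipC g f).
have := le_trans (ler_norm _) (L2_CauchySchwarz f2 g2).
by rewrite mulr2n; lra.
Qed.

End square_integrable_functions.

(** * The fundamental lemma of the calculus of variations *)

Section fundamental_lemma.
Context {R : realType} {d : nat}.
Notation pt := 'rV[R]_d.
Notation leb := (lebesgue_rV d : {measure set pt -> \bar R}).

Lemma oboxI (a b a' b' : 'I_d -> R) : obox a b `&` obox a' b' =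
  obox (fun i => Num.max (a i) (a' i)) (fun i => Num.min (b i) (b' i)).
Proof.
apply/seteqP; split => [x [H H'] i|x H].
  by have /andP[? ?] := H i; have /andP[? ?] := H' i; rewrite gt_max lt_min; apply/andP; split; apply/andP.
by split => i; have := H i; rewrite gt_max lt_min => /andP[/andP[? ?] /andP[? ?]]; apply/andP.
Qed.

Lemma obox_sub_cbox (a b : 'I_d -> R) : obox a b `<=` cbox a b.
Proof. by move=> x H i; have /andP[? ?] := H i; rewrite !ltW. Qed.

(** Open boxes are stable under intersection, so this makes them a generating pi-system for Dynkin's
    theorem. The preimage of an interval under a coordinate is open, hence a countable union of
    boxes. *)
Lemma measurable_rV_oboxes : @measurable _ pt =
  <<s [set B | exists a b, B = obox a b] >>.
Proof.
set G := [set _ | _]; apply/seteqP; split; last first.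
  apply: smallest_sub; first exact: sigma_algebra_measurable.
  by move=> _ [a [b ->]]; exact: measurable_obox.
have mcoord i : measurable_fun setT (fun x : g_sigma_algebraType G => (x : pt) ord0 i).
  apply: (measurability _ (measurable_realfun.RGenOpens.measurableE R)).
  move=> _ [_ [a [b ->] <-]]; rewrite setTI.
  have : open ((fun x : pt => x ord0 i) @^-1` `]a, b[%classic).
    have /continuousP := @coord_continuous R 1 d ord0 i; apply.
    exact: interval_open.
  set A := (X in open X).
  suff : open A -> measurable (A : set (g_sigma_algebraType G)) by [].
  have [-> _|/set0P A0] := eqVneq A set0; first exact: measurable0.
  move=> /(open_bigcup_obox A0)[u [v [_ ->]]].
  apply: bigcupT_measurable => n; apply: sub_sigma_algebra.
  by exists (u n), (v n).
move=> A mA.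
have := @measurable_fun_rVP R _ (g_sigma_algebraType G) d id mcoord measurableT A mA.
by rewrite setTI.
Qed.

Lemma prodf_bumpf_itv c (a b : 'I_d -> R) x : 0 < c ->
  0 <= prodf (fun i => bumpf c (a i) (b i)) x <= 1.
Proof.
move=> c0; rewrite /prodf; elim: (index_enum _) => [|i r /andP[IH0 IH1]].
  by rewrite big_nil ler01 lexx.
by rewrite big_cons mulr_ge0 ?bump_ge0//= mulr_ile1 ?bump_ge0 ?bump_le1.
Qed.

Lemma prodf_bumpf_out c (a b : 'I_d -> R) x : ~ obox a b x ->
  prodf (fun i => bumpf c (a i) (b i)) x = 0.
Proof.
move=> abx; apply/eqP; apply/negPn/negP => /eqP H; apply: abx => i.
apply/negPn/negP => abx; apply: H.
by rewrite /prodf (bigD1 i)//= bump_out// mul0r.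
Qed.

(** As c tends to 0 the products of bumps tend to 1 on the box and stay below 1, so the integrals
    against them converge by domination by |e|. *)
Lemma integral_obox_eq0 (e : pt -> R) (a b : 'I_d -> R) :
  leb.-integrable (obox a b) (EFin \o e) ->
  (forall c, 0 < c -> (\int[leb]_(x in obox a b)
     (e x * prodf (fun i => bumpf c (a i) (b i)) x)%:E = 0)%E) ->
  (\int[leb]_(x in obox a b) (e x)%:E = 0)%E.
Proof.
move=> ie H; have mB := @measurable_obox _ d a b.
pose F (n : nat) (x : pt) := e x * prodf (fun i => bumpf n.+1%:R^-1 (a i) (b i)) x.
have me : measurable_fun (obox a b) e by apply/measurable_EFinP; exact: measurable_int ie.
have mF n : measurable_fun (obox a b) (F n).
  apply: measurable_funM => //; apply: measurable_funTS.
  apply: continuous_measurable_rV; apply: continuous_prodf => i.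
  by apply: smooth1_continuous; exact: bump_smooth.
have cF x : obox a b x -> (F n x)%:E @[n --> \oo] --> (e x)%:E.
  move=> abx; apply: cvg_EFin; first exact: nearW.
  rewrite /= /F -[X in _ --> X]mulr1; apply: cvgM; first exact: cvg_cst.
  rewrite /prodf; elim: (index_enum _) => [|i r IH].
    by under eq_fun do rewrite big_nil; exact: cvg_cst.
  under eq_fun do rewrite big_cons.
  have B := @bump_cvg R (a i) (b i) (x ord0 i); rewrite (abx i) in B.
  by have C := cvgM B IH; rewrite mulr1 in C; exact: C.
have Fe : {ae leb, forall x n, obox a b x -> (`|(F n x)%:E| <= `|e x|%:E)%E}.
  apply: aeW => x n _ /=; rewrite lee_fin normrM ler_piMr//.
  have n0 : 0 < n.+1%:R^-1 :> R by [].
  have /andP[p0 p1] := prodf_bumpf_itv a b x n0.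
  by rewrite ger0_norm.
have [_ _] := @dominated_convergence _ _ _ leb _ mB (fun n x => (F n x)%:E) (EFin \o e)
  (fun x => `|e x|%:E) (fun n => (measurable_EFinP _ _).2 (mF n)) (measurable_int _ ie)
  (aeW _ cF) (integrable_norm ie) Fe.
rewrite (_ : [sequence _]_n = cst 0%E); last by apply/funext => n; exact: H.
by move=> /(cvg_unique _ (cvg_cst _)) <-.
Qed.

(** Testing with products of bumps gives a vanishing integral on every box whose closure lies in
    Omega, hence e = 0 almost everywhere in such a box; countably many of them cover Omega. *)
Lemma fundamental_lemma (Omega : set pt) (e : pt -> R) : open Omega ->
  (forall a b, cbox a b `<=` Omega -> leb.-integrable (cbox a b) (EFin \o e)) ->
  (forall c a b, 0 < c -> cbox a b `<=` Omega ->
    \int[leb]_(x in Omega) (e x * prodf (fun i => bumpf c (a i) (b i)) x) = 0) ->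
  {ae leb, forall x, Omega x -> e x = 0}.
Proof.
move=> oO ie He.
have [->|/set0P O0] := eqVneq Omega set0; first by apply: aeW.
have H1 a b : cbox a b `<=` Omega -> (\int[leb]_(x in obox a b) (e x)%:E = 0)%E.
  move=> abO; have mB := @measurable_obox _ d a b.
  have ieB : leb.-integrable (obox a b) (EFin \o e).
    apply: integrableS (ie _ _ abO) => //; [exact: measurable_cbox|exact: obox_sub_cbox].
  apply: integral_obox_eq0 => // c c0.
  have := He _ _ _ c0 abO.
  set F := fun x => _; rewrite /Rintegral.
  have -> : (\int[leb]_(x in Omega) (F x)%:E = \int[leb]_(x in obox a b) (F x)%:E)%E.
    rewrite integral_mkcond [RHS]integral_mkcond; congr integral; apply/funext => x.
    rewrite /patch; have [abx|abx] := pselect (obox a b x).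
      by rewrite !mem_set//; apply: abO; exact: obox_sub_cbox.
    rewrite [in RHS]memNset//; case: ifPn => // _.
    by rewrite /F prodf_bumpf_out// mulr0.
  move=> F0; apply/eqP; rewrite -fine_eq0 ?F0//.
  apply: integrable_fin_num => //.
  have me : measurable_fun (obox a b) e.
    by apply/measurable_EFinP; exact: measurable_int ieB.
  apply: le_integrable ieB => //.
    apply/measurable_EFinP; apply: measurable_funM => //.
    apply: measurable_funTS; apply: continuous_measurable_rV.
    by apply: continuous_prodf => i; apply: smooth1_continuous; exact: bump_smooth.
  move=> x _ /=; rewrite lee_fin normrM ler_piMr//.
  by have /andP[p0 p1] := @prodf_bumpf_itv c a b x c0; rewrite ger0_norm.
have H2 a b : cbox a b `<=` Omega -> {ae leb, forall x, obox a b x -> e x = 0}.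
  move=> abO; have mB := @measurable_obox _ d a b.
  have ieB : leb.-integrable (obox a b) (EFin \o e).
    apply: integrableS (ie _ _ abO) => //; [exact: measurable_cbox|exact: obox_sub_cbox].
  (* Dynkin induction on S: a box cut by the given box is again a box with closure in Omega, and
     complements are handled by the vanishing integral over the whole box. *)
  have H3 S : measurable S -> (\int[leb]_(x in S `&` obox a b) (e x)%:E = 0)%E.
    rewrite measurable_rV_oboxes => mS; pattern S.
    apply: (dynkin_induction measurable_rV_oboxes) mS => //.
    - move=> _ _ [a1 [b1 ->]] [a2 [b2 ->]]; rewrite oboxI; by do 2 eexists.
    - by rewrite setTI; exact: H1.
    - move=> _ [a1 [b1 ->]]; rewrite oboxI; apply: H1; apply: subset_trans abO => x H i.
      by have := H i; rewrite ge_max le_min => /andP[/andP[_ ->] /andP[_ ->]].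
    - move=> S' mS' HS'; have := H1 _ _ abO.
      rewrite -[in X in X -> _](setIT (obox a b)) -(setUv S') setIUr.
      rewrite integral_setU//=; [|exact: measurableI|by apply: measurableI => //; exact: measurableC| |].
      + by rewrite setIC HS' add0e setIC.
      + by rewrite -setIUr setUv setIT; exact: measurable_int ieB.
      + by apply/disj_setPS; rewrite setIACA setICr setI0.
    - move=> F mF tF HF; rewrite setI_bigcupl integral_bigcup//.
      + by apply: eseries0 => k _ _; exact: HF.
      + exact: trivIset_setIr.
      + by move=> k; exact: measurableI.
      + apply: (integrableS mB) ieB; last by move=> x [k _ []].
        by apply: bigcupT_measurable => k; exact: measurableI.
  have := @integral_ae_eq _ _ _ leb _ mB (cst 0%E) (EFin \o e) ieB (measurable_cst _).
  have H4 : forall E, E `<=` obox a b -> measurable E ->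
      (\int[leb]_(x in E) (e x)%:E = \int[leb]_(x in E) 0)%E.
    by move=> E EB mE; rewrite integral0 -[E](setIidl EB) H3.
  by move=> /(_ H4); apply: filterS => x /= H /H [].
have [a [b [abO ->]]] := open_bigcup_obox O0 oO.
have : {ae leb, forall x, forall n, obox (a n) (b n) x -> e x = 0}.
  by apply: ae_foralln => n; exact: H2.
by apply: filterS => x H [n _]; exact: H.
Qed.

End fundamental_lemma.

(** * Distributional derivatives *)

HB.lock Definition cpartial (R : realType) (d : nat) (i : 'I_d)
    (phi : 'rV[R]_d -> R) : 'rV[R]_d -> R :=
  fun x => 'D_(unit_vec i) phi x.

Section test_functions.
Context {R : realType} {d : nat}.
Notation pt := 'rV[R]_d.
Notation leb := (lebesgue_rV d : {measure set pt -> \bar R}).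
Implicit Types (Omega : set pt) (f phi eta : pt -> R).

Lemma cpartialE i phi : cpartial i phi = fun x => 'D_(unit_vec i) phi x.
Proof. by rewrite unlock. Qed.

Lemma smooth_continuous phi : smooth phi -> continuous phi.
Proof. by move=> /(_ [::])[]. Qed.

Lemma smooth_is_derive phi x i : smooth phi ->
  is_derive x (unit_vec i) phi (cpartial i phi x).
Proof. by rewrite cpartialE => /(_ [::])[_ /(_ i x)]; exact: derivableP. Qed.

Lemma smooth_partial phi i : smooth phi -> smooth (cpartial i phi).
Proof.
rewrite cpartialE => sphi s; have := sphi (rcons s i).
by rewrite /iter_partial foldr_rcons.
Qed.

Lemma partial_support phi i x : cpartial i phi x != 0 ->
  closure [set x | phi x != 0] x.
Proof.
rewrite cpartialE => D0 A Ax; apply: contrapT => phiA; move/eqP: D0; apply.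
have phiA0 : \forall y \near x, cst 0 y = phi y.
  apply: filterS Ax => y Ay; apply/eqP; rewrite eq_sym; apply/negPn/negP => phiy.
  by apply: phiA; exists y.
have := @near_eq_derive R _ _ (cst 0) phi x (unit_vec i) phiA0.
by rewrite derive_cst => <-.
Qed.

Lemma test_fun_partial Omega phi i : test_fun Omega phi ->
  test_fun Omega (cpartial i phi).
Proof.
move=> [sphi cphi phiO].
have sub : closure [set x | cpartial i phi x != 0] `<=` closure [set x | phi x != 0].
  have /closure_id -> := @closed_closure _ [set x | phi x != 0].
  by apply: closure_subset => x; exact: partial_support.
split; first exact: smooth_partial.
- by apply: (subclosed_compact _ cphi sub); exact: closed_closure.
- exact: subset_trans phiO.
Qed.

Lemma test_fun_box Omega phi : test_fun Omega phi ->
  exists M : R, forall x, phi x != 0 -> cbox (fun=> - M) (fun=> M) x.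
Proof.
move=> [_ /compact_bounded/bounded_sub_cbox[M [_ HM]] _]; exists M => x phix.
by apply: HM; exact: subset_closure.
Qed.

Lemma test_fun_out Omega phi x : test_fun Omega phi -> ~ Omega x -> phi x = 0.
Proof.
move=> [_ _ phiO] Ox; apply/eqP; apply: contra_notT Ox => phix.
by apply: phiO; exact: subset_closure.
Qed.

Lemma test_fun_measurable Omega phi : test_fun Omega phi -> measurable_fun setT phi.
Proof. by move=> [sphi _ _]; apply: continuous_measurable_rV; exact: smooth_continuous. Qed.

Lemma Rintegral_out Omega f : (forall x, ~ Omega x -> f x = 0) ->
  \int[leb]_(x in Omega) f x = \int[leb]_x f x.
Proof.
move=> f0; rewrite Rintegral_mkcond; congr Rintegral; apply/funext => x.
by rewrite /patch; case: ifPn => //; rewrite notin_setE => /f0.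
Qed.

Variables (Omega : set pt) (mO : measurable Omega).

Lemma test_fun_L2 phi : test_fun Omega phi -> L2 Omega phi.
Proof.
move=> tphi; have mphi := test_fun_measurable tphi; have [M HM] := test_fun_box tphi.
apply: L2P => //; first exact: measurable_funTS.
have cphi : continuous phi by have [/smooth_continuous] := tphi.
have : leb.-integrable setT (EFin \o (phi \* phi)).
  apply: (@integrable_continuous_support _ _ _ (fun=> - M) (fun=> M)).
    by move=> x; apply: continuousM; exact: cphi.
  by move=> x; rewrite mulf_eq0 negb_or => /andP[/HM].
exact: integrableS.
Qed.

(** Both functions vanish outside Omega, so the integral extends to the whole space, where the
    integrand is the derivative of the compactly supported product [phi \* eta]. *)
Lemma test_fun_ibp phi eta i : test_fun Omega phi -> test_fun Omega eta ->
  ip Omega phi (cpartial i eta) = - ip Omega (cpartial i phi) eta.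
Proof.
move=> tphi teta; apply/eqP; rewrite -addr_eq0; apply/eqP.
have i1 := L2_integrable_mul mO (test_fun_L2 tphi) (test_fun_L2 (test_fun_partial i teta)).
have i2 := L2_integrable_mul mO (test_fun_L2 (test_fun_partial i tphi)) (test_fun_L2 teta).
rewrite !ipE -RintegralD// Rintegral_out; last first.
  by move=> x Ox; rewrite (test_fun_out tphi Ox) (test_fun_out teta Ox) mul0r mulr0 addr0.
have [M HM] := test_fun_box tphi; have [M' HM'] := test_fun_box (test_fun_partial i tphi).
have [sphi _ _] := tphi; have [seta _ _] := teta.
have cphi := smooth_continuous sphi; have ceta := smooth_continuous seta.
have cdphi := smooth_continuous (smooth_partial i sphi).
have cdeta := smooth_continuous (smooth_partial i seta).
pose N : R := Num.max M M'.
have NM x : cbox (fun=> - M) (fun=> M) x \/ cbox (fun=> - M') (fun=> M') x -> cbox (fun=> - N) (fun=> N) x.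
  have MN : M <= N by rewrite le_max lexx.
  have MN' : M' <= N by rewrite le_max lexx orbT.
  by move=> [] H j; have /andP[H1 H2] := H j; apply/andP; split;
     rewrite ?(le_trans H2)// (le_trans _ H1)// lerN2.
pose g x := phi x * cpartial i eta x + cpartial i phi x * eta x.
suff H : (\int[leb]_x (g x)%:E = 0)%E by rewrite /Rintegral H.
apply: (@integral_derive_support R d i (phi \* eta) g N).
- move=> x; apply: (is_derive_eq (is_deriveM (smooth_is_derive x i sphi) (smooth_is_derive x i seta))).
  by rewrite /GRing.scale/=; congr (_ + _); rewrite mulrC.
- by move=> x; apply: continuousM; [exact: cphi|exact: ceta].
- move=> x; have H1 := continuousM (cphi x) (cdeta x); have H2 := continuousM (cdphi x) (ceta x).
  exact: (continuousD H1 H2).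
- by move=> x; rewrite mulf_eq0 negb_or => /andP[/HM H _]; apply: NM; left.
- move=> x; rewrite /g => H; apply: NM; have [p0|/HM] := eqVneq (phi x) 0; last by left.
  right; apply: HM'; apply: contra_neq H => ->.
  by rewrite p0 !mul0r addr0.
Qed.

Lemma weak_partial_test_fun phi i : test_fun Omega phi ->
  weak_partial Omega i phi (cpartial i phi).
Proof.
move=> tphi; split; first exact/test_fun_L2/test_fun_partial.
by move=> eta teta; have := test_fun_ibp i tphi teta; rewrite !ipE cpartialE.
Qed.

End test_functions.

Section weak_derivatives.
Context {R : realType} {d : nat}.
Notation pt := 'rV[R]_d.
Notation leb := (lebesgue_rV d : {measure set pt -> \bar R}).
Variables (Omega : set pt) (oO : open Omega).
Implicit Types (f g phi eta : pt -> R).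

Let mO : measurable Omega. Proof. exact: open_measurable_rV. Qed.

Lemma L2_fundamental f : L2 Omega f ->
  (forall c a b, 0 < c -> cbox a b `<=` Omega ->
    ip Omega f (prodf (fun i => bumpf c (a i) (b i))) = 0) ->
  {ae leb, forall x, Omega x -> f x = 0}.
Proof.
move=> f2 H; apply: fundamental_lemma => // [a b abO|c a b c0 abO]; last by rewrite -ipE H.
have mC := @measurable_cbox _ _ a b.
have f2' : L2 (cbox a b) f.
  have [mf foo] := f2; split; first exact: measurable_funS mf.
  move: foo; apply: le_lt_trans; apply: ge0_subset_integral => //.
    by apply/measurable_EFinP; exact: measurable_funX.
  by move=> x _; rewrite lee_fin sqr_ge0.
have one2 : L2 (cbox a b) (fun=> 1).
  split; first exact: measurable_cst.
  rewrite integral_cst//; rewrite expr1n mul1e; exact: lebesgue_cbox_lty.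
have := L2_integrable_mul mC f2' one2.
by apply: eq_integrable => // x _ /=; rewrite mulr1.
Qed.

Lemma weak_partial_ip f g i phi : weak_partial Omega i f g -> test_fun Omega phi ->
  ip Omega f (cpartial i phi) = - ip Omega g phi.
Proof. by rewrite !ipE cpartialE => -[_]; exact. Qed.

(** [partial] is a chosen weak derivative; uniqueness allows replacing it by one that is known
    explicitly. *)
Lemma weak_partial_ae_eq f g1 g2 i : weak_partial Omega i f g1 ->
  weak_partial Omega i f g2 -> {ae leb, forall x, Omega x -> g1 x = g2 x}.
Proof.
move=> Hg1 Hg2; have [l1 _] := Hg1; have [l2 _] := Hg2.
have : {ae leb, forall x, Omega x -> g1 x - g2 x = 0}.
  apply: L2_fundamental; first exact: L2B.
  move=> c a b c0 abO; have tphi := test_fun_prod_bump c0 abO.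
  have phi2 := test_fun_L2 mO tphi.
  rewrite ipBl//; apply/eqP; rewrite subr_eq0 -eqr_opp; apply/eqP.
  by rewrite -(weak_partial_ip Hg1 tphi) -(weak_partial_ip Hg2 tphi).
by apply: filterS => x H Ox; apply/eqP; rewrite -subr_eq0 H.
Qed.

Lemma partialP f i : H1 Omega f -> weak_partial Omega i f (partial Omega i f).
Proof. by move=> [_ /(_ i)]; exact: xgetPex. Qed.

Lemma partial_L2 f i : H1 Omega f -> L2 Omega (partial Omega i f).
Proof. by move=> /(partialP i)[]. Qed.

(** Two integrations by parts move both derivatives onto a product of bumps, where they commute. The
    equality holds almost everywhere, which is enough under integrals. *)
Lemma test_fun_partialC phi i j : test_fun Omega phi ->
  {ae leb, forall x, Omega x ->
    cpartial i (cpartial j phi) x =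
    cpartial j (cpartial i phi) x}.
Proof.
move=> tphi; pose g1 := cpartial i (cpartial j phi); pose g2 := cpartial j (cpartial i phi).
have g12 : L2 Omega g1 by apply: test_fun_L2 => //; exact: (test_fun_partial _ (test_fun_partial _ tphi)).
have g22 : L2 Omega g2 by apply: test_fun_L2 => //; exact: (test_fun_partial _ (test_fun_partial _ tphi)).
have : {ae leb, forall x, Omega x -> g1 x - g2 x = 0}.
  apply: L2_fundamental; first exact: L2B.
  move=> c a b c0 abO; have teta := test_fun_prod_bump c0 abO.
  have eta2 := test_fun_L2 mO teta.
  have sb k : smooth1 (bumpf c (a k) (b k)) by exact: bump_smooth.
  set eta := prodf _ in teta eta2 *.
  have ED : (cpartial i (cpartial j eta)) =
            (cpartial j (cpartial i eta)).
    have := iter_partial_prodf [:: i; j] sb; have := iter_partial_prodf [:: j; i] sb.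
    rewrite -/eta => E1 E2; rewrite !cpartialE -[LHS]/(iter_partial [:: i; j] eta) -[RHS]/(iter_partial [:: j; i] eta) E1 E2; congr prodf; apply/funext => k.
    by rewrite /= addnCA.
  have H k l : ip Omega (cpartial k (cpartial l phi)) eta =
      ip Omega phi (cpartial l (cpartial k eta)).
    apply/eqP; rewrite -eqr_opp; apply/eqP.
    rewrite -test_fun_ibp//; last exact: test_fun_partial.
    by rewrite (test_fun_ibp mO l tphi (test_fun_partial k teta)) opprK.
  by rewrite ipBl// !H ED subrr.
by apply: filterS => x H Ox; apply/eqP; rewrite -subr_eq0 H.
Qed.

(** Moving the derivative from f to the test function leaves the same second mixed derivative of
    [phi] on both sides. *)
Lemma ip_mixed_partials_test_fun f fi fj phi i j : L2 Omega f ->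
  weak_partial Omega i f fi -> weak_partial Omega j f fj -> test_fun Omega phi ->
  ip Omega fi (cpartial j phi) = ip Omega fj (cpartial i phi).
Proof.
move=> f2 Hi Hj tphi; have [mf _] := f2.
have tD k := test_fun_partial k tphi.
apply/eqP; rewrite -eqr_opp; apply/eqP.
rewrite -(weak_partial_ip Hi (tD j)) -(weak_partial_ip Hj (tD i)) !ipE.
apply: ae_eq_Rintegral => //.
- by apply: measurable_funM => //; apply: measurable_funTS; exact: (test_fun_measurable (test_fun_partial _ (tD j))).
- by apply: measurable_funM => //; apply: measurable_funTS; exact: (test_fun_measurable (test_fun_partial _ (tD i))).
- by have := test_fun_partialC i j tphi; apply: filterS => x H Ox; rewrite H.
Qed.

Lemma weak_partialB f g df dg i : L2 Omega f -> L2 Omega g ->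
  weak_partial Omega i f df -> weak_partial Omega i g dg ->
  weak_partial Omega i (fun x => f x - g x) (fun x => df x - dg x).
Proof.
move=> f2 g2 Hf Hg; have [df2 _] := Hf; have [dg2 _] := Hg; split; first exact: L2B.
move=> phi tphi; have phi2 := test_fun_L2 mO tphi.
have dphi2 := test_fun_L2 mO (test_fun_partial i tphi).
suff : ip Omega (fun x => f x - g x) (cpartial i phi) =
  - ip Omega (fun x => df x - dg x) phi by rewrite !ipE cpartialE.
by rewrite !ipBl// (weak_partial_ip Hf tphi) (weak_partial_ip Hg tphi) opprB opprK addrC.
Qed.

(** The norm in the definition of [H10] involves chosen derivatives of [g - psi n]; by uniqueness
    they agree almost everywhere with the differences of the given derivatives. *)
Lemma H10_approx g (dg : 'I_d -> pt -> R) (e : R) : H10 Omega g ->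
  (forall i, weak_partial Omega i g (dg i)) -> 0 < e ->
  exists2 psi, test_fun Omega psi & forall i,
    L2norm Omega (fun x => dg i x - cpartial i psi x) <= e.
Proof.
move=> [[g2 _] [psi [tpsi Hpsi]]] Hg e0.
have /cvgr0Pnorm_le /(_ e e0)[n _ Hn] := Hpsi.
exists (psi n) => // i; have psi2 := test_fun_L2 mO (tpsi n).
have Hd : weak_partial Omega i (fun x => g x - psi n x)
    (fun x => dg i x - cpartial i (psi n) x).
  by apply: weak_partialB => //; exact: weak_partial_test_fun.
have Hp : weak_partial Omega i (fun x => g x - psi n x)
    (partial Omega i (fun x => g x - psi n x)).
  exact: (xgetPex _ (ex_intro _ _ Hd)).
have -> : L2norm Omega (fun x => dg i x - cpartial i (psi n) x) =
   L2norm Omega (partial Omega i (fun x => g x - psi n x)).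
  have [[md _] _] := Hd; have [[mp _] _] := Hp.
  rewrite /L2norm; congr Num.sqrt; apply: ae_eq_Rintegral => //; try exact: measurable_funX.
  by have := weak_partial_ae_eq Hd Hp; apply: filterS => x H Ox; rewrite H.
have := Hn n (leqnn _); rewrite /= ger0_norm ?sqrtr_ge0//; apply: le_trans.
rewrite -[leLHS]ger0_norm ?L2norm_ge0// -sqrtr_sqr ler_wsqrtr//.
rewrite (bigD1 i)//= addrCA lerDl addr_ge0 ?sqr_ge0// sumr_ge0// => k _.
exact: sqr_ge0.
Qed.

Lemma ip_mixed_partials f g fi fj (dg : 'I_d -> pt -> R) i j : L2 Omega f ->
  weak_partial Omega i f fi -> weak_partial Omega j f fj ->
  H10 Omega g -> (forall i, weak_partial Omega i g (dg i)) ->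
  ip Omega fi (dg j) = ip Omega fj (dg i).
Proof.
move=> f2 Hi Hj g10 Hg; have [fi2 _] := Hi; have [fj2 _] := Hj.
have dg2 k : L2 Omega (dg k) by have [] := Hg k.
apply/eqP; rewrite -subr_eq0 -normr_le0; apply/ler_addgt0Pl => e e0; rewrite addr0.
(* An approximation error of [e / A] in each derivative contributes at most e in total; the summand
   1 keeps A positive. *)
pose A := L2norm Omega fi + L2norm Omega fj + 1.
have A0 : 0 < A by rewrite ltr_wpDl// addr_ge0 ?L2norm_ge0.
have [psi tpsi Hpsi] := H10_approx g10 Hg (divr_gt0 e0 A0).
have dpsi2 k := test_fun_L2 mO (test_fun_partial k tpsi).
have E := ip_mixed_partials_test_fun f2 Hi Hj tpsi.
have E1 := ipBr mO (dg2 j) (dpsi2 j) fi2.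
have E2 := ipBr mO (dg2 i) (dpsi2 i) fj2.
have C1 := L2_CauchySchwarz mO fi2 (L2B mO (dg2 j) (dpsi2 j)).
have C2 := L2_CauchySchwarz mO fj2 (L2B mO (dg2 i) (dpsi2 i)).
have -> : ip Omega fi (dg j) - ip Omega fj (dg i) =
    ip Omega fi (fun x => dg j x - cpartial j psi x) -
    ip Omega fj (fun x => dg i x - cpartial i psi x).
  by rewrite E1 E2 E; ring.
rewrite (le_trans (ler_normB _ _))// (le_trans (lerD C1 C2))//.
apply: (@le_trans _ _ ((L2norm Omega fi + L2norm Omega fj) * (e / A))).
  by rewrite mulrDl lerD// ler_wpM2l ?L2norm_ge0.
by rewrite mulrCA ger_pMr// ler_pdivrMr// mul1r /A lerDl.
Qed.

End weak_derivatives.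

(** * Frobenius product, matrix fields and vector fields *)

Section frobenius_product.
Context {R : realType} {m n : nat}.
Implicit Types A B D : 'M[R]_(m, n).

Lemma frobC A B : frob A B = frob B A.
Proof. by apply: eq_bigr => i _; apply: eq_bigr => j _; rewrite mulrC. Qed.

Lemma frobDl A B D : frob (A + B) D = frob A D + frob B D.
Proof.
rewrite /frob -big_split; apply: eq_bigr => i _ /=.
by rewrite -big_split; apply: eq_bigr => j _ /=; rewrite mxE mulrDl.
Qed.

Lemma frobZl (a : R) A B : frob (a *: A) B = a * frob A B.
Proof.
rewrite /frob mulr_sumr; apply: eq_bigr => i _ /=.
by rewrite mulr_sumr; apply: eq_bigr => j _ /=; rewrite mxE mulrA.
Qed.

Lemma frobBl A B D : frob (A - B) D = frob A D - frob B D.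
Proof. by rewrite -[- B]scaleN1r frobDl frobZl mulN1r. Qed.

Lemma frobDr A B D : frob D (A + B) = frob D A + frob D B.
Proof. by rewrite frobC frobDl !(frobC D). Qed.

Lemma frobZr (a : R) A B : frob A (a *: B) = a * frob A B.
Proof. by rewrite frobC frobZl frobC. Qed.

Lemma frobBr A B D : frob D (A - B) = frob D A - frob D B.
Proof. by rewrite frobC frobBl !(frobC D). Qed.

Lemma frob_ge0 A : 0 <= frob A A.
Proof. by apply: sumr_ge0 => i _; apply: sumr_ge0 => j _; rewrite -expr2 sqr_ge0. Qed.

Lemma enorm_sqr A : enorm A ^+ 2 = frob A A.
Proof. by rewrite /enorm sqr_sqrtr// frob_ge0. Qed.

End frobenius_product.

Lemma frob_tr (R : realType) m n (A B : 'M[R]_(m, n)) : frob A^T B^T = frob A B.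
Proof.
rewrite /frob exchange_big; apply: eq_bigr => i _; apply: eq_bigr => j _.
by rewrite !mxE.
Qed.

HB.lock Definition ipm (R : realType) (d m n : nat) (Omega : set 'rV[R]_d)
    (A B : 'rV[R]_d -> 'M[R]_(m, n)) : R :=
  \int[(lebesgue_rV d : {measure set 'rV[R]_d -> \bar R})]_(x in Omega) frob (A x) (B x).

Section matrix_fields.
Context {R : realType} {d : nat}.
Notation pt := 'rV[R]_d.
Notation leb := (lebesgue_rV d : {measure set pt -> \bar R}).
Variables (Omega : set pt) (mO : measurable Omega).

Definition L2m m n : set (pt -> 'M[R]_(m, n)) :=
  [set A : pt -> 'M[R]_(m, n) | forall i j, L2 Omega (fun x => A x i j)].

Variables m n : nat.
Implicit Types A B D : pt -> 'M[R]_(m, n).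
Notation ipm := (ipm Omega).

Lemma ipmE A B : ipm A B = \int[leb]_(x in Omega) frob (A x) (B x).
Proof. by rewrite unlock. Qed.

Lemma L2mD A B : L2m A -> L2m B -> L2m (fun x => A x + B x).
Proof. by move=> A2 B2 i j; under eq_fun do rewrite mxE; exact: L2D. Qed.

Lemma L2mZ (a : R) A : L2m A -> L2m (fun x => a *: A x).
Proof. by move=> A2 i j; under eq_fun do rewrite mxE; exact: L2Z. Qed.

Lemma L2mB A B : L2m A -> L2m B -> L2m (fun x => A x - B x).
Proof. by move=> A2 B2 i j; under eq_fun do rewrite !mxE; exact: L2B. Qed.

Lemma L2m_integrable A B : L2m A -> L2m B ->
  leb.-integrable Omega (EFin \o (fun x => frob (A x) (B x))).
Proof.
move=> A2 B2; rewrite /frob.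
have -> : EFin \o (fun x => \sum_(i < m) \sum_(j < n) A x i j * B x i j) =
  (fun x => \sum_(i < m) \sum_(j < n) (A x i j * B x i j)%:E)%E.
  by apply/funext => x /=; rewrite -sumEFin; apply: eq_bigr => i _; rewrite -sumEFin.
apply: integrable_sum => // i _; apply: integrable_sum => // j _.
exact: L2_integrable_mul.
Qed.

Lemma ipmC A B : ipm A B = ipm B A.
Proof. by rewrite !ipmE; apply: eq_Rintegral => x _; rewrite frobC. Qed.

Lemma ipmZl (a : R) A D : L2m A -> L2m D -> ipm (fun x => a *: A x) D = a * ipm A D.
Proof.
move=> A2 D2; rewrite !ipmE -RintegralZl//; last exact: L2m_integrable.
by apply: eq_Rintegral => x _; rewrite frobZl.
Qed.

Lemma ipmBl A B D : L2m A -> L2m B -> L2m D ->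
  ipm (fun x => A x - B x) D = ipm A D - ipm B D.
Proof.
move=> A2 B2 D2; rewrite !ipmE -RintegralB//; try exact: L2m_integrable.
by apply: eq_Rintegral => x _; rewrite frobBl.
Qed.

Lemma ipmBr A B D : L2m A -> L2m B -> L2m D ->
  ipm D (fun x => A x - B x) = ipm D A - ipm D B.
Proof. by move=> A2 B2 D2; rewrite ipmC ipmBl// !(ipmC D). Qed.

Lemma ipmZr (a : R) A D : L2m A -> L2m D -> ipm D (fun x => a *: A x) = a * ipm D A.
Proof. by move=> A2 D2; rewrite ipmC ipmZl// ipmC. Qed.

Lemma ipm_ge0 A : 0 <= ipm A A.
Proof. by rewrite ipmE; apply: Rintegral_ge0 => x _; exact: frob_ge0. Qed.

Lemma L2normv_ge0 A : 0 <= L2normv Omega A.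
Proof. exact: L2norm_ge0. Qed.

Lemma L2normv_sqr A : L2normv Omega A ^+ 2 = ipm A A.
Proof.
rewrite /L2normv L2norm_sqr ipE ipmE; apply: eq_Rintegral => x _.
by rewrite -expr2 enorm_sqr.
Qed.

Lemma L2normv_CauchySchwarz A B : L2m A -> L2m B ->
  `|ipm A B| <= L2normv Omega A * L2normv Omega B.
Proof.
move=> A2 B2; rewrite -ler_sqr ?nnegrE ?mulr_ge0 ?L2normv_ge0//.
rewrite real_normK ?num_real// exprMn !L2normv_sqr.
apply: discriminant_le; rewrite ?ipm_ge0// => s.
have sB := L2mZ s B2; have := ipm_ge0 (fun x => A x - s *: B x).
rewrite ipmBl//; last exact: L2mB.
rewrite !ipmBr// !ipmZl// !ipmZr// (ipmC B A).
by move=> /le_trans; apply; rewrite le_eqVlt; apply/orP; left; apply/eqP; ring.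
Qed.

Lemma ipm_sum A B : L2m A -> L2m B -> ipm A B =
  \sum_(i < m) \sum_(j < n) ip Omega (fun x => A x i j) (fun x => B x i j).
Proof.
move=> A2 B2; have AB i j := L2_integrable_mul mO (A2 i j) (B2 i j).
have sumI i : leb.-integrable Omega
    (fun x => \sum_(j < n) (A x i j * B x i j)%:E)%E.
  by apply: integrable_sum => // j _; exact: AB.
rewrite ipmE /Rintegral.
have -> : (\int[leb]_(x in Omega) (frob (A x) (B x))%:E =
    \sum_(i < m) \sum_(j < n) (ip Omega (fun x => A x i j) (fun x => B x i j))%:E)%E.
  transitivity (\int[leb]_(x in Omega)
      (\sum_(i < m) \sum_(j < n) (A x i j * B x i j)%:E))%E.
    by apply: eq_integral => x _; rewrite /frob -sumEFin; apply: eq_bigr => i _; rewrite -sumEFin.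
  rewrite integral_sum//; apply: eq_bigr => i _; rewrite integral_sum//; last by move=> j; exact: AB.
  apply: eq_bigr => j _; rewrite ipE /Rintegral fineK//.
  exact: integrable_fin_num (AB i j).
by under eq_bigr do rewrite sumEFin; rewrite sumEFin.
Qed.

End matrix_fields.

Lemma symmetrized_sum (R : numFieldType) (I : finType) (a : I -> I -> R) :
  \sum_i \sum_k (2^-1 * a i k + 2^-1 * a k i) = \sum_i \sum_k a i k.
Proof.
transitivity (\sum_i \sum_k 2^-1 * a i k + \sum_i \sum_k 2^-1 * a k i).
  by rewrite -big_split; apply: eq_bigr => i _; rewrite -big_split.
rewrite [X in _ + X]exchange_big -big_split; apply: eq_bigr => i _ /=.
by rewrite -big_split; apply: eq_bigr => k _ /=; field.
Qed.

Section vector_fields.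
Context {R : realType} {d : nat}.
Notation pt := 'rV[R]_d.
Variables (Omega : set pt) (oO : open Omega).
Implicit Types (w z : pt -> pt).

Let mO : measurable Omega. Proof. exact: open_measurable_rV. Qed.

Lemma H10v_L2m w : H10v Omega w -> L2m Omega w.
Proof. by move=> w0 i j; rewrite ord1; have [[]] := w0 j. Qed.

Lemma gradE w i j : (fun x => grad Omega w x i j) = partial Omega j (coordf w i).
Proof. by apply/funext => x; rewrite mxE. Qed.

Lemma grad_L2m w : H10v Omega w -> L2m Omega (grad Omega w).
Proof. by move=> w0 i j; rewrite gradE; apply: partial_L2; have [] := w0 i. Qed.

Lemma eps_L2m w : H10v Omega w -> L2m Omega (eps Omega w).
Proof.
move=> w0; apply: L2mZ => //; apply: L2mD => //; first exact: grad_L2m.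
by move=> i j; under eq_fun do rewrite mxE; exact: grad_L2m.
Qed.

Lemma divgE w : divg Omega w = fun x => \sum_(i < d) grad Omega w x i i.
Proof. by []. Qed.

Lemma divg_L2 w : H10v Omega w -> L2 Omega (divg Omega w).
Proof. by move=> w0; rewrite divgE; apply: L2_sum => // i _; exact: grad_L2m. Qed.

(** The square of the divergence norm is the double sum of (d_k w_i, d_i w_k); each term is at most
    the mean of |d_k w_i|^2 and |d_i w_k|^2, and symmetrising the sum gives the square of the
    gradient norm with constant 1. *)
Lemma L2norm_divg w : H10v Omega w ->
  L2norm Omega (divg Omega w) <= L2normv Omega (grad Omega w).
Proof.
move=> w0; have w1 i : H1 Omega (coordf w i) by have [] := w0 i.
have [G HG] : exists G : 'I_d -> 'I_d -> pt -> R,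
    forall i j, G i j = partial Omega j (coordf w i) by exists (fun i j => partial Omega j (coordf w i)).
have GW i j : weak_partial Omega j (coordf w i) (G i j).
  by rewrite HG; exact: partialP.
have G2 i j : L2 Omega (G i j) by have [] := GW i j.
have GE i j : (fun x => grad Omega w x i j) = G i j by rewrite gradE HG.
have G2m := grad_L2m w0.
rewrite -ler_sqr ?nnegrE ?L2norm_ge0 ?L2normv_ge0// L2norm_sqr L2normv_sqr ipm_sum//.
have -> : divg Omega w = fun x => \sum_(i < d) G i i x.
  by rewrite divgE; apply/funext => x; apply: eq_bigr => i _; rewrite -GE.
under [leRHS]eq_bigr do under eq_bigr do rewrite GE.
have dG2 : L2 Omega (fun x => \sum_(i < d) G i i x) by apply: L2_sum.
rewrite ip_suml//.
(* The exchange (d_i w_i, d_k w_k) = (d_k w_i, d_i w_k) uses the zero trace of w_k only; w_i enters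
   as a function with weak derivatives. *)
have E1 i : ip Omega (G i i) (fun x => \sum_(k < d) G k k x) = \sum_(k < d) ip Omega (G i k) (G k i).
  rewrite ipC ip_suml//; apply: eq_bigr => k _; rewrite ipC.
  have [wi2 _] := w1 i.
  exact: (ip_mixed_partials oO wi2 (GW i i) (GW i k) (w0 k) (GW k)).
rewrite (eq_bigr _ (fun i _ => E1 i)).
have E2 i k : ip Omega (G i k) (G k i) <=
    2^-1 * ip Omega (G i k) (G i k) + 2^-1 * ip Omega (G k i) (G k i).
  have := ip_ge0 Omega (fun x => G i k x - G k i x).
  rewrite ipBl//; last exact: L2B.
  by rewrite !ipBr// (ipC Omega (G k i) (G i k)); lra.
apply: (@le_trans _ _ (\sum_i \sum_k (2^-1 * ip Omega (G i k) (G i k) + 2^-1 * ip Omega (G k i) (G k i)))).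
  by apply: ler_sum => i _; apply: ler_sum => k _; exact: E2.
rewrite le_eqVlt (symmetrized_sum (fun i k => ip Omega (G i k) (G i k))) eqxx.
by [].
Qed.

(** Taking the symmetric part does not increase the Frobenius norm: pointwise this is
    [|G - G^T|^2 >= 0]. *)
Lemma L2normv_eps w : H10v Omega w ->
  L2normv Omega (eps Omega w) <= L2normv Omega (grad Omega w).
Proof.
move=> w0; have G2 := grad_L2m w0; have E2 := eps_L2m w0.
rewrite -ler_sqr ?nnegrE ?L2normv_ge0// !L2normv_sqr !ipmE.
apply: le_Rintegral => //; try exact: L2m_integrable.
move=> x _; rewrite /eps; move: (grad Omega w x) => G.
rewrite frobZl frobZr frobDl !frobDr frob_tr (frobC G^T G).
have := frob_ge0 (G - G^T); rewrite frobBl !frobBr frob_tr (frobC G^T G); lra.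
Qed.

End vector_fields.

(** * Duality in space and integration in time *)

Lemma ler_norm_cst1 (R : realType) : `|1 : R| <= 1.
Proof. by rewrite normr1. Qed.

Lemma integrable_fubini_G d1 d2 (T1 : measurableType d1) (T2 : measurableType d2)
    (R : realType) (m1 : {sigma_finite_measure set T1 -> \bar R})
    (m2 : {sigma_finite_measure set T2 -> \bar R}) (f : T1 * T2 -> \bar R) :
  (m1 \x m2)%E.-integrable setT f -> m2.-integrable setT (fubini_G m1 f).
Proof.
move=> fi; have [mf _] := integrableP _ _ _ fi.
have maf : measurable_fun [set: T1 * T2] (abse \o f) by exact: measurableT_comp.
apply/integrableP; split; first exact: measurable_fubini_G fi.
apply: le_lt_trans ((integrable21ltyP m1 m2 mf).1 fi).
apply: ge0_le_integral => //.
- by apply: measurableT_comp => //; exact: measurable_fubini_G fi.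
- apply: (@measurable_fun_fubini_tonelli_G _ _ T1 T2 R m1 (abse \o f)) => //.
  by move=> z; exact: abse_ge0.
- by move=> y _; apply: le_abse_integral => //; exact: measurableT_comp.
Qed.

Section time_dependent_functions.
Context {R : realType} {d : nat}.
Notation pt := 'rV[R]_d.
Notation leb := (lebesgue_rV d).
Notation leb1 := (@lebesgue_measure R).
Variables (T : R) (Omega : set pt) (mO : measurable Omega).
Notation openT := (`]0, T[%classic : set R).
Notation cyl := (openT `*` Omega).
Implicit Types (f g : R -> pt -> R) (q : pt -> R) (c : R -> R).

Let mcyl : measurable (cyl : set (measurableTypeR R * pt)).
Proof. by apply: measurableX => //; exact: measurable_itv. Qed.

Let mI : measurable (openT : set (measurableTypeR R)).
Proof. exact: measurable_itv. Qed.

Lemma restrict_section (h : R -> pt -> R) t x : openT t ->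
  ((fun z : R * pt => h z.1 z.2) \_ cyl) (t, x) = (h t \_ Omega) x.
Proof.
move=> tT; rewrite /patch.
case: ifPn => [|/negP H]; first by rewrite inE => -[_ Ox]; rewrite mem_set.
by case: ifPn => //; rewrite inE => Ox; exfalso; apply: H; rewrite inE.
Qed.

Lemma measurable_L2norm f :
  measurable_fun (cyl : set (measurableTypeR R * pt)) (fun z : R * pt => f z.1 z.2) ->
  measurable_fun (openT : set (measurableTypeR R)) (fun t => L2norm Omega (f t)).
Proof.
move=> mf.
pose H := (fun z : R * pt => f z.1 z.2 ^+ 2) \_ cyl.
have mH : measurable_fun [set: measurableTypeR R * pt] H.
  by apply/(measurable_restrictT _ _).1 => //; exact: measurable_funX.
have mF := @measurable_fun_fubini_tonelli_F _ _ (measurableTypeR R) pt R leb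
   (EFin \o H).
have {}mF : measurable_fun [set: measurableTypeR R] (fubini_F leb (EFin \o H)).
  apply: mF; first exact/measurable_EFinP.
  by move=> z; rewrite /= lee_fin /H /patch; case: ifP => // _; exact: sqr_ge0.
apply: (@eq_measurable_fun _ _ _ _ _ (fun t => Num.sqrt (fine (fubini_F leb (EFin \o H) t)))).
  move=> t; rewrite inE => tT; rewrite /L2norm /Rintegral; congr (Num.sqrt (fine _)).
  rewrite /fubini_F [RHS]integral_mkcond; apply: eq_integral => x _.
  have HE : H (t, x) = ((fun x => f t x ^+ 2) \_ Omega) x.
    exact: (restrict_section (fun s x => f s x ^+ 2)).
  by rewrite [LHS]/= HE /patch; case: ifP.
apply: measurable_funTS; apply: (@measurableT_comp _ _ _ _ _ _ (@Num.sqrt R)).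
  by apply: continuous_measurable_fun; exact: sqrt_continuous.
by apply: (@measurableT_comp _ _ _ _ _ _ (@fine R)) => //; exact: measurable_fine.
Qed.

Lemma integral_absM_le q (g : pt -> R) : L2 Omega q -> L2 Omega g ->
  (\int[leb]_(x in Omega) `|q x * g x|%:E <= (L2norm Omega q * L2norm Omega g)%:E)%E.
Proof.
move=> q2 g2.
have abs2 (k : pt -> R) : L2 Omega k -> L2 Omega (fun x => `|k x|).
  move=> k2; apply: (L2_dominated mO _ k2) => [|x _]; last by rewrite normr_id.
  by apply: measurableT_comp => //; have [] := k2.
have absn (k : pt -> R) : L2norm Omega (fun x => `|k x|) = L2norm Omega k.
  by apply: eq_L2norm => x _; rewrite real_normK// num_real.
have := L2_CauchySchwarz mO (abs2 _ q2) (abs2 _ g2).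
rewrite !absn => /(le_trans (ler_norm _)); rewrite -lee_fin; apply: le_trans.
rewrite ipE /Rintegral fineK.
  by rewrite le_eqVlt; apply/orP; left; apply/eqP; apply: eq_integral => x _; rewrite normrM.
exact: (integrable_fin_num mO (L2_integrable_mul mO (abs2 _ q2) (abs2 _ g2))).
Qed.

(** Extension by zero off the cylinder lets Fubini be applied on the full product space. The factor
    c stands for a test function in time, its derivative, or the indicator of a time step. *)
Definition tensor q f c : R * pt -> R := (fun z => q z.2 * f z.1 z.2 * c z.1) \_ cyl.

Section tensor.
Variables (q : pt -> R) (f : R -> pt -> R) (c : R -> R) (M : R).
Hypotheses (q2 : L2 Omega q) (f2 : Lq_time T Omega 1 (L2 Omega) (L2norm Omega) f).
Hypotheses (mc : measurable_fun (openT : set (measurableTypeR R)) c)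
  (cM : forall t, openT t -> `|c t| <= M).

Let h t x := q x * f t x * c t.
Let H := tensor q f c.

Let mH : measurable_fun [set: measurableTypeR R * pt] H.
Proof.
apply/(measurable_restrictT _ _).1 => //; apply: measurable_funM.
  apply: measurable_funM; last by have [[]] := f2.
  apply: (@measurable_comp _ _ _ _ _ _ Omega q _ snd mO) => //.
  - by move=> _ [z [_ Oz] <-].
  - by have [] := q2.
  - by apply: measurable_funTS; exact: measurable_snd.
apply: (@measurable_comp _ _ _ _ _ _ (openT : set (measurableTypeR R)) c _ fst) => //.
- by move=> _ [z [Oz _] <-].
- by apply: measurable_funTS; exact: measurable_fst.
Qed.

Lemma integrable_L2norm : leb1.-integrable openT (EFin \o (fun t => L2norm Omega (f t))).
Proof.
have [[mf _] foo] := f2; apply/integrableP; split.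
  by apply/measurable_EFinP; exact: measurable_L2norm.
move: foo; apply: le_lt_trans; rewrite le_eqVlt; apply/orP; left; apply/eqP.
by apply: eq_integral => t _ /=; rewrite expr1 ger0_norm// L2norm_ge0.
Qed.

Let M0 t : openT t -> 0 <= M. Proof. by move=> /cM; apply: le_trans. Qed.

Lemma tensor_integrable : (leb1 \x leb)%E.-integrable setT (EFin \o tensor q f c).
Proof.
rewrite -/H.
have mEH : measurable_fun [set: measurableTypeR R * pt] (EFin \o H) by exact/measurable_EFinP.
apply: (integrable12ltyP leb1 leb mEH).2.
have [[mf aef] _] := f2.
have mHa : measurable_fun [set: measurableTypeR R] (fun t => (\int[leb]_x `|(EFin \o H) (t, x)|)%E).
  apply: (@measurable_fun_fubini_tonelli_F _ _ (measurableTypeR R) pt R leb (abse \o (EFin \o H))).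
    by apply: measurableT_comp => //.
  by move=> z; exact: abse_ge0.
(* For T <= 0 the cylinder is empty; otherwise the bound on c at T / 2 shows that M is
   nonnegative. *)
have [T0|T0] := leP T 0.
  rewrite integral0_eq// => t _; rewrite integral0_eq// => x _ /=.
  rewrite /H /tensor /patch ifF ?normr0//; apply/negbTE/negP; rewrite inE => -[] /=.
  by rewrite in_itv/= => /andP[t0 tT]; have := lt_trans t0 tT; rewrite ltNge T0.
have Mge0 : 0 <= M.
  by apply: (@M0 (T / 2)); rewrite /= in_itv/= divr_gt0//= ltr_pdivrMr// ltr_pMr// ltr1n.
have [iN _] := integrableP _ _ _ (integrableZl mI (M * L2norm Omega q) integrable_L2norm).
apply: (@le_lt_trans _ _ (\int[leb1]_(t in openT) (M * L2norm Omega q * L2norm Omega (f t))%:E)%E); last first.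
  have [_] := integrableP _ _ _ (integrableZl mI (M * L2norm Omega q) integrable_L2norm).
  apply: le_lt_trans; rewrite le_eqVlt; apply/orP; left; apply/eqP.
  apply: eq_integral => t _ /=; rewrite ger0_norm//.
  by rewrite !mulr_ge0 ?L2norm_ge0.
rewrite [leRHS]integral_mkcond; apply: ae_ge0_le_integral => //.
- by move=> t _; exact: integral_ge0.
- by move=> t _; rewrite /patch; case: ifP => // _; rewrite lee_fin !mulr_ge0 ?L2norm_ge0.
- by apply/(measurable_restrictT _ _).1 => //; exact: measurable_itv.
apply: (@filterS _ _ (ae_filter_ringOfSetsType leb1) _ _ _ aef) => t + _; rewrite /patch; case: ifPn => [|/negP tT _]; last first.
  rewrite integral0_eq// => x _ /=; rewrite /H /tensor /patch ifF ?normr0//.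
  by apply/negbTE/negP; rewrite inE => -[/= tT' _]; apply: tT; rewrite inE.
rewrite inE => tT /(_ tT) ft2.
apply: (@le_trans _ _ (\int[leb]_(x in Omega) (`|c t|%:E * `|q x * f t x|%:E))%E).
  rewrite [leRHS]integral_mkcond le_eqVlt; apply/orP; left; apply/eqP; apply: eq_integral => x _.
  have HE : H (t, x) = (h t \_ Omega) x by exact: restrict_section.
  rewrite [LHS]/= HE /patch; case: ifP => _; last by rewrite normr0.
  by rewrite /h normrM mulrC -EFinM.
have mqf : measurable_fun Omega (fun x => q x * f t x).
  by apply: measurable_funM; [have [] := q2|have [] := ft2].
rewrite ge0_integralZl//.
  rewrite -mulrA [leRHS]EFinM; apply: lee_pmul => //; first exact: integral_ge0.
    by rewrite lee_fin cM.
  exact: integral_absM_le.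
by apply/measurable_EFinP; apply: measurableT_comp.
Qed.

Lemma tensor_out_time t : ~ openT t -> (\int[leb]_x (tensor q f c (t, x))%:E = 0)%E.
Proof.
move=> tT; rewrite integral0_eq// => x _; rewrite /tensor /patch ifF//.
by apply/negbTE/negP; rewrite inE => -[].
Qed.

Lemma tensor_out_space x : ~ Omega x -> (\int[leb1]_t (tensor q f c (t, x))%:E = 0)%E.
Proof.
move=> tT; rewrite integral0_eq// => t _; rewrite /tensor /patch ifF//.
by apply/negbTE/negP; rewrite inE => -[].
Qed.

Lemma tensor_time_section t : openT t -> L2 Omega (f t) ->
  (\int[leb]_x (tensor q f c (t, x))%:E = (ip Omega q (f t) * c t)%:E)%E.
Proof.
move=> tT ft2; have qf := L2_integrable_mul mO q2 ft2.
transitivity (\int[leb]_(x in Omega) ((q x * f t x)%:E * (c t)%:E))%E.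
  rewrite [RHS]integral_mkcond; apply: eq_integral => x _.
  have -> : tensor q f c (t, x) = (h t \_ Omega) x by exact: restrict_section.
  by rewrite /patch; case: ifP.
rewrite integralZr// ipE EFinM; congr (_ * _)%E.
by rewrite /Rintegral fineK//; exact: integrable_fin_num qf.
Qed.

Lemma tensor_space_section x : Omega x ->
  leb1.-integrable openT (EFin \o (fun t => f t x * c t)) ->
  (\int[leb1]_t (tensor q f c (t, x))%:E =
   (q x * \int[leb1]_(t in openT) (f t x * c t))%:E)%E.
Proof.
move=> Ox fx.
transitivity (\int[leb1]_(t in openT) ((q x)%:E * (f t x * c t)%:E))%E.
  rewrite [RHS]integral_mkcond; apply: eq_integral => t _.
  rewrite /tensor /patch /=; have [tT|tT] := boolP (t \in openT).
    rewrite ifT; first by rewrite -EFinM mulrA.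
    by rewrite inE; split => //; move: tT; rewrite inE.
  by rewrite ifF//; apply/negbTE; move: tT; apply: contraNN; rewrite !inE => -[].
rewrite integralZl// EFinM; congr (_ * _)%E.
by rewrite /Rintegral fineK//; exact: integrable_fin_num fx.
Qed.

End tensor.

Section duality.
Variables (q : pt -> R) (f : R -> pt -> R).
Hypotheses (q2 : L2 Omega q) (f2 : Lq_time T Omega 1 (L2 Omega) (L2norm Omega) f).

Lemma measurable_time_ip :
  measurable_fun (openT : set (measurableTypeR R)) (fun t => ip Omega q (f t)).
Proof.
have H := tensor_integrable q2 f2 (measurable_cst (1 : R)) (fun t _ => ler_norm_cst1 R).
apply: (@eq_measurable_fun _ _ _ _ _ (fun t => fine (fubini_F leb (EFin \o tensor q f (cst 1)) t))).
  move=> t; rewrite inE => tT; rewrite ipE /Rintegral /fubini_F; congr fine.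
  rewrite [RHS]integral_mkcond; apply: eq_integral => x _.
  have E : tensor q f (cst 1) (t, x) = ((fun x => q x * f t x * 1) \_ Omega) x.
    exact: (restrict_section (fun s x => q x * f s x * 1)).
  by rewrite [LHS]/= E /patch; case: ifP; rewrite // mulr1.
apply: measurable_funTS; apply: (@measurableT_comp _ _ _ _ _ _ (@fine R)) => //.
exact: measurable_fubini_F H.
Qed.

Variables (c : R -> R) (M : R).
Hypotheses (mc : measurable_fun (openT : set (measurableTypeR R)) c)
  (cM : forall t, openT t -> `|c t| <= M).

Let H := tensor_integrable q2 f2 mc cM.

Let ae_ip : ae_eq leb1 openT (fubini_F leb (EFin \o tensor q f c))
  (fun t => (ip Omega q (f t) * c t)%:E).
Proof.
have [[_ aef] _] := f2.
apply: (@filterS _ _ (ae_filter_ringOfSetsType leb1) _ _ _ aef) => t + tT => /(_ tT) ft2.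
exact: tensor_time_section.
Qed.

Lemma integrable_time_ip : leb1.-integrable openT (EFin \o (fun t => ip Omega q (f t) * c t)).
Proof.
have mF : measurable_fun (openT : set (measurableTypeR R)) (fun t => ip Omega q (f t) * c t).
  by apply: measurable_funM => //; exact: measurable_time_ip.
have Fi : leb1.-integrable openT (fubini_F leb (EFin \o tensor q f c)).
  exact: (integrableS measurableT mI (@subsetT _ _) (integrable_fubini_F H)).
have [mFi Foo] := integrableP _ _ _ Fi.
have mEF : measurable_fun (openT : set (measurableTypeR R)) (EFin \o (fun t => ip Omega q (f t) * c t)).
  exact/measurable_EFinP.
apply/integrableP; split => //; move: Foo; apply: le_lt_trans.
rewrite le_eqVlt; apply/orP; left; apply/eqP; apply: ae_eq_integral => //.
- exact: measurableT_comp mEF.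
- exact: measurableT_comp mFi.
- by apply: ae_eq_abse; exact: ae_eq_sym ae_ip.
Qed.

Lemma integral_time_ip : (\int[leb1]_t \int[leb]_x (tensor q f c (t, x))%:E =
  (\int[leb1]_(t in openT) (ip Omega q (f t) * c t))%:E)%E.
Proof.
rewrite /Rintegral fineK; last exact: (integrable_fin_num mI integrable_time_ip).
transitivity (\int[leb1]_(t in openT) (fubini_F leb (EFin \o tensor q f c) t))%E.
  rewrite [RHS]integral_mkcond; apply: eq_integral => t _; rewrite /patch.
  by case: ifPn => // /negP tT; rewrite tensor_out_time// => tT'; apply: tT; rewrite inE.
apply: ae_eq_integral => //.
- by apply: measurable_funTS; exact: measurable_fubini_F H.
- by apply/measurable_EFinP; apply: measurable_funM => //; exact: measurable_time_ip.
Qed.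

Hypothesis one2 : L2 Omega (fun=> 1).

Let H1 := tensor_integrable one2 f2 mc cM.

(** With q = 1 the tensor is f c itself. This is where the finite measure of Omega enters:
    integrability on the cylinder passes to almost every fibre in time. *)
Lemma ae_integrable_time :
  {ae leb, forall x, Omega x -> leb1.-integrable openT (EFin \o (fun t => f t x * c t))}.
Proof.
have := ae_integrable2 H1; apply: filterS => x Hx Ox.
have := integrableS measurableT mI (@subsetT _ _) Hx.
apply: eq_integrable => // t; rewrite inE => tT.
have E : tensor (fun=> 1) f c (t, x) = ((fun x => 1 * f t x * c t) \_ Omega) x.
  exact: (restrict_section (fun s x => 1 * f s x * c s)).
by rewrite /= E /patch mem_set// mul1r.
Qed.

Lemma measurable_space_integral :
  measurable_fun Omega (fun x => \int[leb1]_(t in openT) (f t x * c t)).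
Proof.
apply: (@eq_measurable_fun _ _ _ _ _ (fun x => fine (fubini_G leb1 (EFin \o tensor (fun=> 1) f c) x))).
  move=> x; rewrite inE => Ox; rewrite /Rintegral /fubini_G; congr fine.
  rewrite [RHS]integral_mkcond; apply: eq_integral => t _.
  rewrite /tensor /patch /=; have [tT|tT] := boolP (t \in openT).
    rewrite ifT; first by rewrite mul1r.
    by rewrite inE; split => //; move: tT; rewrite inE.
  by rewrite ifF//; apply/negbTE; move: tT; apply: contraNN; rewrite !inE => -[].
apply: measurable_funTS; apply: (@measurableT_comp _ _ _ _ _ _ (@fine R)) => //.
exact: measurable_fubini_G H1.
Qed.

Let ae_space : ae_eq leb Omega (fubini_G leb1 (EFin \o tensor q f c))
  (fun x => (q x * \int[leb1]_(t in openT) (f t x * c t))%:E).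
Proof.
have := ae_integrable_time; apply: filterS => x + Ox => /(_ Ox).
exact: tensor_space_section.
Qed.

Let mqY : measurable_fun Omega (fun x => q x * \int[leb1]_(t in openT) (f t x * c t)).
Proof.
by apply: measurable_funM; [have [] := q2|exact: measurable_space_integral].
Qed.

Lemma integrable_space_ip : leb.-integrable Omega
  (EFin \o (fun x => q x * \int[leb1]_(t in openT) (f t x * c t))).
Proof.
have Gi : leb.-integrable Omega (fubini_G leb1 (EFin \o tensor q f c)).
  exact: (integrableS measurableT mO (@subsetT _ _) (integrable_fubini_G H)).
have [mGi Goo] := integrableP _ _ _ Gi.
have mEY : measurable_fun Omega (EFin \o (fun x => q x * \int[leb1]_(t in openT) (f t x * c t))).
  exact/measurable_EFinP.
apply/integrableP; split => //; move: Goo; apply: le_lt_trans.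
rewrite le_eqVlt; apply/orP; left; apply/eqP; apply: ae_eq_integral => //.
- exact: measurableT_comp mEY.
- exact: measurableT_comp mGi.
- by apply: ae_eq_abse; exact: ae_eq_sym ae_space.
Qed.

(** Fubini, read as an exchange of the pairing with q and the time integral. It converts the weak
    time derivative, an identity for almost every x, into an identity for the scalar function t |->
    (q, f(t)). *)
Lemma ip_time_integral :
  \int[leb1]_(t in openT) (ip Omega q (f t) * c t) =
  ip Omega q (fun x => \int[leb1]_(t in openT) (f t x * c t)).
Proof.
apply: EFin_inj; rewrite -integral_time_ip (Fubini H) ipE.
rewrite /Rintegral fineK; last exact: (integrable_fin_num mO integrable_space_ip).
transitivity (\int[leb]_(x in Omega) (fubini_G leb1 (EFin \o tensor q f c) x))%E.
  rewrite [RHS]integral_mkcond; apply: eq_integral => x _; rewrite /patch.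
  by case: ifPn => // /negP xO; rewrite tensor_out_space// => xO'; apply: xO; rewrite inE.
apply: ae_eq_integral => //.
- by apply: measurable_funTS; exact: measurable_fubini_G H.
- exact/measurable_EFinP.
Qed.

End duality.

End time_dependent_functions.

(** * Smooth steps in time *)

Section smooth_step.
Context {R : realType}.
Notation leb1 := (@lebesgue_measure R).
Variables (a b : R) (ab : a < b).

Let bmp := bumpf (1 : R) a b.

Let cbmp : continuous bmp.
Proof. by apply: smooth1_continuous; exact: bump_smooth. Qed.

Let mbmp : measurable_fun [set: R] bmp.
Proof. exact: continuous_measurable_fun. Qed.

Lemma integral_support (D D' : set R) (f : R -> R) :
  (forall t, f t != 0 -> (t \in D) = (t \in D')) ->
  \int[leb1]_(t in D) f t = \int[leb1]_(t in D') f t.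
Proof.
move=> H; rewrite Rintegral_mkcond [RHS]Rintegral_mkcond; apply: eq_Rintegral => t _.
rewrite /patch; have [->|/H ->] := eqVneq (f t) 0; last by [].
by case: ifP => _; case: ifP.
Qed.

Lemma integrable_bump (D : set (measurableTypeR R)) : measurable D -> leb1.-integrable D (EFin \o bmp).
Proof.
move=> mD; apply: (integrableS measurableT mD (@subsetT _ _)).
have -> : EFin \o bmp = (EFin \o bmp) \_ (`[a, b]%classic : set (measurableTypeR R)).
  apply/funext => t; rewrite /patch; case: ifPn => // /negP tab /=.
  rewrite /bmp bump_out//; apply/negP => /andP[ta tb]; apply: tab.
  by rewrite inE /= in_itv/= (ltW ta) (ltW tb).
have mab : measurable (`[a, b]%classic : set (measurableTypeR R)) by exact: measurable_itv.
rewrite -integrable_mkcond//.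
apply: measurable_bounded_integrable => //.
- apply: (@eq_ind_r _ _ (fun z => (z < +oo)%E) _ _ (@lebesgue_measure_itv R `[a, b])).
  by case: ifP => _; rewrite ?ltry// -EFinB ltry.
- exact: measurable_funTS.
- exists 1; split; first by rewrite num_real.
  move=> y y1 t _ /=; rewrite ger0_norm ?bump_ge0// (le_trans _ (ltW y1))//.
  exact: bump_le1.
Qed.

Let m := \int[leb1]_(t in `]a, b[) bmp t.

Lemma integral_bump_gt0 : 0 < m.
Proof.
rewrite lt_neqAle eq_sym Rintegral_ge0 ?andbT; last by move=> t _; exact: bump_ge0.
apply/negP => /eqP m0.
have mab : measurable (`]a, b[%classic : set (measurableTypeR R)) by exact: measurable_itv.
have bi := integrable_bump mab.
have H0 : (\int[leb1]_(t in `]a, b[) `|(bmp t)%:E| = 0)%E.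
  rewrite -[RHS](congr1 EFin m0) /m /Rintegral fineK ?(integrable_fin_num _ bi)//.
  by apply: eq_integral => t _; rewrite /= ger0_norm// bump_ge0.
have mE : measurable_fun (`]a, b[%classic : set (measurableTypeR R)) (EFin \o bmp).
  by apply/measurable_EFinP; exact: measurable_funTS.
have H := (ae_eq_integral_abs leb1 mab mE).1 H0.
have : leb1 (`]a, b[%classic : set (measurableTypeR R)) = 0%E.
  apply/eqP; rewrite -measure_le0; case: H => N [mN N0 HN].
  rewrite -N0; apply: le_measure; rewrite ?inE//.
  move=> t tab; apply: HN => /= /(_ tab) [] => /eqP; apply/negP; rewrite gt_eqF//; apply: bump_gt0; move: tab; rewrite /= in_itv.
  exact: id.
move=> /(etrans (esym (@lebesgue_measure_itv R `]a, b[))).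
rewrite /= lte_fin ab -EFinB => -[] /eqP.
by rewrite subr_eq0 gt_eqF.
Qed.

(** Its derivative is a smooth probability density on []a, b[], so integrating a function against
    the derivative averages it over this interval. *)
Definition smooth_step (t : R) : R := m^-1 * \int[leb1]_(s in `]-oo, t]) bmp s.

Lemma is_derive_smooth_step t : is_derive (t : R) 1 smooth_step (m^-1 * bmp t).
Proof.
have [] := @continuous_FTC1 R bmp -oo%O t (t + 1) _ (integrable_bump (measurable_itv _)) _ (@cbmp t).
- by rewrite ltrDl.
- by rewrite ltNyr.
rewrite derive1E => dF DF.
have FF : is_derive (t : R) 1 (fun x : R => \int[leb1]_(s in `]-oo, x]) bmp s) (bmp t).
  by apply: DeriveDef.
exact: is_deriveZ.
Qed.

Lemma derive1_smooth_step : derive1 smooth_step = fun t => m^-1 * bmp t.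
Proof.
apply/funext => t; rewrite derive1E; have H := is_derive_smooth_step t.
exact: derive_val.
Qed.

Lemma smooth1_smooth_step : smooth1 smooth_step.
Proof.
move=> [|n] t; first by have H := is_derive_smooth_step t; exact: ex_derive.
rewrite derive1Sn derive1_smooth_step.
have /smooth1P H : smooth1 bmp by exact: bump_smooth.
have /smooth1P : forall n, diffn n (fun t => m^-1 * bmp t).
  by move=> k; exact: diffnZ.
exact.
Qed.

Lemma smooth_step_left t : t <= a -> smooth_step t = 0.
Proof.
move=> ta; rewrite /smooth_step (@integral_support _ set0) ?Rintegral_set0 ?mulr0//.
move=> s bs; rewrite [RHS]in_set0; apply/negbTE/negP; rewrite inE /= in_itv/= => st.
by move/eqP: bs; apply; apply: bump_out; rewrite ltNge (le_trans st ta).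
Qed.

Lemma smooth_step_right t : b <= t -> smooth_step t = 1.
Proof.
move=> bt; rewrite /smooth_step (@integral_support _ `]a, b[) -/m.
  by rewrite mulVf// gt_eqF// integral_bump_gt0.
move=> s bs; have : a < s < b.
  by move: bs; apply: contraNT => ?; rewrite /bmp bump_out.
move=> sab; rewrite !mem_set//= in_itv//=.
by case/andP: sab => _ /ltW/le_trans; exact.
Qed.

Lemma smooth_step_ge0 t : 0 <= smooth_step t.
Proof.
rewrite /smooth_step mulr_ge0// ?invr_ge0 ?(ltW integral_bump_gt0)//.
by apply: Rintegral_ge0 => s _; exact: bump_ge0.
Qed.

Lemma smooth_step_le1 t : smooth_step t <= 1.
Proof.
rewrite -[leRHS](@smooth_step_right (Num.max t b)) ?le_max ?lexx ?orbT//.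
rewrite /smooth_step; apply: ler_wpM2l; first by rewrite invr_ge0 (ltW integral_bump_gt0).
rewrite /Rintegral; apply: fine_le.
- by apply: integrable_fin_num; [|apply: integrable_bump]; exact: measurable_itv.
- by apply: integrable_fin_num; [|apply: integrable_bump]; exact: measurable_itv.
apply: ge0_subset_integral => //; try exact: measurable_itv.
- by apply/measurable_EFinP; exact: measurable_funTS.
- by move=> s _; rewrite lee_fin bump_ge0.
- by move=> s /=; rewrite !in_itv/= le_max => ->.
Qed.

Lemma derive1_smooth_step_ge0 t : 0 <= derive1 smooth_step t.
Proof.
by rewrite derive1_smooth_step mulr_ge0 ?bump_ge0// invr_ge0 (ltW integral_bump_gt0).
Qed.

Lemma derive1_smooth_step_le t : derive1 smooth_step t <= m^-1.
Proof.
rewrite derive1_smooth_step ler_piMr ?bump_le1//.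
by rewrite invr_ge0 (ltW integral_bump_gt0).
Qed.

Lemma derive1_smooth_step_out t : ~~ (a < t < b) -> derive1 smooth_step t = 0.
Proof. by move=> tab; rewrite derive1_smooth_step /bmp bump_out// mulr0. Qed.

Lemma integrable_derive1_smooth_step (D : set (measurableTypeR R)) : measurable D ->
  leb1.-integrable D (EFin \o derive1 smooth_step).
Proof.
move=> mD; rewrite derive1_smooth_step.
by have := integrableZl mD m^-1 (integrable_bump mD).
Qed.

Lemma integral_derive1_smooth_step (D : set (measurableTypeR R)) : measurable D -> `]a, b[ `<=` D ->
  \int[leb1]_(t in D) derive1 smooth_step t = 1.
Proof.
move=> mD abD; rewrite derive1_smooth_step RintegralZl//; last exact: integrable_bump.
rewrite (@integral_support _ `]a, b[) -/m.
  by rewrite mulVf// gt_eqF// integral_bump_gt0.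
move=> s bs; have sab : a < s < b.
  by move: bs; apply: contraNT => ?; rewrite /bmp bump_out.
have sI : (`]a, b[%classic : set R) s by rewrite /= in_itv.
by rewrite (mem_set (abD _ sI)) (mem_set sI).
Qed.

End smooth_step.

(** * Increments of functions with a weak time derivative *)

Lemma ae_le_Rintegral d (T : measurableType d) (R : realType)
    (mu : {measure set T -> \bar R}) (D : set T) (f g : T -> R) : measurable D ->
  (forall x, D x -> 0 <= f x) -> (forall x, D x -> 0 <= g x) ->
  mu.-integrable D (EFin \o f) -> mu.-integrable D (EFin \o g) ->
  {ae mu, forall x, D x -> f x <= g x} ->
  \int[mu]_(x in D) f x <= \int[mu]_(x in D) g x.
Proof.
move=> mD f0 g0 fi gi fg; rewrite /Rintegral; apply: fine_le.
- exact: integrable_fin_num fi.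
- exact: integrable_fin_num gi.
- have [mf _] := integrableP _ _ _ fi; have [mg _] := integrableP _ _ _ gi.
  exact: ae_ge0_le_integral.
Qed.

Lemma norm_sub_le (R : realDomainType) (x y A B : R) :
  0 <= x -> x <= A -> 0 <= y -> y <= B -> `|x - y| <= A + B.
Proof. by move=> x0 xA y0 yB; rewrite ler_norml; apply/andP; split; lra. Qed.

(** [I1] and [I2] stand for averages of (q, f) near the two ends, and [J] for the integral of (q,
    f_t) against the test function. *)
Lemma increment_assembly (R : realDomainType) (I1 I2 J Fa Fb B e : R) :
  I1 - I2 = - J -> `|I1 - Fa| <= e -> `|I2 - Fb| <= e -> `|J| <= B ->
  `|Fb - Fa| <= B + 2 * e.
Proof.
move=> EJ; rewrite !ler_norml => /andP[? ?] /andP[? ?] /andP[? ?].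
by apply/andP; split; lra.
Qed.

Section weak_time_derivative.
Context {R : realType} {d : nat}.
Notation pt := 'rV[R]_d.
Notation leb := (lebesgue_rV d : {measure set pt -> \bar R}).
Notation leb1 := (@lebesgue_measure R).
Variables (T : R) (Omega : set pt) (mO : measurable Omega).
Hypothesis one2 : L2 Omega (fun=> 1).
Notation openT := (`]0, T[%classic : set R).
Notation closedT := (`[0, T]%classic : set R).

Let mI : measurable (openT : set (measurableTypeR R)).
Proof. exact: measurable_itv. Qed.

Lemma test_fun1_bounded (theta : R -> R) : test_fun1 T theta ->
  exists M, forall t, `|theta t| <= M.
Proof.
move=> [sm cK _]; have cth := smooth1_continuous sm.
have [M [_ HM]] := compact_bounded (continuous_compact (continuous_subspaceT cth) cK).
exists (Num.max 0 (M + 1)) => t; have [->|t0] := eqVneq (theta t) 0.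
  by rewrite normr0 le_max lexx.
rewrite le_max; apply/orP; right; apply: (HM (M + 1)); first by rewrite ltrDl.
by exists t => //; exact: subset_closure.
Qed.

Section increments.
Variables (q : pt -> R) (f g : R -> pt -> R).
Hypotheses (q2 : L2 Omega q) (f2 : Lq_time T Omega 1 (L2 Omega) (L2norm Omega) f)
  (fg : weak_dt T Omega f g).

Let g2 : Lq_time T Omega 1 (L2 Omega) (L2norm Omega) g. Proof. by have [] := fg. Qed.

Lemma measurable_test_fun1 theta : test_fun1 T theta ->
  measurable_fun (openT : set (measurableTypeR R)) theta.
Proof.
move=> [sm _ _]; apply: measurable_funTS; apply: continuous_measurable_fun.
exact: smooth1_continuous.
Qed.

(** The defining identity of the weak derivative is multiplied by q and integrated over Omega, and
    Fubini is applied on both sides. *)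
Lemma ip_weak_dt theta (M : R) : test_fun1 T theta ->
  (forall t, `|derive1 theta t| <= M) ->
  \int[leb1]_(t in openT) (ip Omega q (f t) * derive1 theta t) =
  - \int[leb1]_(t in openT) (ip Omega q (g t) * theta t).
Proof.
move=> th HM; have [sm _ _] := th.
have [M' HM'] := test_fun1_bounded th.
have mth := measurable_test_fun1 th.
have mth' : measurable_fun (openT : set (measurableTypeR R)) (derive1 theta).
  apply: measurable_funTS; apply: continuous_measurable_fun.
  by apply: smooth1_continuous; exact: smooth1_derive1.
rewrite (ip_time_integral mO q2 f2 mth' (fun t _ => HM t) one2).
rewrite (ip_time_integral mO q2 g2 mth (fun t _ => HM' t) one2) ipE.
have iG := integrable_space_ip mO q2 g2 mth (fun t _ => HM' t) one2.
have [mq _] := q2.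
have mG := measurable_space_integral mO g2 mth (fun t _ => HM' t) one2.
have mF := measurable_space_integral mO f2 mth' (fun t _ => HM t) one2.
rewrite (@ae_eq_Rintegral _ _ _ mO _ (fun x => (-1) * (q x * \int[leb1]_(t in openT) (g t x * theta t)))).
- by rewrite RintegralZl// mulN1r ipE.
- exact: measurable_funM.
- by apply: measurable_funM => //; exact: measurable_funM.
- by have [_ /(_ _ th)] := fg; apply: filterS => x + Ox => /(_ Ox) ->; rewrite mulN1r mulrN.
Qed.

Hypothesis fc : cont_L2 T Omega f.

Lemma cont_L2_near a e : 0 < e -> closedT a ->
  exists2 del, 0 < del & forall t, closedT t -> `|t - a| < del ->
    `|ip Omega q (f t) - ip Omega q (f a)| <= e.
Proof.
move=> e0 aT; have [fL2 fcv] := fc.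
have qn : 0 < L2norm Omega q + 1 by rewrite ltr_wpDl// L2norm_ge0.
have /cvgrPdist_lt /(_ (e / (L2norm Omega q + 1)) (divr_gt0 e0 qn)) := fcv a aT.
rewrite near_withinE => -[del /= del0 H]; exists del => // t tT td.
have := H t; rewrite /ball/= distrC => /(_ td tT); rewrite sub0r normrN ger0_norm ?L2norm_ge0//.
rewrite ltr_pdivlMr// => Hn.
rewrite -ipBr//; try exact: fL2.
apply: (le_trans (L2_CauchySchwarz mO q2 (L2B mO (fL2 t tT) (fL2 a aT)))).
apply: (le_trans _ (ltW Hn)); rewrite mulrC; apply: ler_wpM2l; first exact: L2norm_ge0.
by rewrite lerDl.
Qed.

Local Notation H a b t := (\1_(`]a, b[%classic : set R) t : R).

Lemma integrable_indic_norm a b :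
  leb1.-integrable openT (EFin \o (fun t => H a b t * L2norm Omega (g t))).
Proof.
have gi := integrable_L2norm mO g2.
apply: (le_integrable mI _ _ gi).
  apply/measurable_EFinP; apply: measurable_funM.
    by apply: measurable_indic; exact: measurable_itv.
  by apply: measurable_L2norm => //; have [[]] := g2.
move=> t _ /=; rewrite lee_fin normrM ler_piMl// indicE.
by case: (_ \in _); rewrite ?normr1 ?normr0.
Qed.

(** The test function [theta] rises from 0 to 1 on [[a + c, a + 2 c]] and falls back on
    [[b - 2 c, b - c]]. Pairing with its derivative gives an average of (q, f) near a minus one near
    b. The margin c keeps the support inside []0, T[] even if a = 0 or b = T, and [a + 4 * c < b]
    separates the two ramps. *)
Lemma ip_increment_near (a b c e : R) :
  0 <= a -> b <= T -> 0 < c -> a + 4 * c < b -> 0 < e ->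
  (forall t, a < t < a + 2 * c -> `|ip Omega q (f t) - ip Omega q (f a)| <= e) ->
  (forall t, b - 2 * c < t < b -> `|ip Omega q (f t) - ip Omega q (f b)| <= e) ->
  `|ip Omega q (f b) - ip Omega q (f a)| <=
    L2norm Omega q * \int[leb1]_(t in openT) (H a b t * L2norm Omega (g t)) + 2 * e.
Proof.
move=> a0 bT c0 abc e0 Ha Hb.
have i1 : a + c < a + 2 * c by rewrite ltrD2l; nra.
have i2 : b - 2 * c < b - c by rewrite ltrD2l ltrN2; nra.
pose S1 := smooth_step (a + c) (a + 2 * c); pose S2 := smooth_step (b - 2 * c) (b - c).
pose theta := fun t => S1 t - S2 t.
have sm1 : smooth1 S1 by exact: smooth1_smooth_step.
have sm2 : smooth1 S2 by exact: smooth1_smooth_step.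
have dth t : derive1 theta t = derive1 S1 t - derive1 S2 t.
  by rewrite !derive1E; apply: (@deriveB R _ _ S1 S2); exact: smooth1_derivable.
have th0 t : ~~ (a + c <= t <= b - c) -> theta t = 0.
  rewrite negb_and -!ltNge => /orP[ta|tb].
    rewrite /theta /S1 /S2 !smooth_step_left ?subrr//; last exact: ltW.
    by apply: ltW; apply: (lt_trans ta); lra.
  rewrite /theta /S1 /S2 !smooth_step_right ?subrr//; first exact: ltW.
  by apply: ltW; apply: le_lt_trans tb; lra.
have th01 t : 0 <= theta t <= H a b t.
  have [tab|tab] := boolP (a + c <= t <= b - c); last first.
    by rewrite th0// lexx indicE ler0n.
  have -> : H a b t = 1.
    by rewrite indicE mem_set//= in_itv/=; move: tab => /andP[]; lra.
  rewrite /theta /S1 /S2; have [t1|t1] := lerP (a + 2 * c) t.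
    by rewrite smooth_step_right// subr_ge0 smooth_step_le1//= lerBlDr lerDl smooth_step_ge0.
  rewrite [X in _ - X]smooth_step_left ?subr0; last by apply: ltW; apply: (lt_trans t1); lra.
  by rewrite smooth_step_ge0//= smooth_step_le1.
have thK : closure [set t | theta t != 0] `<=` (`[a + c, b - c]%classic : set R).
  rewrite closureE => t; apply; split; first exact: itv_closed.
  by move=> s /=; apply: contraNT; rewrite in_itv/= => /th0 ->.
have thT : test_fun1 T theta.
  split.
  - apply/smooth1P => n; have D1 := (smooth1P S1).2 sm1 n.
    have D2 := diffnZ (-1) ((smooth1P S2).2 sm2 n).
    have := diffnD D1 D2.
    by congr (diffn n _); apply/funext => t /=; rewrite mulN1r /theta.
  - apply: (subclosed_compact (@closed_closure _ _) (@segment_compact _ (a + c) (b - c))).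
    exact: thK.
  - move=> t /thK /=; rewrite !in_itv/= => /andP[]; lra.
have [M HM] : exists M, forall t, `|derive1 theta t| <= M.
  exists ((\int[leb1]_(t in `]a + c, a + 2 * c[) bumpf 1 (a + c) (a + 2 * c) t)^-1 +
     (\int[leb1]_(t in `]b - 2 * c, b - c[) bumpf 1 (b - 2 * c) (b - c) t)^-1) => t.
  have D1 := derive1_smooth_step_le i1 t; have D2 := derive1_smooth_step_le i2 t.
  have P1 := derive1_smooth_step_ge0 i1 t; have P2 := derive1_smooth_step_ge0 i2 t.
  by rewrite dth; exact: (norm_sub_le P1 D1 P2 D2).
have HW := ip_weak_dt thT HM.
pose F t := ip Omega q (f t).
have mdS (S : R -> R) : smooth1 S -> measurable_fun (openT : set (measurableTypeR R)) (derive1 S).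
  move=> sS; apply: measurable_funTS; apply: continuous_measurable_fun.
  by apply: smooth1_continuous; exact: smooth1_derive1.
(* Since the derivative of S has integral 1, F z can be brought under the integral; the average then
   differs from F z by no more than F does on the ramp. *)
have step (x y z : R) (S := smooth_step x y) : x < y -> `]x, y[ `<=` openT ->
    (forall t, x < t < y -> `|F t - F z| <= e) ->
    leb1.-integrable openT (EFin \o (fun t => F t * derive1 S t)) /\
    `|\int[leb1]_(t in openT) (F t * derive1 S t) - F z| <= e.
  move=> xy xyT HF.
  have iFS : leb1.-integrable openT (EFin \o (fun t => F t * derive1 S t)).
    have bS t : openT t -> `|derive1 S t| <= (\int[leb1]_(t in `]x, y[) bumpf 1 x y t)^-1.
      move=> _; have P1 := derive1_smooth_step_ge0 xy t; have D1 := derive1_smooth_step_le xy t.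
      by rewrite (ger0_norm P1).
    exact: (integrable_time_ip mO q2 f2 (mdS S (@smooth1_smooth_step R x y)) bS).
  split => //.
  have iS := integrable_derive1_smooth_step x y mI.
  have iz := integrableZl mI (F z) iS.
  have ie := integrableZl mI e iS.
  have -> : \int[leb1]_(t in openT) (F t * derive1 S t) - F z =
      \int[leb1]_(t in openT) ((F t - F z) * derive1 S t).
    rewrite -[X in _ - X]mulr1 -(integral_derive1_smooth_step xy mI xyT) -RintegralZl//.
    rewrite -RintegralB//; apply: eq_Rintegral => t _; by rewrite mulrBl.
  have iB : leb1.-integrable openT (EFin \o (fun t => (F t - F z) * derive1 S t)).
    have := integrableB mI iFS iz; apply: eq_integrable => // t _ /=.
    by rewrite mulrBl.
  apply: (le_trans (le_normr_Rintegral mI iB)).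
  rewrite -[leRHS]mulr1 -(integral_derive1_smooth_step xy mI xyT) -RintegralZl//.
  apply: le_Rintegral => //; first by have := integrable_norm iB.
  move=> t _; rewrite normrM (ger0_norm (derive1_smooth_step_ge0 xy t)).
  have [xty|xty] := boolP (x < t < y); last by rewrite derive1_smooth_step_out// !mulr0.
  by apply: ler_wpM2r; [exact: derive1_smooth_step_ge0|exact: HF].
have [iF1 B1] : leb1.-integrable openT (EFin \o (fun t => F t * derive1 S1 t)) /\
    `|\int[leb1]_(t in openT) (F t * derive1 S1 t) - F a| <= e.
  apply: step => //; first by move=> t /=; rewrite !in_itv/=; lra.
  by move=> t t1; apply: Ha; lra.
have [iF2 B2] : leb1.-integrable openT (EFin \o (fun t => F t * derive1 S2 t)) /\
    `|\int[leb1]_(t in openT) (F t * derive1 S2 t) - F b| <= e.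
  apply: step => //; first by move=> t /=; rewrite !in_itv/=; lra.
  by move=> t t1; apply: Hb; lra.
have EF : \int[leb1]_(t in openT) (ip Omega q (f t) * derive1 theta t) =
    \int[leb1]_(t in openT) (F t * derive1 S1 t) - \int[leb1]_(t in openT) (F t * derive1 S2 t).
  apply: (etrans _ (RintegralB mI iF1 iF2)); apply: eq_Rintegral => t _.
  exact: (etrans (congr1 (fun z => ip Omega q (f t) * z) (dth t)) (mulrBr _ _ _)).
have th1 t : `|theta t| <= 1.
  have /andP[t0 tH] := th01 t; rewrite ger0_norm// (le_trans tH)//.
have iG := integrable_time_ip mO q2 g2 (measurable_test_fun1 thT) (fun t _ => th1 t).
(* As [theta] lies below the indicator of []a, b[], only the part of f_t between a and b is
   charged. *)
have BG : `|\int[leb1]_(t in openT) (ip Omega q (g t) * theta t)| <=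
    L2norm Omega q * \int[leb1]_(t in openT) (H a b t * L2norm Omega (g t)).
  apply: (le_trans (le_normr_Rintegral mI iG)).
  have iH := integrable_indic_norm a b.
  rewrite -RintegralZl//; apply: ae_le_Rintegral => //.
  - by move=> t _; rewrite !mulr_ge0 ?L2norm_ge0// indicE.
  - by have := integrable_norm iG.
  - by have := integrableZl mI (L2norm Omega q) iH.
  - have [[_ aeg] _] := g2.
    apply: (@filterS _ _ (ae_filter_ringOfSetsType leb1) _ _ _ aeg) => t + tT => /(_ tT) gt2.
    have /andP[t0 tH] := th01 t.
    rewrite normrM mulrC (ger0_norm t0) mulrCA; apply: ler_pM => //.
    exact: L2_CauchySchwarz.
exact: (increment_assembly (etrans (esym EF) HW) B1 B2 BG).
Qed.

Theorem ip_increment a b : 0 <= a -> a < b -> b <= T ->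
  `|ip Omega q (f b) - ip Omega q (f a)| <=
    L2norm Omega q * \int[leb1]_(t in openT) (H a b t * L2norm Omega (g t)).
Proof.
move=> a0 ab bT; apply/ler_addgt0Pl => e0 e00; rewrite [leRHS]addrC.
have [e e1 ->] : exists2 e, 0 < e & e0 = 2 * e.
  by exists (e0 / 2); [rewrite divr_gt0|rewrite mulrCA divff ?mulr1].
have aT : closedT a by rewrite /= in_itv/= a0 (le_trans (ltW ab)).
have bT' : closedT b by rewrite /= in_itv/= bT andbT (le_trans a0)// ltW.
have [d1 d10 H1] := cont_L2_near e1 aT; have [d2 d20 H2] := cont_L2_near e1 bT'.
(* Dividing by 8 leaves room for both requirements: 2 c below the two continuity moduli, and 4 c
   below [b - a]. *)
pose c := Num.min (Num.min d1 d2) (b - a) / 8.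
have m0 : 0 < Num.min (Num.min d1 d2) (b - a) by rewrite !lt_min d10 d20 subr_gt0.
have c0 : 0 < c by rewrite divr_gt0.
have c1 : 8 * c <= d1 by rewrite /c mulrC divfK// !ge_min lexx.
have c2 : 8 * c <= d2 by rewrite /c mulrC divfK// !ge_min lexx orbT.
have c3 : 8 * c <= b - a by rewrite /c mulrC divfK// !ge_min lexx !orbT.
apply: (ip_increment_near a0 bT c0 _ e1); first lra.
- move=> t /andP[t1 t2]; apply: H1; first by rewrite /= in_itv/=; apply/andP; split; lra.
  by rewrite ltr_norml; apply/andP; split; lra.
- move=> t /andP[t1 t2]; apply: H2; first by rewrite /= in_itv/=; apply/andP; split; lra.
  by rewrite ltr_norml; apply/andP; split; lra.
Qed.

End increments.
End weak_time_derivative.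

(** * Pairing a step function with W^{1,1}_0 *)

Lemma Rintegral_sum d (T : measurableType d) (R : realType)
    (mu : {measure set T -> \bar R}) (D : set T) n (F : 'I_n -> T -> R) :
  measurable D -> (forall i, mu.-integrable D (EFin \o F i)) ->
  \int[mu]_(x in D) (\sum_(i < n) F i x) = \sum_(i < n) \int[mu]_(x in D) F i x.
Proof.
move=> mD Fi; rewrite /Rintegral sum_fine//; last first.
  by move=> i _; exact: (integrable_fin_num mD (Fi i)).
by rewrite -integral_sum//; congr fine; apply: eq_integral => x _; rewrite sumEFin.
Qed.

(** Arithmetic of one induction step: [Sfa] and [Sf] are the pairings of S_n with f at the two ends
    of the step, [pb] is the pairing of the new pressure with the final value of f, and
    [Sf + tau * pb] is the new nodal term. *)
Lemma pairing_assembly (R : realDomainType) (A A' Sf Sfa pb tau G g M : R) :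
  `|A - Sfa| <= 3 * M * G -> `|A' - tau * pb| <= 2 * M * g -> `|Sf - Sfa| <= M * g ->
  `|A + A' - (Sf + tau * pb)| <= 3 * M * (G + g).
Proof.
rewrite !ler_norml => /andP[? ?] /andP[? ?] /andP[? ?].
by apply/andP; split; lra.
Qed.

Definition pressure_integral (R : realType) d (tau : R) (p : nat -> 'rV[R]_d -> R)
  (n : nat) (x : 'rV[R]_d) : R := \sum_(1 <= i < n.+1) tau * p i x.

Section pairing_bound.
Context {R : realType} {d : nat}.
Notation pt := 'rV[R]_d.
Notation leb := (lebesgue_rV d : {measure set pt -> \bar R}).
Notation leb1 := (@lebesgue_measure R).
Variables (T : R) (Omega : set pt) (mO : measurable Omega).
Hypothesis one2 : L2 Omega (fun=> 1).
Notation openT := (`]0, T[%classic : set R).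
Notation closedT := (`[0, T]%classic : set R).

Let mI : measurable (openT : set (measurableTypeR R)).
Proof. exact: measurable_itv. Qed.

Section W110_functions.
Variable f : R -> pt -> R.
Hypothesis fW : W110 T Omega f.

Lemma W110_Lq : Lq_time T Omega 1 (L2 Omega) (L2norm Omega) f.
Proof.
have [[[mf aef] foo] _ _ _ _] := fW; split => //; split => //.
by apply: (@filterS _ _ (ae_filter_ringOfSetsType leb1) _ _ _ aef) => t + tT => /(_ tT) [].
Qed.

Lemma W110_dt : weak_dt T Omega f (dt T Omega f).
Proof. by have [_ [g fg _] _ _ _] := fW; apply: xgetPex; exists g. Qed.

Lemma W110_cont : cont_L2 T Omega f.
Proof. by have [_ _ fc _ _] := fW. Qed.

Lemma W110_L2 t : closedT t -> L2 Omega (f t).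
Proof. by move=> tT; exact: (W110_cont.1 t tT). Qed.

Lemma W110_ip_end q : 0 <= T -> L2 Omega q -> ip Omega q (f T) = 0.
Proof.
move=> T0 q2; have TT : closedT T by rewrite /= in_itv/= T0 lexx.
have [mf _] := W110_L2 TT; have [mq _] := q2.
rewrite ipE (@ae_eq_Rintegral _ _ _ mO _ (fun=> 0)) ?Rintegral_cst ?mul0r//.
- exact: measurable_funM.
- by have [_ _ _ _] := fW; apply: filterS => x + Ox => /(_ Ox) ->; rewrite mulr0.
Qed.

End W110_functions.

Variables (tau : R) (N : nat) (tau0 : 0 < tau) (TE : T = N%:R * tau).
Variable p : nat -> pt -> R.
Hypothesis p2 : forall i : nat, (i < N)%N -> L2 Omega (p i.+1).

(** Pieces are numbered from 0, so piece i carries the pressure of index i + 1. *)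
Let c (i : nat) (t : R) : R := \1_(`]i%:R * tau, i.+1%:R * tau]%classic : set R) t.
Let ph := step_function tau N p.

Let T0 : 0 <= T. Proof. by rewrite TE mulr_ge0// ltW. Qed.

Let mc i : measurable_fun (openT : set (measurableTypeR R)) (c i).
Proof. by apply: measurable_indic; exact: measurable_itv. Qed.

Let c1 i t : openT t -> `|c i t| <= 1.
Proof. by move=> _; rewrite /c indicE; case: (_ \in _); rewrite ?normr1 ?normr0. Qed.

Lemma step_functionE t x : ph t x = \sum_(i < N) c i t * p i.+1 x.
Proof. by rewrite /ph /step_function big_add1 /= big_mkord. Qed.

Let openclosed t : openT t -> closedT t.
Proof. by rewrite /= !in_itv/= => /andP[/ltW -> /ltW ->]. Qed.

Section single.
Variable f : R -> pt -> R.
Hypothesis fW : W110 T Omega f.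

Lemma ip_step_function t : openT t ->
  \int[leb]_(x in Omega) (ph t x * f t x) =
  \sum_(i < N) ip Omega (p i.+1) (f t) * c i t.
Proof.
move=> tT; have ft2 := W110_L2 fW (openclosed tT).
rewrite -ipE (_ : ph t = fun x => \sum_(i < N) c i t * p i.+1 x); last first.
  by apply/funext => x; exact: step_functionE.
rewrite (ip_suml mO _ _ ft2); last by move=> i; apply: L2Z => //; exact: p2.
by apply: eq_bigr => i _; rewrite ipZl//; [rewrite mulrC|exact: p2].
Qed.

Lemma integrable_piece (i : 'I_N) :
  leb1.-integrable openT (EFin \o (fun t => ip Omega (p i.+1) (f t) * c i t)).
Proof. exact: (integrable_time_ip mO (p2 (ltn_ord i)) (W110_Lq fW) (mc i) (@c1 i)). Qed.

Lemma integrable_pairing :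
  leb1.-integrable openT (EFin \o (fun t => \int[leb]_(x in Omega) (ph t x * f t x))).
Proof.
have := integrable_sum mI (index_enum 'I_N) (fun (i : 'I_N) (_ : true) => integrable_piece i).
apply: eq_integrable => // t; rewrite inE => tT /=.
by rewrite ip_step_function// sumEFin.
Qed.

Lemma pairing_step_function : pairing T Omega ph f =
  \sum_(i < N) \int[leb1]_(t in openT) (ip Omega (p i.+1) (f t) * c i t).
Proof.
rewrite /pairing (@eq_Rintegral _ _ _ leb1 openT
  (fun t => \sum_(i < N) ip Omega (p i.+1) (f t) * c i t)); last first.
  by move=> t; rewrite inE; exact: ip_step_function.
exact: (Rintegral_sum mI integrable_piece).
Qed.

(** The product is a finite sum of tensors, each integrable on the product space, so Tonelli gives
    the absolute integrability that [Wm1inf] requires besides the bound on the pairing. *)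
Lemma absolute_pairing_lty :
  (\int[leb1]_(t in openT) \int[leb]_(x in Omega) (`|ph t x * f t x|)%:E < +oo)%E.
Proof.
pose tn (i : 'I_N) := EFin \o tensor T Omega (p i.+1) f (c i).
have iH : (leb1 \x lebesgue_rV d)%E.-integrable setT (fun z => \sum_(i < N) tn i z)%E.
  apply: (integrable_sum measurableT (index_enum 'I_N)) => i _.
  exact: (tensor_integrable mO (p2 (ltn_ord i)) (W110_Lq fW) (mc i) (@c1 i)).
have [mH _] := integrableP _ _ _ iH.
apply: le_lt_trans ((integrable12ltyP _ _ mH).1 iH).
rewrite le_eqVlt; apply/orP; left; apply/eqP.
rewrite integral_mkcond; apply: eq_integral => t _; rewrite /patch; case: ifPn => tT; last first.
  rewrite integral0_eq// => x _; rewrite big1 ?abse0// => i _.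
  rewrite /tn /= /tensor /patch ifF//; apply/negbTE; move: tT; apply: contraNN.
  by rewrite !inE => -[].
rewrite integral_mkcond; apply: eq_integral => x _; rewrite /patch; case: ifPn => xO; last first.
  rewrite big1 ?abse0// => i _.
  rewrite /tn /= /tensor /patch ifF//; apply/negbTE; move: xO; apply: contraNN.
  by rewrite !inE => -[].
rewrite step_functionE mulr_suml /tn /= sumEFin /=; congr (`|_|%:E).
apply: eq_bigr => i _; rewrite /tensor /patch ifT/=; first by rewrite mulrAC mulrC mulrA mulrAC.
by move: tT xO; rewrite !inE.
Qed.

End single.

Lemma step_function_L2 t : L2 Omega (ph t).
Proof.
rewrite (_ : ph t = fun x => \sum_(i < N) c i t * p i.+1 x); last first.
  by apply/funext => x; exact: step_functionE.
by apply: L2_sum => // i _; apply: L2Z => //; exact: p2.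
Qed.

Lemma linear_pairing : linear_on (W110 T Omega) (pairing T Omega ph).
Proof.
move=> a f g fW gW.
have fi := integrable_pairing fW; have gi := integrable_pairing gW.
have afi := integrableZl mI a fi.
rewrite {2 3}/pairing -RintegralZl// -RintegralD//.
apply: eq_Rintegral => t; rewrite inE => tT.
have ft2 := W110_L2 fW (openclosed tT); have gt2 := W110_L2 gW (openclosed tT).
have pt2 := step_function_L2 t.
have E := ipDr mO (L2Z mO a ft2) gt2 pt2.
by rewrite (ipZr mO a ft2 pt2) !ipE in E; exact: E.
Qed.

Variable M : R.
Hypothesis SM : forall n, (n <= N)%N -> L2norm Omega (pressure_integral tau p n) <= M.

Section bound.
Variable f : R -> pt -> R.
Hypothesis fW : W110 T Omega f.

Let S := pressure_integral tau p.
Let Gn t := L2norm Omega (dt T Omega f t).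
(** Bounds the increment of f across the step, paired with any q of norm at most one. *)
Let gam i := \int[leb1]_(t in openT)
  (\1_(`](i%:R * tau), (i.+1%:R * tau)[%classic : set R) t * Gn t).

Lemma pressure_integral_L2 n : (n <= N)%N -> L2 Omega (S n).
Proof.
move=> nN; rewrite (_ : S n = fun x => \sum_(i < n) tau * p i.+1 x); last first.
  by apply/funext => x; rewrite /S /pressure_integral big_add1 /= big_mkord.
by apply: L2_sum => // i _; apply: L2Z => //; apply: p2; exact: (leq_trans (ltn_ord i)).
Qed.

Lemma pressure_integralS n : S n.+1 = fun x => S n x + tau * p n.+1 x.
Proof. by apply/funext => x; rewrite /S /pressure_integral big_nat_recr. Qed.

Let nodeT n : (n <= N)%N -> closedT (n%:R * tau).
Proof.
move=> nN; rewrite /= in_itv/= mulr_ge0 ?(ltW tau0)//= TE.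
by rewrite ler_pM2r// ler_nat.
Qed.

Let M0 : 0 <= M.
Proof. exact: (le_trans (L2norm_ge0 _ _) (SM (leq0n N))). Qed.

Let gam0 i : 0 <= gam i.
Proof.
by apply: Rintegral_ge0 => t _; rewrite mulr_ge0 ?L2norm_ge0// indicE.
Qed.

Lemma indic_piece i : (i < N)%N ->
  leb1.-integrable openT (EFin \o c i) /\ \int[leb1]_(t in openT) c i t = tau.
Proof.
move=> iN.
have a0 : 0 <= i%:R * tau by rewrite mulr_ge0// ltW.
have ab : i%:R * tau < i.+1%:R * tau by rewrite ltr_pM2r// ltr_nat.
have bT : i.+1%:R * tau <= T by rewrite TE ler_pM2r// ler_nat.
split.
  apply: measurable_bounded_integrable => //.
    apply: (@eq_ind_r _ _ (fun z => (z < +oo)%E) _ _ (@lebesgue_measure_itv R `]0, T[)).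
    by case: ifP => _; rewrite ?ltry// -EFinB ltry.
  exists 1; split; first by rewrite num_real.
  by move=> y y1 t tT /=; rewrite (le_trans (c1 _ tT))// ltW.
have mA : measurable (`](i%:R * tau), (i.+1%:R * tau)]%classic : set (measurableTypeR R)).
  exact: measurable_itv.
have mB : measurable (`](i%:R * tau), (i.+1%:R * tau)[%classic : set (measurableTypeR R)).
  exact: measurable_itv.
have mAI := measurableI _ _ mA mI.
(* The last piece contains T, which is not in []0, T[]. The trace of a piece on []0, T[] therefore
   lies between the open and the half-open interval, both of length [tau]. *)
have len (b1 b2 : bool) : leb1 [set` Interval (BSide b1 (i%:R * tau)) (BSide b2 (i.+1%:R * tau))] = tau%:E.
  apply: (etrans (@lebesgue_measure_itv R _)).
  by rewrite /= lte_fin ab -EFinB -mulrBl -natrB// subSnn mul1r.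
have LA : leb1 (`](i%:R * tau), (i.+1%:R * tau)]%classic `&` openT) = tau%:E.
  apply/eqP; rewrite eq_le; apply/andP; split.
    rewrite -(len false false); apply: le_measure; rewrite ?inE//.
  rewrite -[leLHS](len false true); apply: le_measure; rewrite ?inE//.
  move=> t /=; rewrite !in_itv/= => /andP[t1 t2]; split; first by rewrite t1 ltW.
  by rewrite (le_lt_trans a0 t1) (lt_le_trans t2 bT).
rewrite /c /Rintegral -[RHS]/(fine tau%:E) -LA; congr fine.
exact: (@integral_indic _ _ _ leb1 openT mI _ mA).
Qed.

Lemma piece_estimate i : (i < N)%N ->
  `|\int[leb1]_(t in openT) (ip Omega (p i.+1) (f t) * c i t) -
    tau * ip Omega (p i.+1) (f (i.+1%:R * tau))| <= 2 * M * gam i.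
Proof.
move=> iN; have [ci Ec] := indic_piece iN.
have a0 : 0 <= i%:R * tau by rewrite mulr_ge0// ltW.
have bT : i.+1%:R * tau <= T by rewrite TE ler_pM2r// ler_nat.
set b := i.+1%:R * tau in bT *; pose F t := ip Omega (p i.+1) (f t).
have Fi : leb1.-integrable openT (EFin \o (fun t => F t * c i t)).
  exact: (integrable_piece fW (Ordinal iN)).
have bi := integrableZl mI (F b) ci.
have iD : leb1.-integrable openT (EFin \o (fun t => (F t - F b) * c i t)).
  by have := integrableB mI Fi bi; apply: eq_integrable => // t _ /=; rewrite mulrBl.
have ED : \int[leb1]_(t in openT) (F t * c i t) - tau * F b =
    \int[leb1]_(t in openT) ((F t - F b) * c i t).
  rewrite -Ec mulrC -RintegralZl// -RintegralB//.
  by apply: eq_Rintegral => t _; rewrite mulrBl.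
pose B := L2norm Omega (p i.+1) * gam i.
have Bi := integrableZl mI B ci.
have HB : `|\int[leb1]_(t in openT) ((F t - F b) * c i t)| <= B * tau.
  apply: (le_trans (le_normr_Rintegral mI iD)).
  rewrite -Ec -RintegralZl//; apply: le_Rintegral => //; first by have := integrable_norm iD.
  move=> t tT; rewrite normrM.
  rewrite /c indicE; have [tA|_] := boolP (t \in _); last by rewrite normr0 !mulr0.
  rewrite normr1 !mulr1.
  move: tA tT; rewrite inE /= !in_itv/= => /andP[at' tb] /andP[t0 tT].
  (* The increment estimate needs t strictly below the right end of the step; at that end the
     difference is zero. *)
  move: tb; rewrite le_eqVlt => /orP[/eqP ->|tb].
    by rewrite subrr normr0 mulr_ge0 ?L2norm_ge0.
  rewrite distrC; apply: (le_trans (ip_increment mO one2 (p2 iN) (W110_Lq fW) (W110_dt fW)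
    (W110_cont fW) (ltW t0) tb bT)).
  apply: ler_wpM2l; first exact: L2norm_ge0.
  have g2 : Lq_time T Omega 1 (L2 Omega) (L2norm Omega) (dt T Omega f) by have [] := W110_dt fW.
  apply: le_Rintegral => //; try exact: (integrable_indic_norm mO (W110_dt fW)).
  move=> s _; apply: ler_wpM2r; first exact: L2norm_ge0.
  rewrite !indicE ler_nat; case: (boolP (s \in _)) => //; rewrite inE /= in_itv/= => /andP[ts sb].
  by rewrite mem_set//= in_itv/= (lt_trans at' ts).
have Hp : tau * L2norm Omega (p i.+1) <= 2 * M.
  rewrite -(ger0_norm (ltW tau0)) -L2normZ//; last exact: p2.
  have S1 := pressure_integral_L2 iN; have S0 := pressure_integral_L2 (ltnW iN).
  rewrite (_ : (fun x => _) = fun x => S i.+1 x + (-1) * S i x); last first.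
    by apply/funext => x; rewrite pressure_integralS mulN1r addrAC subrr add0r.
  apply: (le_trans (L2normD mO S1 (L2Z mO (-1) S0))).
  rewrite L2normZ// normrN1 mul1r.
  have := SM iN; have := SM (ltnW iN); rewrite -/S; lra.
rewrite ED (le_trans HB)// /B mulrC mulrA.
exact: ler_wpM2r.
Qed.

Lemma sum_gam : \sum_(i < N) gam i <= \int[leb1]_(t in openT) Gn t.
Proof.
have g2 : Lq_time T Omega 1 (L2 Omega) (L2norm Omega) (dt T Omega f) by have [] := W110_dt fW.
have gi := integrable_L2norm mO g2.
have Hi (i : 'I_N) : leb1.-integrable openT (EFin \o (fun t =>
    \1_(`](i%:R * tau), (i.+1%:R * tau)[%classic : set R) t * Gn t)).
  exact: (integrable_indic_norm mO (W110_dt fW)).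
rewrite /gam -(Rintegral_sum mI Hi); apply: le_Rintegral => //.
  have := integrable_sum mI (index_enum 'I_N) (fun (i : 'I_N) (_ : true) => Hi i).
  by apply: eq_integrable => // t _ /=; rewrite sumEFin.
move=> t _; rewrite -mulr_suml ler_piMl ?L2norm_ge0//.
(* Strengthened for the induction: the first n indicators add up to at most the indicator of t < n
   [tau], which expresses that the open steps are disjoint. *)
suff H n : \sum_(i < n) \1_(`](i%:R * tau), (i.+1%:R * tau)[%classic : set R) t <=
    (((t : R) < n%:R * tau)%R : nat)%:R :> R.
  by apply: (le_trans (H N)); case: (_ < _)%R; rewrite ?lexx ?ler01.
elim: n => [|n IH]; first by rewrite big_ord0 ler0n.
rewrite big_ord_recr/=; apply: (le_trans (lerD IH (lexx _))).
rewrite indicE -natrD ler_nat.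
have nn : n%:R * tau < n.+1%:R * tau by rewrite ltr_pM2r// ltr_nat.
have [tn|tn] := ltP t (n%:R * tau).
  rewrite (lt_trans tn nn) (_ : (t \in _) = false)//.
  by apply/negbTE/negP; rewrite inE /= in_itv/= => /andP[]; rewrite ltNge ltW.
rewrite add0n; case: (boolP (t \in _)) => //; rewrite inE /= in_itv/= => /andP[_ ->].
by [].
Qed.

(** Summation by parts as an invariant: the partial pairing is compared with the single nodal term
    (S_n, f(t_n)). This term is zero at n = 0 because S_0 is an empty sum, and at n = N because f(T)
    = 0. *)
Lemma pairing_partial n : (n <= N)%N ->
  `|\sum_(i < n) \int[leb1]_(t in openT) (ip Omega (p i.+1) (f t) * c i t) -
    ip Omega (S n) (f (n%:R * tau))| <= 3 * M * \sum_(i < n) gam i.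
Proof.
elim: n => [_|n IH nN].
  have f0 := W110_L2 fW (nodeT (leq0n N)).
  (* The empty sum is written [0 * 0] so that homogeneity of the pairing evaluates it. *)
  rewrite !big_ord0 mulr0 sub0r normrN (_ : S 0 = fun=> 0 * 0); last first.
    by apply/funext => x; rewrite /S /pressure_integral big_geq// mulr0.
  by rewrite (ipZl mO 0 (L2_cst0 mO) f0) mul0r normr0.
rewrite !big_ord_recr /=.
have fa := W110_L2 fW (nodeT (ltnW nN)); have fb := W110_L2 fW (nodeT nN).
have S2 := pressure_integral_L2 (ltnW nN).
have EN := piece_estimate nN.
rewrite pressure_integralS ipDl//; [|exact: L2Z (p2 nN)].
rewrite ipZl//; last exact: p2.
have ab : n%:R * tau < n.+1%:R * tau by rewrite ltr_pM2r// ltr_nat.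
have a0 : 0 <= n%:R * tau by rewrite mulr_ge0// ltW.
have bT : n.+1%:R * tau <= T by rewrite TE ler_pM2r// ler_nat.
have HI := ip_increment mO one2 S2 (W110_Lq fW) (W110_dt fW) (W110_cont fW) a0 ab bT.
have {}HI := le_trans HI (ler_wpM2r (gam0 n) (SM (ltnW nN))).
exact: (pairing_assembly (IH (ltnW nN)) EN HI).
Qed.

Lemma pairing_le : `|pairing T Omega ph f| <= 3 * M * W11norm T Omega f.
Proof.
have := pairing_partial (leqnn N).
rewrite -TE (W110_ip_end fW T0 (pressure_integral_L2 (leqnn N))) subr0.
rewrite -pairing_step_function// => /le_trans; apply.
apply: ler_wpM2l; first exact: mulr_ge0.
apply: (le_trans sum_gam); rewrite /W11norm lerDr.
by apply: Rintegral_ge0 => t _; exact: L2norm_ge0.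
Qed.

End bound.

Theorem Wm1norm_step_function : (Wm1norm T Omega ph <= (3 * M)%:E)%E.
Proof.
apply: ge_ereal_sup => _ [f [fW f1] <-]; rewrite lee_fin.
apply: (le_trans (pairing_le fW)); rewrite ler_piMr//.
by rewrite mulr_ge0// (le_trans (L2norm_ge0 _ _) (SM (leq0n N))).
Qed.

Theorem Wm1inf_step_function : Wm1inf T Omega ph.
Proof.
split; [exact: absolute_pairing_lty|exact: linear_pairing|].
by apply: (le_lt_trans Wm1norm_step_function); rewrite ltry.
Qed.

End pairing_bound.

(** * Energy estimates *)

Ltac positivity := repeat first
  [ assumption | exact: ltr01 | exact: ltr0Sn | exact: sqr_ge0
  | apply: ltW; assumption | apply: mulr_gt0 | apply: mulr_ge0
  | rewrite invr_gt0 | rewrite invr_ge0 | apply: exprn_gt0 | exact: ler0n ].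

Section energy_algebra.
Context {R : realType}.

Lemma young (e x y : R) : 0 < e -> x * y <= e / 2 * x ^+ 2 + (2 * e)^-1 * y ^+ 2.
Proof.
move=> e0; have e0' : e != 0 by rewrite gt_eqF.
rewrite -subr_ge0.
have -> : e / 2 * x ^+ 2 + (2 * e)^-1 * y ^+ 2 - x * y = (e * x - y) ^+ 2 / (2 * e) by field.
by rewrite divr_ge0 ?sqr_ge0// mulr_ge0// ltW.
Qed.

Lemma sqr_sum3 (x y z : R) : (x + y + z) ^+ 2 <= 3 * (x ^+ 2 + y ^+ 2 + z ^+ 2).
Proof.
by have := sqr_ge0 (x - y); have := sqr_ge0 (y - z); have := sqr_ge0 (x - z); nra.
Qed.

(* Weighted Cauchy-Schwarz; this is where the factor 1 + D1/2 comes from *)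
Lemma sqr_sum_weighted (a q b c : R) : 0 < c ->
  (a + b * q) ^+ 2 <= (1 + b ^+ 2 / c) * (a ^+ 2 + c * q ^+ 2).
Proof.
move=> c0; have c0' : c != 0 by rewrite gt_eqF.
rewrite -subr_ge0.
have -> : (1 + b ^+ 2 / c) * (a ^+ 2 + c * q ^+ 2) - (a + b * q) ^+ 2 =
  (c * q - b * a) ^+ 2 / c by field.
by rewrite divr_ge0 ?sqr_ge0// ltW.
Qed.

(** [E] and [D] are the norms of the strain and of the divergence of the test function; both are at
    most its gradient norm [G], so the stress is a functional bounded in the gradient norm. *)
Lemma stress_assembly (e1 g2 e2 g6 g8 a q I1 I2 E D G : R) :
  0 <= e1 -> 0 <= g2 -> 0 <= e2 -> 0 <= g6 -> 0 <= g8 -> 0 <= a -> 0 <= q ->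
  I1 <= g2 * (a * E) -> I2 <= g8 * g2 * g6 * (q * D) -> E <= G -> D <= G ->
  e1 * I1 + e2 * e1 * I2 <= g2 * e1 * (a + e2 * g6 * g8 * q) * G.
Proof.
move=> e10 g20 e20 g60 g80 a0 q0 HI1 HI2 EG DG.
have -> : g2 * e1 * (a + e2 * g6 * g8 * q) * G =
  e1 * (g2 * (a * G)) + e2 * e1 * (g8 * g2 * g6 * (q * G)) by ring.
apply: lerD; apply: ler_wpM2l; positivity.
- by apply: (le_trans HI1); apply: ler_wpM2l => //; apply: ler_wpM2l.
- by apply: (le_trans HI2); apply: ler_wpM2l; [positivity|apply: ler_wpM2l].
Qed.

Lemma le_drop_ge0 (c x y z b : R) : 0 <= c -> 0 <= y -> 0 <= z ->
  c * (x + y) + z <= b -> c * x <= b.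
Proof.
by move=> c0 y0 z0; apply: le_trans; rewrite mulrDr -addrA lerDl addr_ge0// mulr_ge0.
Qed.

Lemma mul_chain (x y g a P K : R) : 0 <= x -> 0 <= P ->
  y <= P * g -> g <= K * a -> x * y <= x * (P * (K * a)).
Proof.
move=> x0 P0 yg ga; apply: ler_wpM2l => //; apply: (le_trans yg).
exact: ler_wpM2l.
Qed.

(** With z the interpolant of v, the coupling is (al / tau) (du, v - z) + al (v, z) - S, the last
    two terms coming from the displacement equation. The first is paid by the approximation property
    and produces the factor [h / tau]; the others by Poincaré and by the stability of the
    interpolation. All carry a factor [gv], to be absorbed by viscosity. *)
Lemma velocity_assembly (al tau C h P uv uz vz S W du vn gv nvz nz gz : R) :
  0 < al -> 0 < tau -> 0 < P -> 0 <= W -> 0 <= du -> 0 <= vn ->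
  `|uv - uz| <= du * nvz -> nvz <= C * h * gv ->
  `|vz| <= vn * nz -> nz <= P * gz -> gz <= C * gv -> `|S| <= W * gz ->
  al / tau * uz + S = al * vz ->
  al / tau * uv <= gv * (C * (al * h / tau * du + al * P * vn + W)).
Proof.
move=> al0 tau0 P0 W0 du0 vn0 H1 H2 H3 H4 H5 H6 HE.
have -> : al / tau * uv = al / tau * (uv - uz) + (al * vz - S) by rewrite -HE; ring.
have T1 : al / tau * (uv - uz) <= al / tau * (du * (C * h * gv)).
  apply: ler_wpM2l; first by apply: ltW; positivity.
  by apply: (le_trans (ler_norm _)); apply: (le_trans H1); apply: ler_wpM2l.
have T2 : al * vz <= al * (vn * (P * (C * gv))).
  apply: ler_wpM2l; first exact: ltW.
  apply: (le_trans (ler_norm _)); apply: (le_trans H3); apply: mul_chain H4 H5 => //.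
  exact: ltW.
have T3 : - S <= W * (C * gv).
  rewrite -normrN in H6; apply: (le_trans (ler_norm _)); apply: (le_trans H6).
  exact: ler_wpM2l.
have -> : gv * (C * (al * h / tau * du + al * P * vn + W)) =
  al / tau * (du * (C * h * gv)) + (al * (vn * (P * (C * gv))) + W * (C * gv)) by ring.
by apply: lerD => //; apply: lerD.
Qed.

Variables (m : material R) (d : nat) (l1 l2 delta h tau P K C : R).
Hypotheses (halpha : 0 < alpha m) (hnu : 0 < nu m) (hrho : 0 < rho m)
  (hE1 : 0 < E1 m) (hE2 : E2 m < 0) (htau : 0 < tau) (hh : 0 < h)
  (hP : 0 < P) (hK : 0 < K) (hC : 0 < C)
  (g1 : 0 < gamma1 l1 delta) (g2 : 0 < gamma2 l1 delta)
  (g5 : 0 < gamma5 d m l1 l2 delta) (g6 : 0 < gamma6 d m l1 l2 delta)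
  (g7 : 0 < gamma7 l2 delta) (g8 : 0 < gamma8 l2 delta).

Let E2n : 0 < `|E2 m|. Proof. by rewrite normr_gt0 lt_eqF. Qed.

Let D1_ge0 : 0 <= calD1 d m l1 l2 delta.
Proof. by rewrite /calD1 mulr_ge0// divr_ge0 ?sqr_ge0// mulr_ge0// ltW. Qed.

Let D2_gt0 : 0 < calD2 d m l1 l2 delta.
Proof. by rewrite /calD2 ltr_wpDr// divr_ge0. Qed.

Lemma calD3_gt0 : 0 < calD3 d m l1 l2 delta h tau.
Proof.
rewrite /calD3 ltr_wpDl//; first by rewrite divr_ge0 ?sqr_ge0// ltW.
positivity.
Qed.

Lemma calD4_gt0 : 0 < calD4 d m l1 l2 delta h tau P K.
Proof.
rewrite /calD4 mulr_gt0//; first by rewrite exprn_gt0// mulr_gt0.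
rewrite ltr_wpDr// mulr_ge0//; last exact/ltW/calD3_gt0.
by rewrite divr_ge0// ?mulr_ge0// ?sqr_ge0// ltW.
Qed.

(** [a] and [q] are the strain and divergence norms of the displacement. Young's inequality with
    weight [gamma1 / E1] spends half of the lower bound on the strain term to absorb the coupling;
    the other half and the whole divergence term survive. *)
Lemma displacement_energy (un2 up2 du2 a q vn uu vu S : R) :
  0 <= a -> 0 <= vn ->
  uu = (un2 - up2 + du2) / 2 ->
  vu <= vn * (P * (K * a)) ->
  (E1 m)^-1 * (gamma1 l1 delta * a ^+ 2) +
    `|E2 m| / E1 m * (gamma7 l2 delta * gamma1 l1 delta * gamma5 d m l1 l2 delta * q ^+ 2) <= S ->
  alpha m / tau * uu + S = alpha m * vu ->
  alpha m / tau * (un2 - up2 + du2) + gamma1 l1 delta / E1 m *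
    (a ^+ 2 + 2 * `|E2 m| * gamma5 d m l1 l2 delta * gamma7 l2 delta * q ^+ 2) <=
  E1 m * (alpha m * P * K) ^+ 2 / gamma1 l1 delta * vn ^+ 2.
Proof.
move=> a0 vn0 -> Hvu HS HE.
have Y := @young (gamma1 l1 delta / E1 m) a (alpha m * P * K * vn) (divr_gt0 g1 hE1).
have Hvu' := ler_wpM2l (ltW halpha) Hvu.
move: g1 g5 g7 E2n Y HS.
move: (gamma1 _ _) (gamma5 _ _ _ _ _) (gamma7 _ _) `|E2 m| => G1 G5 G7 e2 G10 G50 G70 e20 Y HS.
have hE1' : E1 m != 0 by rewrite gt_eqF.
have G1' : G1 != 0 by rewrite gt_eqF.
have htau' : tau != 0 by rewrite gt_eqF.
have EQ : alpha m / tau * (un2 - up2 + du2) = 2 * (alpha m * vu - S).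
  by rewrite -HE; field.
rewrite EQ.
have -> : G1 / E1 m * (a ^+ 2 + 2 * e2 * G5 * G7 * q ^+ 2) =
  2 * ((E1 m)^-1 * (G1 * a ^+ 2) + e2 / E1 m * (G7 * G1 * G5 * q ^+ 2)) - G1 / E1 m * a ^+ 2.
  by field.
have EY : 2 * ((2 * (G1 / E1 m))^-1 * (alpha m * P * K * vn) ^+ 2) =
  E1 m * (alpha m * P * K) ^+ 2 / G1 * vn ^+ 2 by field; rewrite hE1' G1'.
have EY' : 2 * (G1 / E1 m / 2 * a ^+ 2) = G1 / E1 m * a ^+ 2 by field.
have E3 : alpha m * (vn * (P * (K * a))) = a * (alpha m * P * K * vn) by ring.
by rewrite -EY -EY'; rewrite E3 in Hvu'; lra.
Qed.

(** Half of the viscous term absorbs [gv], leaving the square of a sum of three terms, whence the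
    factor 3 in k. The squares of the increment term and of the stress term are charged to the
    dissipation of the displacement inequality, whose remaining part is a difference of displacement
    norms: this is why the energy contains [k * D3 * un2]. *)
Lemma velocity_energy (k un2 up2 du a q vn vp2 dv2 gv vv uv : R) :
  k = 3 * C ^+ 2 / (nu m * rho m) ->
  0 <= a -> 0 <= vn -> 0 <= gv -> 0 <= du -> 0 <= q -> 0 <= dv2 ->
  vv = (vn ^+ 2 - vp2 + dv2) / 2 ->
  rho m / tau * vv + nu m * gv ^+ 2 + alpha m * vn ^+ 2 = uv ->
  uv <= gv * (C * (alpha m * h / tau * du + alpha m * P * vn +
     gamma2 l1 delta / E1 m * (a + `|E2 m| * gamma6 d m l1 l2 delta * gamma8 l2 delta * q))) ->
  alpha m / tau * (un2 - up2 + du ^+ 2) + gamma1 l1 delta / E1 m *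
    (a ^+ 2 + 2 * `|E2 m| * gamma5 d m l1 l2 delta * gamma7 l2 delta * q ^+ 2) <=
  E1 m * (alpha m * P * K) ^+ 2 / gamma1 l1 delta * vn ^+ 2 ->
  (vn ^+ 2 + k * calD3 d m l1 l2 delta h tau * un2) +
    tau * (nu m / rho m * gv ^+ 2 + 2 * alpha m / rho m * vn ^+ 2) <=
  (vp2 + k * calD3 d m l1 l2 delta h tau * up2) +
    k * calD4 d m l1 l2 delta h tau P K * tau * vn ^+ 2.
Proof.
move=> kE a0 vn0 gv0 du0 q0 dv20 -> HE Huv HA.
set X1 := alpha m * h / tau * du in Huv.
set X2 := alpha m * P * vn in Huv.
set X3 := gamma2 _ _ / E1 m * _ in Huv.
have Y := @young (nu m) gv (C * (X1 + X2 + X3)) hnu.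
have S3 := sqr_sum3 X1 X2 X3.
have D3p := calD3_gt0.
set D3 := calD3 _ _ _ _ _ _ _ in D3p *.
set Z := (a ^+ 2 + 2 * _ * _ * _ * q ^+ 2) in HA.
have Z0 : 0 <= Z.
  by rewrite addr_ge0 ?sqr_ge0// mulr_ge0 ?sqr_ge0// !mulr_ge0// ltW.
have c0 : 0 < 2 * `|E2 m| * gamma5 d m l1 l2 delta * gamma7 l2 delta by rewrite !mulr_gt0.
have X3Z : X3 ^+ 2 <= (gamma2 l1 delta / E1 m) ^+ 2 * (calD2 d m l1 l2 delta * Z).
  rewrite exprMn ler_wpM2l ?sqr_ge0//.
  (* With b = |E2| gamma6 gamma8 and c = 2 |E2| gamma5 gamma7, the ratio b^2 / c is D1 / 2. *)
  have := @sqr_sum_weighted a q (`|E2 m| * gamma6 d m l1 l2 delta * gamma8 l2 delta) _ c0.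
  move=> /le_trans; apply; rewrite le_eqVlt; apply/orP; left; apply/eqP; congr (_ * _).
  rewrite /calD2 /calD1; field.
  by rewrite !gt_eqF.
(* The two summands of D3 are matched to the two squares: [(alpha h)^2 / tau] times the increment
   part of the dissipation is [X1 ^+ 2], and the other summand times the elastic part bounds
   [X3 ^+ 2]. The cross terms are nonnegative. *)
have X13 : X1 ^+ 2 + X3 ^+ 2 <= D3 / alpha m *
    (alpha m / tau * du ^+ 2 + gamma1 l1 delta / E1 m * Z).
  have EE : D3 / alpha m * (alpha m / tau * du ^+ 2 + gamma1 l1 delta / E1 m * Z) =
    X1 ^+ 2 + (gamma2 l1 delta / E1 m) ^+ 2 * (calD2 d m l1 l2 delta * Z) +
    (h ^+ 2 * alpha m / tau * (gamma1 l1 delta / E1 m * Z) +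
    (E1 m)^-1 * (gamma2 l1 delta ^+ 2 / gamma1 l1 delta) * calD2 d m l1 l2 delta * (alpha m / tau * du ^+ 2)).
    rewrite /D3 /calD3 /X1; field.
    by rewrite !gt_eqF.
  rewrite EE -addrA lerD2l (le_trans X3Z)// lerDl addr_ge0//.
    positivity.
  positivity.
(* The displacement inequality, scaled by [D3 / alpha], is inserted; its right-hand side together
   with [X2 ^+ 2] adds up to exactly D4 |v^n|^2. *)
have XX : X1 ^+ 2 + X2 ^+ 2 + X3 ^+ 2 <=
    calD4 d m l1 l2 delta h tau P K * vn ^+ 2 - D3 / tau * (un2 - up2).
  have := ler_wpM2l (ltW (divr_gt0 D3p halpha)) HA.
  have -> : D3 / alpha m * (alpha m / tau * (un2 - up2 + du ^+ 2) + gamma1 l1 delta / E1 m * Z) =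
    D3 / tau * (un2 - up2) + D3 / alpha m * (alpha m / tau * du ^+ 2 + gamma1 l1 delta / E1 m * Z).
    by field; rewrite !gt_eqF.
  have -> : calD4 d m l1 l2 delta h tau P K * vn ^+ 2 = X2 ^+ 2 +
    D3 / alpha m * (E1 m * (alpha m * P * K) ^+ 2 / gamma1 l1 delta * vn ^+ 2).
    by rewrite /calD4 -/D3 /X2; field; rewrite !gt_eqF.
  lra.
have H1 : rho m / tau * ((vn ^+ 2 - vp2 + dv2) / 2) + nu m / 2 * gv ^+ 2 + alpha m * vn ^+ 2 <=
  3 * C ^+ 2 / (2 * nu m) * (calD4 d m l1 l2 delta h tau P K * vn ^+ 2 - D3 / tau * (un2 - up2)).
  have H2 : (2 * nu m)^-1 * (C * (X1 + X2 + X3)) ^+ 2 <= 3 * C ^+ 2 / (2 * nu m) *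
      (calD4 d m l1 l2 delta h tau P K * vn ^+ 2 - D3 / tau * (un2 - up2)).
    rewrite exprMn mulrA (_ : 3 * C ^+ 2 / (2 * nu m) = (2 * nu m)^-1 * C ^+ 2 * 3); last by ring.
    rewrite -[leRHS]mulrA ler_wpM2l//; first by positivity.
    by rewrite (le_trans S3)// ler_wpM2l.
  lra.
(* Scaling by [2 * tau / rho] gives |v^n|^2 the coefficient 1 and turns [3 C^2 / (2 nu)] into
   [k * tau]. *)
have H2 := ler_wpM2l (ltW (divr_gt0 (mulr_gt0 (ltr0Sn R 1) htau) hrho)) H1.
move: H2; rewrite kE; move: (calD4 _ _ _ _ _ _ _ _ _) => D4.
have -> : 2 * tau / rho m * (rho m / tau * ((vn ^+ 2 - vp2 + dv2) / 2) + nu m / 2 * gv ^+ 2 + alpha m * vn ^+ 2) =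
  vn ^+ 2 - vp2 + dv2 + tau * (nu m / rho m * gv ^+ 2 + 2 * alpha m / rho m * vn ^+ 2).
  by field; rewrite !gt_eqF.
have -> : 2 * tau / rho m * (3 * C ^+ 2 / (2 * nu m) * (D4 * vn ^+ 2 - D3 / tau * (un2 - up2))) =
  3 * C ^+ 2 / (nu m * rho m) * D4 * tau * vn ^+ 2 - 3 * C ^+ 2 / (nu m * rho m) * D3 * un2 +
  3 * C ^+ 2 / (nu m * rho m) * D3 * up2.
  by field; rewrite !gt_eqF.
lra.
Qed.

End energy_algebra.

(** * Weights of the stress *)

Section truncated_coefficients.
Context {R : realType}.
Variables (m : material R) (d : nat) (l1 l2 delta : R).
Hypotheses (hE1 : 0 < E1 m) (hE2 : E2 m < 0) (hdelta : 0 < delta)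
  (hs1 : 0 < 1 - `|l1| * delta)
  (hs2 : 0 < gamma3 d m - `|gamma4 d m l1 l2| * delta)
  (hs3 : 0 < 1 - `|l2| * delta).

Let Ndelta : - delta <= delta. Proof. by rewrite ltW// gtrN. Qed.

(** The clamped form yields the bound by [delta] and the continuity of the truncation, hence
    measurability of the coefficients. *)
Lemma truncE (t : R) : trunc delta t = Num.max (- delta) (Num.min t delta).
Proof.
rewrite /trunc ler_norml; have [t1|t1] := leP (- delta) t => /=.
  have [t2|t2] := leP t delta; first by rewrite max_r.
  by rewrite gtr0_sg ?(lt_trans _ t2)// mulr1 max_r.
have td : t < delta by exact: lt_le_trans t1 Ndelta.
rewrite ltr0_sg ?(lt_trans t1)// ?oppr_lt0// mulrN1 min_l; last exact: ltW.
by rewrite max_l// ltW.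
Qed.

Lemma norm_trunc_le (t : R) : `|trunc delta t| <= delta.
Proof.
by rewrite truncE ler_norml le_max lexx/= ge_max ge_min lexx orbT andbT.
Qed.

Lemma continuous_trunc : continuous (trunc delta).
Proof.
have -> : trunc delta = fun t => Num.max (- delta) (Num.min t delta).
  by apply/funext => t; exact: truncE.
move=> t.
have C : {for t, continuous ((fun=> - delta : R^o) \max ((fun s : R => s : R^o) \min (fun=> delta)))}.
  apply: continuous_max; first exact: cst_continuous.
  by apply: continuous_min; [exact: cvg_id|exact: cst_continuous].
exact: C.
Qed.

Lemma affine_bounds (l t : R) : `|t| <= delta ->
  1 - `|l| * delta <= 1 + l * t <= 1 + `|l| * delta.
Proof.
move=> td; rewrite lerD2l lerD2l -ler_norml normrM.
by rewrite ler_wpM2l.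
Qed.

Lemma FfunE (t : R) : Ffun d m l1 l2 t = gamma3 d m + gamma4 d m l1 l2 * t.
Proof. by rewrite /Ffun /gamma3 /gamma4 (ltr0_norm hE2); ring. Qed.

Lemma Ffun_bounds (t : R) : `|t| <= delta ->
  gamma3 d m - `|gamma4 d m l1 l2| * delta <= Ffun d m l1 l2 t <=
  gamma3 d m + `|gamma4 d m l1 l2| * delta.
Proof. by move=> td; rewrite FfunE lerD2l lerD2l -ler_norml normrM ler_wpM2l. Qed.

Definition weight1 (t : R) : R := (1 + l1 * trunc delta t)^-1.

Definition weight2 (t : R) : R :=
  (1 + l2 * trunc delta t) / (1 + l1 * trunc delta t) / Ffun d m l1 l2 (trunc delta t).

Lemma gamma1_gt0 : 0 < gamma1 l1 delta.
Proof. by rewrite invr_gt0 ltr_wpDr// mulr_ge0// ltW. Qed.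

Lemma gamma2_gt0 : 0 < gamma2 l1 delta.
Proof. by rewrite invr_gt0. Qed.

Lemma gamma5_gt0 : 0 < gamma5 d m l1 l2 delta.
Proof.
have : 0 <= `|gamma4 d m l1 l2| * delta by rewrite mulr_ge0// ltW.
by move=> H; rewrite invr_gt0 (lt_le_trans hs2)// lerD2l (le_trans _ H)// oppr_le0.
Qed.

Lemma gamma6_gt0 : 0 < gamma6 d m l1 l2 delta.
Proof. by rewrite invr_gt0. Qed.

Lemma gamma8_gt0 : 0 < gamma8 l2 delta.
Proof. by rewrite ltr_wpDr// mulr_ge0// ltW. Qed.

Lemma weight1_bounds t : gamma1 l1 delta <= weight1 t <= gamma2 l1 delta.
Proof.
have /andP[a1 a2] := affine_bounds l1 (norm_trunc_le t).
have a0 := lt_le_trans hs1 a1.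
by apply/andP; split; rewrite lef_pV2// posrE// (lt_le_trans a0).
Qed.

Lemma weight2_bounds t :
  gamma7 l2 delta * gamma1 l1 delta * gamma5 d m l1 l2 delta <= weight2 t <=
  gamma8 l2 delta * gamma2 l1 delta * gamma6 d m l1 l2 delta.
Proof.
have /andP[w1 w2] := weight1_bounds t.
have /andP[b1 b2] := affine_bounds l2 (norm_trunc_le t).
have /andP[F1 F2] := Ffun_bounds (norm_trunc_le t).
have F0 := lt_le_trans hs2 F1.
have w0 := lt_le_trans gamma1_gt0 w1.
have b0 := lt_le_trans hs3 b1.
have f5 : gamma5 d m l1 l2 delta <= (Ffun d m l1 l2 (trunc delta t))^-1 <= gamma6 d m l1 l2 delta.
  by apply/andP; split; rewrite lef_pV2// posrE// (lt_le_trans F0).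
have /andP[f5l f5r] := f5.
have g1 := ltW gamma1_gt0; have g5 := ltW gamma5_gt0.
rewrite /weight2 -/(weight1 t); apply/andP; split.
  by apply: ler_pM => //; [exact: mulr_ge0 (ltW hs3) g1|exact: ler_pM (ltW hs3) g1 b1 w1].
by apply: ler_pM => //; [exact: mulr_ge0 (ltW b0) (ltW w0)|rewrite invr_ge0 ltW|
  exact: ler_pM (ltW b0) (ltW w0) b2 w2].
Qed.

Lemma continuous_affine_trunc (a l : R) : continuous (fun t => a + l * trunc delta t).
Proof.
move=> t; apply: cvgD; first exact: cvg_cst.
by apply: cvgMl_tmp; exact: continuous_trunc.
Qed.

Lemma continuous_weight1 : continuous weight1.
Proof.
move=> t; apply: cvgV; last exact: continuous_affine_trunc.
have /andP[a1 _] := affine_bounds l1 (norm_trunc_le t).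
by rewrite gt_eqF// (lt_le_trans hs1).
Qed.

Lemma continuous_weight2 : continuous weight2.
Proof.
move=> t; apply: cvgM; first apply: cvgM.
- exact: continuous_affine_trunc.
- exact: continuous_weight1.
- under eq_fun do rewrite FfunE; rewrite FfunE.
  apply: cvgV; last exact: continuous_affine_trunc.
  have /andP[F1 _] := Ffun_bounds (norm_trunc_le t).
  by rewrite -FfunE gt_eqF// (lt_le_trans hs2).
Qed.

End truncated_coefficients.

Section weighted_products.
Context {R : realType} {d : nat}.
Notation pt := 'rV[R]_d.
Notation leb := (lebesgue_rV d : {measure set pt -> \bar R}).
Variables (Omega : set pt) (mO : measurable Omega).
Variables (w : pt -> R) (lo hi : R).
Hypotheses (mw : measurable_fun Omega w) (lo0 : 0 <= lo)
  (whi : forall x, lo <= w x <= hi).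

Let w_ge0 x : 0 <= w x. Proof. by have /andP[/(le_trans lo0)] := whi x. Qed.

Let norm_w x : `|w x| <= `|hi|.
Proof. by have /andP[_ H] := whi x; rewrite ger0_norm// (le_trans H)// ler_norm. Qed.

Lemma L2_weight (f : pt -> R) : L2 Omega f -> L2 Omega (fun x => w x * f x).
Proof.
move=> f2; have [mf _] := f2.
apply: (L2_dominated mO _ (L2Z mO hi f2)); first exact: measurable_funM.
by move=> x _; rewrite !normrM ler_wpM2r.
Qed.

Lemma weighted_ip_le (f g : pt -> R) : L2 Omega f -> L2 Omega g ->
  `|\int[leb]_(x in Omega) (w x * (f x * g x))| <= hi * (L2norm Omega f * L2norm Omega g).
Proof.
move=> f2 g2; have wf2 := L2_weight f2.
have -> : \int[leb]_(x in Omega) (w x * (f x * g x)) = ip Omega (fun x => w x * f x) g.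
  by rewrite ipE; apply: eq_Rintegral => x _; rewrite mulrA.
rewrite (le_trans (L2_CauchySchwarz mO wf2 g2))// mulrA ler_wpM2r ?L2norm_ge0//.
have hi0 : 0 <= hi by have /andP[H1 H2] := whi 0; rewrite (le_trans lo0)// (le_trans H1).
rewrite -(ger0_norm hi0) -L2normZ//; apply: L2norm_le => //; first exact: L2Z.
by move=> x _; rewrite !normrM ler_wpM2r.
Qed.

Lemma weighted_ip_ge (f : pt -> R) : L2 Omega f ->
  lo * L2norm Omega f ^+ 2 <= \int[leb]_(x in Omega) (w x * (f x * f x)).
Proof.
move=> f2; rewrite L2norm_sqr ipE -RintegralZl//; last exact: L2_integrable_mul.
apply: le_Rintegral => //.
- by have := L2_integrable_mul mO (L2Z mO lo f2) f2; apply: eq_integrable => // x _ /=; rewrite mulrA.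
- by have := L2_integrable_mul mO (L2_weight f2) f2; apply: eq_integrable => // x _ /=; rewrite mulrA.
- move=> x _; rewrite ler_wpM2r -?expr2 ?sqr_ge0//.
  by have /andP[] := whi x.
Qed.

Lemma weighted_ipm_le m n (A B : pt -> 'M[R]_(m, n)) : L2m Omega A -> L2m Omega B ->
  `|\int[leb]_(x in Omega) (w x * frob (A x) (B x))| <=
  hi * (L2normv Omega A * L2normv Omega B).
Proof.
move=> A2 B2.
have wA2 : L2m Omega (fun x => w x *: A x).
  by move=> i j; under eq_fun do rewrite mxE; exact: L2_weight.
have -> : \int[leb]_(x in Omega) (w x * frob (A x) (B x)) = ipm Omega (fun x => w x *: A x) B.
  by rewrite ipmE; apply: eq_Rintegral => x _; rewrite frobZl.
rewrite (le_trans (L2normv_CauchySchwarz mO wA2 B2))// mulrA ler_wpM2r ?L2normv_ge0//.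
have hi0 : 0 <= hi by have /andP[H1 H2] := whi 0; rewrite (le_trans lo0)// (le_trans H1).
rewrite -ler_sqr ?nnegrE ?mulr_ge0 ?L2normv_ge0// exprMn !L2normv_sqr !ipmE.
rewrite -RintegralZl//; last exact: L2m_integrable.
apply: le_Rintegral => //; first exact: L2m_integrable.
  by have := L2m_integrable mO (L2mZ mO (hi ^+ 2) A2) A2; apply: eq_integrable => // x _ /=; rewrite frobZl.
move=> x _; rewrite frobZl frobZr mulrA ler_wpM2r ?frob_ge0// -expr2 ler_sqr ?nnegrE//.
by have /andP[] := whi x.
Qed.

Lemma weighted_ipm_ge m n (A : pt -> 'M[R]_(m, n)) : L2m Omega A ->
  lo * L2normv Omega A ^+ 2 <= \int[leb]_(x in Omega) (w x * frob (A x) (A x)).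
Proof.
move=> A2; rewrite L2normv_sqr ipmE -RintegralZl//; last exact: L2m_integrable.
have wA2 : L2m Omega (fun x => w x *: A x).
  by move=> i j; under eq_fun do rewrite mxE; exact: L2_weight.
apply: le_Rintegral => //.
- by have := L2m_integrable mO (L2mZ mO lo A2) A2; apply: eq_integrable => // x _ /=; rewrite frobZl.
- by have := L2m_integrable mO wA2 A2; apply: eq_integrable => // x _ /=; rewrite frobZl.
- move=> x _; rewrite ler_wpM2r ?frob_ge0//.
  by have /andP[] := whi x.
Qed.

End weighted_products.

(** * Discrete Gronwall lemma and the square roots of C4 *)

Section discrete_gronwall.
Context {R : realType}.

(** The error term sits at the new time level. Under [2 * kt <= 1] one has (1 - kt) (1 + 2 kt) >= 1,
    so a step costs a factor at most 1 + 2 kt <= exp(2 kt). Carrying the accumulated dissipation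
    through the induction bounds it together with the energy. *)
Lemma discrete_gronwall (N : nat) (E W : nat -> R) (kt : R) :
  0 <= kt -> 2 * kt <= 1 -> (forall n, 0 <= E n) -> (forall n, 0 <= W n) ->
  (forall n, (0 < n <= N)%N -> E n + W n <= E n.-1 + kt * E n) ->
  forall n, (n <= N)%N ->
  E n + \sum_(1 <= i < n.+1) W i <= E 0%N * expR (2 * kt * n%:R).
Proof.
move=> kt0 kt1 E0 W0 H; elim=> [|n IH] nN; first by rewrite big_geq// mulr0 expR0 mulr1 addr0.
have Hn := H n.+1 nN; have IHn := IH (ltnW nN).
rewrite big_nat_recr//=; set S := \sum_(1 <= i < n.+1) W i in IHn *.
have S0 : 0 <= S by apply: sumr_ge0.
pose G := E n.+1 + (S + W n.+1).
have HG : G <= (1 + 2 * kt) * (E n + S).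
  have G0 : 0 <= G by rewrite !addr_ge0.
  have G1 : (1 - kt) * G <= E n + S.
    have : kt * E n.+1 <= kt * G by rewrite ler_wpM2l// lerDl addr_ge0.
    by move: Hn => /=; rewrite /G; lra.
  have := ler_wpM2l (addr_ge0 ler01 (mulr_ge0 (ler0n _ 2) kt0)) G1.
  apply: le_trans; rewrite mulrA -[leLHS]mul1r ler_wpM2r//.
  by nra.
apply: (le_trans HG).
have -> : 2 * kt * n.+1%:R = 2 * kt * n%:R + 2 * kt by rewrite -[n.+1%:R]natr1; ring.
rewrite expRD mulrA [leLHS]mulrC.
apply: ler_pM => //; first by rewrite addr_ge0.
- by rewrite addr_ge0// mulr_ge0.
- exact: expR_ge1Dx.
Qed.

(* The Cauchy-Schwarz inequality, obtained by optimising over the parameter of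
   a weighted arithmetic-geometric inequality *)
Lemma le_sqrt_of_young (L G W : R) : 0 <= G -> 0 < W ->
  (forall e, 0 < e -> L <= e / 2 * G + (2 * e)^-1 * W) ->
  L <= Num.sqrt W * Num.sqrt G.
Proof.
move=> G0 W0 H; have [G1|G1] := eqVneq G 0.
  rewrite G1 sqrtr0 mulr0; apply/ler_addgt0Pl => e e0; rewrite addr0.
  (* For G = 0 this parameter makes the right-hand side equal to the arbitrary positive e. *)
  have := H (W / (2 * e)) (divr_gt0 W0 (mulr_gt0 (ltr0Sn R 1) e0)).
  rewrite G1 mulr0 add0r.
  have -> : (2 * (W / (2 * e)))^-1 * W = e by field; rewrite !gt_eqF.
  by [].
have Gp : 0 < G by rewrite lt_neqAle eq_sym G1.
pose g := Num.sqrt G; pose w := Num.sqrt W.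
have g0 : 0 < g by rewrite sqrtr_gt0.
have w0 : 0 < w by rewrite sqrtr_gt0.
(* [w / g] is the minimising parameter, at which both terms are equal. *)
have -> : Num.sqrt W * Num.sqrt G = w / g / 2 * g ^+ 2 + (2 * (w / g))^-1 * w ^+ 2.
  by rewrite -/g -/w; field; rewrite !gt_eqF.
have := H (w / g) (divr_gt0 w0 g0).
by rewrite /g /w !sqr_sqrtr// ltW.
Qed.

(** Cauchy-Schwarz applied jointly to the final velocity and to the whole sum, so that they share
    one bound G. Young's weights reproduce the dissipation; what remains is r^2 from the final value
    and [tau * r * (nuu / P ^+ 2 + al / 2)] per step, which sum to the square of the second root in
    C4. *)
Lemma velocity_terms_bound (r nuu al P tau T G : R) (vn gv : nat -> R) n :
  0 < r -> 0 < nuu -> 0 < al -> 0 < P -> 0 < tau -> 0 <= T -> n%:R * tau <= T ->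
  (forall i, 0 <= vn i) -> (forall i, 0 <= gv i) ->
  vn n ^+ 2 + \sum_(1 <= i < n.+1)
    tau * (nuu / r * gv i ^+ 2 + 2 * al / r * vn i ^+ 2) <= G ->
  r * vn n + \sum_(1 <= i < n.+1) tau * (nuu / P * gv i + al * vn i) <=
  r * Num.sqrt (1 + T / r * (nuu / P ^+ 2 + al / 2)) * Num.sqrt G.
Proof.
move=> r0 nu0 al0 P0 tau0 T0 nT vn0 gv0 HG.
have A0 : 0 <= nuu / P ^+ 2 + al / 2 by apply: addr_ge0; positivity.
have W1 : 0 < 1 + T / r * (nuu / P ^+ 2 + al / 2).
  by rewrite ltr_wpDr// mulr_ge0// divr_ge0// ltW.
have G0 : 0 <= G.
  apply: le_trans HG; rewrite addr_ge0 ?sqr_ge0// sumr_ge0// => i _.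
  by apply: mulr_ge0; [exact: ltW|apply: addr_ge0; positivity].
have -> : r * Num.sqrt (1 + T / r * (nuu / P ^+ 2 + al / 2)) =
    Num.sqrt (r ^+ 2 * (1 + T / r * (nuu / P ^+ 2 + al / 2))).
  by rewrite sqrtrM ?sqr_ge0// sqrtr_sqr gtr0_norm.
apply: le_sqrt_of_young => //; first by apply: mulr_gt0 => //; exact: exprn_gt0.
move=> e e0.
have Hi i : tau * (nuu / P * gv i + al * vn i) <=
    e / 2 * (tau * (nuu / r * gv i ^+ 2 + 2 * al / r * vn i ^+ 2)) +
    (2 * e)^-1 * (tau * (r * (nuu / P ^+ 2 + al / 2))).
  have Y1 := @young _ (e * (nuu / r)) (gv i) (nuu / P) (mulr_gt0 e0 (divr_gt0 nu0 r0)).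
  have Y2 := @young _ (e * (2 * al / r)) (vn i) al (mulr_gt0 e0 (divr_gt0 (mulr_gt0 (ltr0Sn R 1) al0) r0)).
  have -> : e / 2 * (tau * (nuu / r * gv i ^+ 2 + 2 * al / r * vn i ^+ 2)) +
    (2 * e)^-1 * (tau * (r * (nuu / P ^+ 2 + al / 2))) =
    tau * (e * (nuu / r) / 2 * gv i ^+ 2 + (2 * (e * (nuu / r)))^-1 * (nuu / P) ^+ 2 +
     (e * (2 * al / r) / 2 * vn i ^+ 2 + (2 * (e * (2 * al / r)))^-1 * al ^+ 2)).
    by field; rewrite !gt_eqF.
  by apply: ler_wpM2l; [exact: ltW|apply: lerD; rewrite mulrC].
have Hs : \sum_(1 <= i < n.+1) tau * (nuu / P * gv i + al * vn i) <=
    e / 2 * (\sum_(1 <= i < n.+1) tau * (nuu / r * gv i ^+ 2 + 2 * al / r * vn i ^+ 2)) +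
    (2 * e)^-1 * (n%:R * tau * (r * (nuu / P ^+ 2 + al / 2))).
  rewrite mulr_sumr.
  have -> : (2 * e)^-1 * (n%:R * tau * (r * (nuu / P ^+ 2 + al / 2))) =
    \sum_(1 <= i < n.+1) (2 * e)^-1 * (tau * (r * (nuu / P ^+ 2 + al / 2))).
    by rewrite sumr_const_nat subn1/= -mulr_natl; ring.
  by rewrite -big_split; apply: ler_sum.
have Hv : r * vn n <= e / 2 * vn n ^+ 2 + (2 * e)^-1 * r ^+ 2.
  by rewrite mulrC; exact: young.
have HT : (2 * e)^-1 * (n%:R * tau * (r * (nuu / P ^+ 2 + al / 2))) <=
    (2 * e)^-1 * (T * (r * (nuu / P ^+ 2 + al / 2))).
  apply: ler_wpM2l; first by positivity.
  by apply: ler_wpM2r => //; apply: mulr_ge0 => //; exact: ltW.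
have HGe := ler_wpM2l (ltW (divr_gt0 e0 (ltr0Sn R 1))) HG.
have -> : (2 * e)^-1 * (r ^+ 2 * (1 + T / r * (nuu / P ^+ 2 + al / 2))) =
  (2 * e)^-1 * r ^+ 2 + (2 * e)^-1 * (T * (r * (nuu / P ^+ 2 + al / 2))).
  by field; rewrite !gt_eqF.
rewrite mulrDr in HGe; lra.
Qed.

(** The displacement inequality telescopes and leaves [tau] times a sum of |v^i|^2, which the
    dissipation term with coefficient [2 * al / r] controls. The ratio of coefficients is
    [e * r / (2 * g1)], the first root in C4. *)
Lemma displacement_terms_bound (al r e P K g1 nuu tau G : R) (un vn gv : nat -> R) n :
  0 < al -> 0 < r -> 0 < e -> 0 < P -> 0 < K -> 0 < g1 -> 0 < nuu -> 0 < tau ->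
  (forall i, 0 <= un i) ->
  (forall i, (0 < i <= n)%N -> al / tau * (un i ^+ 2 - un i.-1 ^+ 2) <=
    e * (al * P * K) ^+ 2 / g1 * vn i ^+ 2) ->
  vn n ^+ 2 + \sum_(1 <= i < n.+1)
    tau * (nuu / r * gv i ^+ 2 + 2 * al / r * vn i ^+ 2) <= G ->
  al * un n <= al * un 0%N + al * P * K * Num.sqrt (e * r / (2 * g1)) * Num.sqrt G.
Proof.
move=> al0 r0 e0 P0 K0 g10 nu0 tau0 un0 H HG.
have V0 : 0 <= \sum_(1 <= i < n.+1) tau * (2 * al / r * vn i ^+ 2).
  by apply: sumr_ge0 => i _; positivity.
have VG : \sum_(1 <= i < n.+1) tau * (2 * al / r * vn i ^+ 2) <= G.
  apply: le_trans HG; rewrite -[leLHS]add0r; apply: lerD; first exact: sqr_ge0.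
  apply: ler_sum => i _; apply: ler_wpM2l; first exact: ltW.
  by rewrite lerDr; positivity.
have G0 := le_trans V0 VG.
have HS j : (j <= n)%N -> (al * un j) ^+ 2 <= (al * un 0%N) ^+ 2 +
    (al * P * K) ^+ 2 * (e * r / (2 * g1)) * \sum_(1 <= i < j.+1) tau * (2 * al / r * vn i ^+ 2).
  elim: j => [|j IH] jn; first by rewrite big_geq// mulr0 addr0.
  rewrite big_nat_recr//= mulrDr addrA.
  have := H j.+1 jn => /= Hj.
  have Hj' := ler_wpM2l (ltW (mulr_gt0 tau0 al0)) Hj.
  have IHj := IH (ltnW jn).
  have E1 : tau * al * (al / tau * (un j.+1 ^+ 2 - un j ^+ 2)) = (al * un j.+1) ^+ 2 - (al * un j) ^+ 2.
    by field; rewrite gt_eqF.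
  have E2 : tau * al * (e * (al * P * K) ^+ 2 / g1 * vn j.+1 ^+ 2) =
     (al * P * K) ^+ 2 * (e * r / (2 * g1)) * (tau * (2 * al / r * vn j.+1 ^+ 2)).
    by field; rewrite !gt_eqF.
  rewrite E1 E2 in Hj'; lra.
rewrite -ler_sqr ?nnegrE; last 2 first.
- by apply: mulr_ge0 => //; exact: ltW.
- by apply: addr_ge0; [apply: mulr_ge0 => //; exact: ltW|rewrite !mulr_ge0 ?sqrtr_ge0// ltW].
apply: (le_trans (HS n (leqnn n))).
have c0 : 0 <= e * r / (2 * g1) by positivity.
(* A sum of two squares is at most the square of the sum of the nonnegative numbers. *)
apply: (@le_trans _ _ ((al * un 0%N) ^+ 2 + (al * P * K * Num.sqrt (e * r / (2 * g1)) * Num.sqrt G) ^+ 2)).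
  rewrite lerD2l !exprMn !sqr_sqrtr// -!exprMn; apply: ler_wpM2l => //.
  by apply: mulr_ge0 => //; exact: sqr_ge0.
rewrite [leRHS]sqrrD -addrA lerD2l lerDr mulrn_wge0// !mulr_ge0 ?sqrtr_ge0//; exact: ltW.
Qed.

End discrete_gronwall.

(** * The fully discrete scheme *)

Lemma andP_leq_trans (i n N : nat) : (0 < i <= n)%N -> (n <= N)%N -> (0 < i <= N)%N.
Proof. by move=> /andP[-> i_n] /(leq_trans i_n) ->. Qed.

Lemma eq_le_intro (R : realType) (a b : R) : a = b -> a <= b.
Proof. by move=> ->. Qed.

Section scheme_estimates.
Context {R : realType} {d : nat}.
Notation pt := 'rV[R]_d.
Notation leb := (lebesgue_rV d : {measure set pt -> \bar R}).
Variables (Omega : set pt) (oO : open Omega).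
Variables (m : material R) (l1 l2 delta h tau P K C : R).
Hypotheses (halpha : 0 < alpha m) (hnu : 0 < nu m) (hrho : 0 < rho m)
  (hE1 : 0 < E1 m) (hE2 : E2 m < 0) (hdelta : 0 < delta)
  (htau : 0 < tau) (hh : 0 < h) (hP0 : 0 < P) (hK0 : 0 < K) (hC : 0 < C)
  (hs1 : 0 < 1 - `|l1| * delta)
  (hs2 : 0 < gamma3 d m - `|gamma4 d m l1 l2| * delta)
  (hs3 : 0 < 1 - `|l2| * delta)
  (hP : poincare_constant Omega P) (hK : korn_constant Omega K).
Variables (U X : set (pt -> pt)) (Q : set (pt -> R)).
Hypotheses (hU : U `<=` H10v Omega) (hX : X `<=` H10v Omega).
Variable PiU : (pt -> pt) -> (pt -> pt).
Hypothesis (hPiU : interpolation Omega C h (H10v Omega) U PiU).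
Variables (N : nat) (u v : nat -> pt -> pt) (p : nat -> pt -> R).
Hypotheses (hu0 : U (u 0%N)) (hv0 : Vh Omega X Q (v 0%N)).
Hypothesis hsol : discrete_solution Omega m l1 l2 delta tau N U X Q u v p.

Let mO : measurable Omega. Proof. exact: open_measurable_rV. Qed.

Lemma scheme_uU n : (n <= N)%N -> U (u n).
Proof. by case: n => [//|n] nN; have [] := hsol (nN : (1 <= n.+1 <= N)%N). Qed.

Lemma scheme_vV n : (n <= N)%N -> Vh Omega X Q (v n).
Proof. by case: n => [//|n] nN; have [] := hsol (nN : (1 <= n.+1 <= N)%N). Qed.

Lemma scheme_u_H10v n : (n <= N)%N -> H10v Omega (u n).
Proof. by move=> /scheme_uU/hU. Qed.

Lemma scheme_v_H10v n : (n <= N)%N -> H10v Omega (v n).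
Proof. by move=> /scheme_vV[/hX]. Qed.

(** The scheme is semi-implicit: the coefficients are frozen at [c], the divergence at the previous
    step, so the form is bilinear in y and z. *)
Definition stress (c : pt -> R) (y z : pt -> pt) : R :=
  (E1 m)^-1 * (\int[leb]_(x in Omega)
     (weight1 l1 delta (c x) * frob (eps Omega y x) (eps Omega z x))) +
  `|E2 m| / E1 m * (\int[leb]_(x in Omega)
     (weight2 m d l1 l2 delta (c x) * (divg Omega y x * divg Omega z x))).

Lemma scheme_displacement n z : (0 < n <= N)%N -> U z ->
  alpha m / tau * ipm Omega (fun x => u n x - u n.-1 x) z +
    stress (divg Omega (u n.-1)) (u n) z = alpha m * ipm Omega (v n) z.
Proof.
move=> nN Uz; have [_ _ _ /(_ z Uz) H _] := hsol nN.
rewrite !ipmE /stress -H addrA; congr (_ + _ * _ + _ * _); apply: eq_Rintegral => x _.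
  by rewrite mulrC.
by rewrite /weight2; ring.
Qed.

Lemma scheme_velocity n w : (0 < n <= N)%N -> X w ->
  rho m / tau * ipm Omega (fun x => v n x - v n.-1 x) w -
    ip Omega (p n) (divg Omega w) +
    nu m * ipm Omega (grad Omega (v n)) (grad Omega w) +
    alpha m * ipm Omega (v n) w =
  alpha m / tau * ipm Omega (fun x => u n x - u n.-1 x) w.
Proof. by move=> nN Xw; have [_ _ _ _ /(_ w Xw)] := hsol nN; rewrite !ipmE ipE. Qed.

Section stress_bounds.
Variable y : pt -> pt.
Hypothesis hy : H10v Omega y.

Let mdiv : measurable_fun Omega (divg Omega y).
Proof. by have [] := divg_L2 oO hy. Qed.

Let mw1 : measurable_fun Omega (fun x => weight1 l1 delta (divg Omega y x)).
Proof.
apply: (measurableT_comp _ mdiv); apply: continuous_measurable_fun.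
exact: continuous_weight1.
Qed.

Let mw2 : measurable_fun Omega (fun x => weight2 m d l1 l2 delta (divg Omega y x)).
Proof.
apply: (measurableT_comp _ mdiv); apply: continuous_measurable_fun.
exact: continuous_weight2.
Qed.

Lemma stress_ge z : H10v Omega z ->
  (E1 m)^-1 * (gamma1 l1 delta * L2normv Omega (eps Omega z) ^+ 2) +
    `|E2 m| / E1 m * (gamma7 l2 delta * gamma1 l1 delta * gamma5 d m l1 l2 delta *
       L2norm Omega (divg Omega z) ^+ 2) <= stress (divg Omega y) z z.
Proof.
move=> hz; have g1 := @gamma1_gt0 _ l1 delta hdelta; have g5 := gamma5_gt0 hdelta hs2.
apply: lerD; apply: ler_wpM2l.
- by rewrite invr_ge0 ltW.
- apply: (weighted_ipm_ge mO mw1 (ltW g1) (fun x => weight1_bounds hdelta hs1 (divg Omega y x))).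
  exact: eps_L2m.
- by rewrite divr_ge0// ltW.
- apply: (weighted_ip_ge mO mw2 _ (fun x => weight2_bounds hE2 hdelta hs1 hs2 hs3 (divg Omega y x))).
    by rewrite !mulr_ge0// ltW.
  exact: divg_L2.
Qed.

Lemma stress_le z w : H10v Omega z -> H10v Omega w ->
  `|stress (divg Omega y) z w| <= gamma2 l1 delta / E1 m *
    (L2normv Omega (eps Omega z) + `|E2 m| * gamma6 d m l1 l2 delta * gamma8 l2 delta *
      L2norm Omega (divg Omega z)) * L2normv Omega (grad Omega w).
Proof.
move=> hz hw; have g1 := @gamma1_gt0 _ l1 delta hdelta; have g5 := gamma5_gt0 hdelta hs2.
have g2 := @gamma2_gt0 _ l1 delta hs1; have g6 := gamma6_gt0 hs2; have g8 := @gamma8_gt0 _ l2 delta hdelta.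
have E1i : 0 <= (E1 m)^-1 by rewrite invr_ge0 ltW.
have B1 := weighted_ipm_le mO mw1 (ltW g1)
  (fun x => weight1_bounds hdelta hs1 (divg Omega y x)) (eps_L2m oO hz) (eps_L2m oO hw).
have lo0 : 0 <= gamma7 l2 delta * gamma1 l1 delta * gamma5 d m l1 l2 delta.
  by rewrite !mulr_ge0// ltW.
have B2 := weighted_ip_le mO mw2 lo0
  (fun x => weight2_bounds hE2 hdelta hs1 hs2 hs3 (divg Omega y x)) (divg_L2 oO hz) (divg_L2 oO hw).
have Ew := L2normv_eps oO hw; have Dw := L2norm_divg oO hw.
rewrite /stress (le_trans (ler_normD _ _))// !normrM (ger0_norm E1i) normr_id.
exact: (stress_assembly E1i (ltW g2) (normr_ge0 _) (ltW g6) (ltW g8)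
  (L2normv_ge0 _ _) (L2norm_ge0 _ _) B1 B2 Ew Dw).
Qed.

End stress_bounds.

Let un n := L2normv Omega (u n).
Let vn n := L2normv Omega (v n).
Let gv n := L2normv Omega (grad Omega (v n)).
Let k := 3 * C ^+ 2 / (nu m * rho m).
Let D3 := calD3 d m l1 l2 delta h tau.
Let D4 := calD4 d m l1 l2 delta h tau P K.

(** The discrete chain rule of implicit Euler. Its last square is the numerical dissipation, which
    for the displacement pays for the interpolation error. *)
Lemma half_identity (A B : pt -> pt) : L2m Omega A -> L2m Omega B ->
  ipm Omega (fun x => A x - B x) A =
  (L2normv Omega A ^+ 2 - L2normv Omega B ^+ 2 + L2normv Omega (fun x => A x - B x) ^+ 2) / 2.
Proof.
move=> A2 B2; have AB2 := L2mB mO A2 B2.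
rewrite !L2normv_sqr ipmBl// (ipmBl mO A2 B2 AB2) !ipmBr// (ipmC Omega B A).
by field.
Qed.

(** The first inequality drops the dissipation and serves to bound the displacement itself; the
    second is the energy balance, with its error term at the new time level. *)
Lemma scheme_step n : (0 < n <= N)%N ->
  alpha m / tau * (un n ^+ 2 - un n.-1 ^+ 2) <=
    E1 m * (alpha m * P * K) ^+ 2 / gamma1 l1 delta * vn n ^+ 2 /\
  (vn n ^+ 2 + k * D3 * un n ^+ 2) +
    tau * (nu m / rho m * gv n ^+ 2 + 2 * alpha m / rho m * vn n ^+ 2) <=
  (vn n.-1 ^+ 2 + k * D3 * un n.-1 ^+ 2) + k * D4 * tau * vn n ^+ 2.
Proof.
move=> nN; have /andP[n0 nN1] := nN.
have nN1' : (n.-1 <= N)%N by rewrite (leq_trans (leq_pred n)).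
have g1 := @gamma1_gt0 _ l1 delta hdelta; have g5 := gamma5_gt0 hdelta hs2.
have g2 := @gamma2_gt0 _ l1 delta hs1; have g6 := gamma6_gt0 hs2; have g8 := @gamma8_gt0 _ l2 delta hdelta.
have hun := scheme_u_H10v nN1; have hup := scheme_u_H10v nN1'.
have hvn := scheme_v_H10v nN1; have hvp := scheme_v_H10v nN1'.
have un2 := H10v_L2m hun; have up2 := H10v_L2m hup.
have vn2 := H10v_L2m hvn; have vp2 := H10v_L2m hvp.
have [Pi1 Pi2 Pi3] := hPiU.1 _ hvn.
have hz := hU Pi1; have z2 := H10v_L2m hz.
have du2 := L2mB mO un2 up2.
have vz2 := L2mB mO vn2 z2.
have HA : alpha m / tau * (un n ^+ 2 - un n.-1 ^+ 2 + L2normv Omega (fun x => u n x - u n.-1 x) ^+ 2) +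
    gamma1 l1 delta / E1 m * (L2normv Omega (eps Omega (u n)) ^+ 2 +
      2 * `|E2 m| * gamma5 d m l1 l2 delta * gamma7 l2 delta * L2norm Omega (divg Omega (u n)) ^+ 2) <=
    E1 m * (alpha m * P * K) ^+ 2 / gamma1 l1 delta * vn n ^+ 2.
  apply: (displacement_energy _ _ _ _ _ _ _ _ _ (half_identity un2 up2) _
    (stress_ge hup hun) (scheme_displacement nN (scheme_uU nN1))) => //; try exact: L2norm_ge0.
  rewrite (le_trans (ler_norm _))// (le_trans (L2normv_CauchySchwarz mO vn2 un2))//.
  exact: (mul_chain (L2normv_ge0 _ _) (ltW hP0) (hP hun) (hK hun)).
split.
  apply: (le_drop_ge0 _ (sqr_ge0 _) _ HA); first by rewrite divr_ge0// ltW.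
  rewrite mulr_ge0//; first by rewrite divr_ge0// ltW.
  rewrite addr_ge0 ?sqr_ge0// mulr_ge0 ?sqr_ge0//.
  by rewrite !mulr_ge0 ?(ltW g5) ?(ltW hs3).
have HV := scheme_velocity nN (scheme_vV nN1).1.
have [_ _ Qp _ _] := hsol nN.
(* The discrete velocity lies in [Vh], so the pressure disappears when the equation is tested with
   it. *)
have p0 : ip Omega (p n) (divg Omega (v n)) = 0.
  by rewrite ipE; exact: (scheme_vV nN1).2.
rewrite p0 subr0 -!L2normv_sqr (half_identity vn2 vp2) in HV.
apply: (velocity_energy halpha hnu hrho hE1 hE2 htau g1 g2 g5 hs3 (erefl k)
  (L2normv_ge0 _ _) (L2normv_ge0 _ _) (L2normv_ge0 _ _) (L2normv_ge0 _ _) (L2norm_ge0 _ _)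
  (sqr_ge0 _) erefl HV _ HA).
have HU := scheme_displacement nN Pi1.
have T1 := L2normv_CauchySchwarz mO du2 vz2.
rewrite ipmBr// in T1.
apply: (velocity_assembly halpha htau hP0 _ (L2normv_ge0 _ _) (L2normv_ge0 _ _) T1 Pi3
  (L2normv_CauchySchwarz mO vn2 z2) (hP hz) Pi2 (stress_le hup hun hz) HU).
apply: mulr_ge0; first by rewrite divr_ge0// ltW.
apply: addr_ge0; first exact: L2norm_ge0.
apply: mulr_ge0; last exact: L2norm_ge0.
by rewrite !mulr_ge0// ltW.
Qed.

Hypothesis hQ : Q `<=` L20 Omega.
Hypotheses (hQ0 : Q (fun=> 0)) (hQD : forall (a : R) f g, Q f -> Q g -> Q (fun x => a * f x + g x)).
Variable beta : R.
Hypotheses (hbeta : 0 < beta) (hinfsup : infsup Omega X Q = beta%:E).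

(** The infimum is at most the supremum attached to q, and that supremum is at most B divided by the
    norm of q. The infimum ranges over q of nonzero norm, so norm zero is treated apart. *)
Lemma infsup_bound q (B : R) : Q q -> 0 <= B ->
  (forall w, X w -> ip Omega q (divg Omega w) <= B * L2normv Omega (grad Omega w)) ->
  L2norm Omega q <= beta^-1 * B.
Proof.
move=> Qq B0 H; have [->|q0] := eqVneq (L2norm Omega q) 0.
  by rewrite mulr_ge0// invr_ge0 ltW.
have qp : 0 < L2norm Omega q by rewrite lt_neqAle eq_sym q0 L2norm_ge0.
suff : (beta%:E <= (B / L2norm Omega q)%:E)%E.
  by rewrite lee_fin ler_pdivlMr// => bq; rewrite ler_pdivlMl.
rewrite -hinfsup; apply: (@le_trans _ _ (ereal_sup [set
      ((\int[leb]_(x in Omega) (q x * divg Omega w x)) /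
       (L2norm Omega q * L2normv Omega (grad Omega w)))%:E
    | w in [set w : pt -> 'rV[R]_d | X w /\ L2normv Omega (grad Omega w) != 0]])).
  by apply: ereal_inf_lbound; exists q.
apply: ge_ereal_sup => _ [w [Xw w0] <-]; rewrite lee_fin -ipE.
have wp : 0 < L2normv Omega (grad Omega w) by rewrite lt_neqAle eq_sym w0 L2norm_ge0.
rewrite ler_pdivrMr ?mulr_gt0//.
have -> : B / L2norm Omega q * (L2norm Omega q * L2normv Omega (grad Omega w)) =
  B * L2normv Omega (grad Omega w) by field.
exact: H.
Qed.

Lemma scheme_p_Q n : (0 < n <= N)%N -> Q (p n).
Proof. by move=> nN; have [] := hsol nN. Qed.

Lemma pressure_integral_Q n : (n <= N)%N -> Q (pressure_integral tau p n).
Proof.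
elim: n => [_|n IH nN].
  by rewrite (_ : pressure_integral tau p 0 = fun=> 0)//; apply/funext => x; rewrite /pressure_integral big_geq.
rewrite (_ : pressure_integral tau p n.+1 = fun x => tau * p n.+1 x + pressure_integral tau p n x).
  by apply: hQD; [exact: scheme_p_Q|exact: IH (ltnW nN)].
by apply/funext => x; rewrite /pressure_integral big_nat_recr//= addrC.
Qed.

Lemma Q_L2 q : Q q -> L2 Omega q. Proof. by move=> /hQ[]. Qed.

(** Multiplication by [tau] cancels the difference quotients and the sum telescopes, so only values
    at times 0 and n remain beside a time sum of order one. *)
Lemma pressure_integral_ip n w : (n <= N)%N -> X w ->
  ip Omega (pressure_integral tau p n) (divg Omega w) =
  rho m * (ipm Omega (v n) w - ipm Omega (v 0%N) w) +
  \sum_(1 <= i < n.+1) tau * (nu m * ipm Omega (grad Omega (v i)) (grad Omega w) +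
    alpha m * ipm Omega (v i) w) -
  alpha m * (ipm Omega (u n) w - ipm Omega (u 0%N) w).
Proof.
move=> + Xw; have hw := hX Xw; have w2 := H10v_L2m hw; have dw2 := divg_L2 oO hw.
elim: n => [_|n IH nN].
  rewrite (_ : pressure_integral tau p 0 = fun=> 0 * 0); last first.
    by apply/funext => x; rewrite /pressure_integral big_geq// mulr0.
  by rewrite big_geq// ipZl ?mul0r ?subrr ?mulr0 ?addr0 ?subr0//; exact: L2_cst0.
rewrite (_ : pressure_integral tau p n.+1 = fun x => tau * p n.+1 x + pressure_integral tau p n x); last first.
  by apply/funext => x; rewrite /pressure_integral big_nat_recr//= addrC.
have p2 := Q_L2 (scheme_p_Q (nN : (0 < n.+1 <= N)%N)).
rewrite ipDl//; [|exact: L2Z|exact: Q_L2 (pressure_integral_Q (ltnW nN))].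
rewrite ipZl// IH ?(ltnW nN)//.
rewrite [in RHS](@big_nat_recr _ _ _ n.+1 1)//=.
have vS := H10v_L2m (scheme_v_H10v nN); have vn2 := H10v_L2m (scheme_v_H10v (ltnW nN)).
have uS := H10v_L2m (scheme_u_H10v nN); have un2 := H10v_L2m (scheme_u_H10v (ltnW nN)).
have := @scheme_velocity n.+1 w nN Xw.
rewrite /= (ipmBl mO vS vn2 w2) (ipmBl mO uS un2 w2).
move=> HV.
have {}HV : ip Omega (p n.+1) (divg Omega w) =
  rho m / tau * (ipm Omega (v n.+1) w - ipm Omega (v n) w) +
  nu m * ipm Omega (grad Omega (v n.+1)) (grad Omega w) + alpha m * ipm Omega (v n.+1) w -
  alpha m / tau * (ipm Omega (u n.+1) w - ipm Omega (u n) w) by rewrite -HV; ring.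
rewrite HV; field.
by rewrite gt_eqF.
Qed.

(** Every term is bounded by a multiple of P |grad w|. The initial displacement enters here with one
    factor [alpha]; bounding the displacement at time n adds another, whence the 2 in C3. *)
Lemma pressure_integral_bound n : (n <= N)%N ->
  L2norm Omega (pressure_integral tau p n) <= beta^-1 * (P * (
    (rho m * vn n + \sum_(1 <= i < n.+1) tau * (nu m / P * gv i + alpha m * vn i)) +
    (rho m * vn 0%N + alpha m * un n + alpha m * un 0%N))).
Proof.
move=> nN; apply: infsup_bound; first exact: pressure_integral_Q.
  apply: mulr_ge0; first exact: ltW.
  have S0 : 0 <= \sum_(1 <= i < n.+1) tau * (nu m / P * gv i + alpha m * vn i).
    apply: sumr_ge0 => i _; apply: mulr_ge0; first exact: ltW.
    by apply: addr_ge0; apply: mulr_ge0; rewrite ?L2norm_ge0// ?divr_ge0// ltW.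
  apply: addr_ge0; first apply: addr_ge0 => //; first by apply: mulr_ge0; [exact: ltW|exact: L2norm_ge0].
  by apply: addr_ge0; [apply: addr_ge0|]; apply: mulr_ge0; rewrite ?L2norm_ge0// ltW.
move=> w Xw; have hw := hX Xw; have w2 := H10v_L2m hw; have gw2 := grad_L2m hw.
rewrite pressure_integral_ip//; have Pw := hP hw.
set gw := L2normv Omega (grad Omega w) in Pw *.
have gw0 : 0 <= gw by exact: L2norm_ge0.
have HC (c : R) (A : pt -> pt) : 0 <= c -> L2m Omega A ->
    `|c * ipm Omega A w| <= c * L2normv Omega A * (P * gw).
  move=> c0 A2; rewrite normrM ger0_norm// -mulrA; apply: ler_wpM2l => //.
  apply: (le_trans (L2normv_CauchySchwarz mO A2 w2)).
  by apply: ler_wpM2l => //; exact: L2norm_ge0.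
have Hv i : (i <= N)%N -> L2m Omega (v i) by move=> iN; apply: H10v_L2m; exact: scheme_v_H10v.
have Hu i : (i <= N)%N -> L2m Omega (u i) by move=> iN; apply: H10v_L2m; exact: scheme_u_H10v.
have r0 := ltW hrho; have al0 := ltW halpha.
have B1 := HC _ _ r0 (Hv n nN); have B2 := HC _ _ r0 (Hv 0%N (leq0n _)).
have B3 := HC _ _ al0 (Hu n nN); have B4 := HC _ _ al0 (Hu 0%N (leq0n _)).
have BS : \sum_(1 <= i < n.+1) tau * (nu m * ipm Omega (grad Omega (v i)) (grad Omega w) +
    alpha m * ipm Omega (v i) w) <=
    (\sum_(1 <= i < n.+1) tau * (nu m / P * gv i + alpha m * vn i)) * (P * gw).
  rewrite mulr_suml; apply: ler_sum_nat => i /andP[i1 i2].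
  have iN : (i <= N)%N by rewrite (leq_trans _ nN).
  rewrite -mulrA; apply: ler_wpM2l; first exact: ltW.
  rewrite mulrDl; apply: lerD; last exact: (le_trans (ler_norm _) (HC _ _ al0 (Hv i iN))).
  (* The viscous term is already paired with grad w and needs no Poincaré inequality; dividing by P
     compensates the common factor. *)
  have -> : nu m / P * gv i * (P * gw) = nu m * (gv i * gw) by field; rewrite gt_eqF.
  apply: ler_wpM2l; first exact: ltW.
  have gi2 := grad_L2m (scheme_v_H10v iN).
  exact: (le_trans (ler_norm _) (L2normv_CauchySchwarz mO gi2 gw2)).
move: B1 B2 B3 B4 BS; rewrite !ler_norml.
rewrite -/(vn n) -/(vn 0%N) -/(un n) -/(un 0%N).
move: (ipm Omega (v n) w) (ipm Omega (v 0%N) w) (ipm Omega (u n) w) (ipm Omega (u 0%N) w).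
move: (vn n) (vn 0%N) (un n) (un 0%N) => a1 a2 a3 a4 i1 i2 i3 i4.
move: (\sum_(1 <= i < n.+1) _) (\sum_(1 <= i < n.+1) _) => s1 s2.
move=> /andP[b1 b1'] /andP[b2 b2'] /andP[b3 b3'] /andP[b4 b4'] bs.
have -> : P * (rho m * a1 + s1 + (rho m * a2 + alpha m * a3 + alpha m * a4)) * gw =
  rho m * a1 * (P * gw) + s1 * (P * gw) + rho m * a2 * (P * gw) + alpha m * a3 * (P * gw) +
  alpha m * a4 * (P * gw) by ring.
lra.
Qed.

Theorem pressure_estimate T : T = N%:R * tau -> 2 * (k * D4 * tau) <= 1 ->
  let C1 := vn 0%N ^+ 2 + 3 * C ^+ 2 * D3 / (nu m * rho m) * un 0%N ^+ 2 in
  let C2 := 9 * C ^+ 2 * D4 / (nu m * rho m) in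
  let C3 := beta^-1 * P * (rho m * vn 0%N + 2 * alpha m * un 0%N) in
  let C4 := P / beta *
    (alpha m * P * K * Num.sqrt (E1 m * rho m / (2 * gamma1 l1 delta)) +
     rho m * Num.sqrt (1 + T / rho m * (nu m / P ^+ 2 + alpha m / 2))) in
  forall n, (n <= N)%N ->
  L2norm Omega (pressure_integral tau p n) <= C3 + C4 * Num.sqrt (C1 * expR (C2 * T)).
Proof.
move=> TE kt1 C1 C2 C3 C4 n nN.
have g1 := @gamma1_gt0 _ l1 delta hdelta; have g5 := gamma5_gt0 hdelta hs2.
have g2 := @gamma2_gt0 _ l1 delta hs1; have g6 := gamma6_gt0 hs2; have g8 := @gamma8_gt0 _ l2 delta hdelta.
have k0 : 0 < k by rewrite divr_gt0 ?mulr_gt0 ?exprn_gt0.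
have D30 : 0 < D3 := calD3_gt0 _ halpha hE1 htau g1 g2 g5 hs3.
have D40 : 0 < D4 := calD4_gt0 _ halpha hE1 htau hP0 hK0 g1 g2 g5 hs3.
have vn0 i : 0 <= vn i by exact: L2norm_ge0.
have gv0 i : 0 <= gv i by exact: L2norm_ge0.
have un0 i : 0 <= un i by exact: L2norm_ge0.
have T0 : 0 <= T by rewrite TE mulr_ge0// ltW.
pose W i := tau * (nu m / rho m * gv i ^+ 2 + 2 * alpha m / rho m * vn i ^+ 2).
have W0 i : 0 <= W i.
  by apply: mulr_ge0; [exact: ltW|apply: addr_ge0; positivity].
have E0 i : 0 <= vn i ^+ 2 + k * D3 * un i ^+ 2 by apply: addr_ge0; positivity.
have kt0 : 0 <= k * D4 * tau by positivity.
have HE i : (0 < i <= N)%N -> vn i ^+ 2 + k * D3 * un i ^+ 2 + W i <=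
    vn i.-1 ^+ 2 + k * D3 * un i.-1 ^+ 2 + k * D4 * tau * (vn i ^+ 2 + k * D3 * un i ^+ 2).
  move=> iN; apply: (le_trans (scheme_step iN).2); rewrite lerD2l; apply: ler_wpM2l => //.
  by rewrite lerDl; positivity.
have HG := discrete_gronwall kt0 kt1 E0 W0 HE nN.
have nT : n%:R * tau <= T by rewrite TE ler_wpM2r ?ler_nat// ltW.
have {}HG : vn n ^+ 2 + \sum_(1 <= i < n.+1) W i <= C1 * expR (C2 * T).
  apply: (@le_trans _ _ (vn n ^+ 2 + k * D3 * un n ^+ 2 + \sum_(1 <= i < n.+1) W i)).
    by rewrite lerD2r lerDl; positivity.
  apply: (le_trans HG); have -> : vn 0%N ^+ 2 + k * D3 * un 0%N ^+ 2 = C1 by rewrite /C1 /k; ring.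
  apply: ler_wpM2l; first by rewrite (_ : C1 = vn 0%N ^+ 2 + k * D3 * un 0%N ^+ 2)// /C1 /k; ring.
  rewrite ler_expR.
  (* Gronwall yields the exponent [2 * k * D4 * n * tau], at most [2 * k * D4 * T]; the constant 9
     in C2 corresponds to 3 in place of 2. *)
  have -> : C2 * T = 3 * (k * D4) * T by rewrite /C2 /k; ring.
  have := ler_wpM2l (ltW (mulr_gt0 k0 D40)) nT.
  have : 0 <= k * D4 * T by rewrite mulr_ge0// ltW// mulr_gt0.
  lra.
have Hv := velocity_terms_bound hrho hnu halpha hP0 htau T0 nT vn0 gv0 HG.
have Hu := displacement_terms_bound halpha hrho hE1 hP0 hK0 g1 hnu htau un0
  (fun i iN => (scheme_step (andP_leq_trans iN nN)).1) HG.
apply: (le_trans (pressure_integral_bound nN)).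
apply: (@le_trans _ _ (beta^-1 * (P * (
   rho m * Num.sqrt (1 + T / rho m * (nu m / P ^+ 2 + alpha m / 2)) * Num.sqrt (C1 * expR (C2 * T)) +
   (rho m * vn 0%N + (alpha m * un 0%N + alpha m * P * K *
      Num.sqrt (E1 m * rho m / (2 * gamma1 l1 delta)) * Num.sqrt (C1 * expR (C2 * T))) +
    alpha m * un 0%N))))).
  apply: ler_wpM2l; first by rewrite invr_ge0 ltW.
  apply: ler_wpM2l; first exact: ltW.
  by apply: lerD => //; apply: lerD => //; apply: lerD.
by apply: eq_le_intro; rewrite /C3 /C4; ring.
Qed.

End scheme_estimates.

Lemma bounded_L2_one (R : realType) (d : nat) (Omega : set 'rV[R]_d) :
  measurable Omega -> bounded_set Omega -> L2 Omega (fun=> 1).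
Proof.
move=> mO bO; split; first exact: measurable_cst.
have [M [_ OM]] := bounded_sub_cbox bO.
rewrite (eq_integral (cst 1%E)); last by move=> x _; rewrite expr1n.
rewrite integral_cst// mul1e.
apply: (le_lt_trans _ (lebesgue_cbox_lty (fun=> - M) (fun=> M))).
by apply: le_measure; rewrite ?inE//; exact: measurable_cbox.
Qed.

Theorem proposition3 (R : realType) (d : nat) (hd : d = 2%N \/ d = 3%N)
  (Omega : set 'rV[R]_d) (hOmega : domain Omega) (T : R) (hT : 0 < T)
  (m : material R) (halpha : 0 < alpha m) (hnu : 0 < nu m) (hrho : 0 < rho m)
  (hE1 : 0 < E1 m) (hE2 : E2 m < 0) (hE : 0 < E1 m - d%:R * `|E2 m|)
  (u0 v0 : 'rV[R]_d -> 'rV[R]_d) (hu0 : H10v Omega u0) (hv0 : Vdiv Omega v0)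
  (lbar Dbound : R)
  (hstanding : standing_assumption T Omega m u0 v0 lbar Dbound)
  (delta : R) (hdelta : Dbound <= delta)
  (P K : R) (hP0 : 0 < P) (hP : poincare_constant Omega P)
  (hK0 : 0 < K) (hK : korn_constant Omega K)
  (sizes : set R) (U X : R -> set ('rV[R]_d -> 'rV[R]_d))
  (Q : R -> set ('rV[R]_d -> R))
  (hsizes : forall h, sizes h -> 0 < h)
  (hU : forall h, sizes h -> fe_space Omega h (U h) /\ U h `<=` H10v Omega)
  (hX : forall h, sizes h -> fe_space Omega h (X h) /\ X h `<=` H10v Omega)
  (hQ : forall h, sizes h -> fe_space Omega h (Q h) /\ Q h `<=` L20 Omega)
  (beta : R) (hbeta : 0 < beta)
  (hinfsup : forall h, sizes h -> infsup Omega (X h) (Q h) = beta%:E)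
  (PiU PiX PiV : R -> ('rV[R]_d -> 'rV[R]_d) -> ('rV[R]_d -> 'rV[R]_d))
  (C : R) (hC : 0 < C)
  (hPiU : forall h, sizes h ->
     interpolation Omega C h (H10v Omega) (U h) (PiU h))
  (hPiX : forall h, sizes h ->
     interpolation Omega C h (H10v Omega) (X h) (PiX h))
  (hPiV : forall h, sizes h ->
     interpolation Omega C h (Vdiv Omega) (Vh Omega (X h) (Q h)) (PiV h))
  (l1 l2 : R) (hl1 : `|l1| <= lbar) (hl2 : `|l2| <= lbar)
  (hs1 : 0 < 1 - `|l1| * delta)
  (hs2 : 0 < gamma3 d m - `|gamma4 d m l1 l2| * delta)
  (hs3 : 0 < 1 - `|l2| * delta)
  (h : R) (hh : sizes h) (N : nat) (hN : (1 < N)%N)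
  (u v : nat -> 'rV[R]_d -> 'rV[R]_d) (p : nat -> 'rV[R]_d -> R)
  (hinit_u : u 0%N = PiU h u0) (hinit_v : v 0%N = PiV h v0) :
  let tau := T / N%:R in
  let D3 := calD3 d m l1 l2 delta h tau in
  let D4 := calD4 d m l1 l2 delta h tau P K in
  let C1 := L2normv Omega (v 0%N) ^+ 2 +
    3 * C ^+ 2 * D3 / (nu m * rho m) * L2normv Omega (u 0%N) ^+ 2 in
  let C2 := 9 * C ^+ 2 * D4 / (nu m * rho m) in
  let C3 := beta^-1 * P * (rho m * L2normv Omega (v 0%N) +
    2 * alpha m * L2normv Omega (u 0%N)) in
  let C4 := P / beta *
    (alpha m * P * K * Num.sqrt (E1 m * rho m / (2 * gamma1 l1 delta)) +
     rho m * Num.sqrt (1 + T / rho m * (nu m / P ^+ 2 + alpha m / 2))) in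
  discrete_solution Omega m l1 l2 delta tau N (U h) (X h) (Q h) u v p ->
  6 * C ^+ 2 * D4 / (nu m * rho m) * tau <= 1 ->
  Wm1inf T Omega (step_function tau N p) /\
  (Wm1norm T Omega (step_function tau N p) <=
     (3 * (C3 + C4 * Num.sqrt (C1 * expR (C2 * T))))%:E)%E.

Proof.
move=> tau D3 D4 C1 C2 C3 C4 hsol hstep.
have [_ oO _ bO _] := hOmega.
have mO := open_measurable_rV oO.
have [_ D0 _] := hstanding.
have delta0 : 0 < delta := lt_le_trans D0 hdelta.
have N0 : (0 : R) < N%:R by rewrite ltr0n (ltn_trans _ hN).
have tau0 : 0 < tau by rewrite divr_gt0.
have TE : T = N%:R * tau by rewrite /tau mulrCA divff ?mulr1// gt_eqF.
have [[Q0 QD _] QL] := hQ h hh.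
have Uu0 : U h (u 0%N) by rewrite hinit_u; have [] := (hPiU h hh).1 _ hu0.
have Vv0 : Vh Omega (X h) (Q h) (v 0%N) by rewrite hinit_v; have [] := (hPiV h hh).1 _ hv0.
(* The restriction on the time step, with 6 = 2 * 3, is exactly the smallness that the implicit
   Gronwall lemma requires. *)
have kt1 : 2 * (3 * C ^+ 2 / (nu m * rho m) * D4 * tau) <= 1.
  by move: hstep; congr (_ <= 1); ring.
have p2 i : (i < N)%N -> L2 Omega (p i.+1).
  by move=> iN; have [_ _ Qp _ _] := hsol i.+1 iN; have [] := QL _ Qp.
have one2 := bounded_L2_one mO bO.
have HM n := @pressure_estimate R d Omega oO m l1 l2 delta h tau P K C
  halpha hnu hrho hE1 hE2 delta0 tau0 hP0 hK0 hC hs1 hs2 hs3 hP hK (U h) (X h) (Q h)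
  (hU h hh).2 (hX h hh).2 (PiU h) (hPiU h hh) N u v p Uu0 Vv0 hsol QL Q0 QD beta hbeta
  (hinfsup h hh) T TE kt1 n.
split; first exact: (Wm1inf_step_function mO one2 tau0 TE p2 HM).
exact: (Wm1norm_step_function mO one2 tau0 TE p2 HM).
Qed.
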